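(* Let $n\in\mathbb{N}$, $1<\alpha\le 3/2$, $\lambda\in\mathbb{C}$ with $|\lambda|\le\frac{1}{n+1}$, and let $f\in\mathcal{F}(\alpha,\lambda,n)$. Then for $0<r<1$, $$2\pi\int_0^r\left(1-|\lambda|^2\xi^{2n}\right)(1-\xi)^2\xi\,d\xi\le\mathcal{A}\left(f(\mathbb{D}_r)\right)\le2\pi\int_0^r\left(1-|\lambda|^2\xi^{2n}\right)(1+\xi)^2\xi\,d\xi.$$
   Context: $\mathbb{D}=\{z\in\mathbb{C}:|z|<1\}$, $\mathbb{N}=\{1,2,3,\ldots\}$. For $0<r<1$, $\mathbb{D}_r=r\mathbb{D}=\{z:|z|<r\}$, and $\mathcal{A}(f(\mathbb{D}_r))$ denotes the area of $f(\mathbb{D}_r)$. $\mathcal{H}$ is the class of harmonic functions $f=h+\overline{g}$ in $\mathbb{D}$, with $h,g$ analytic in $\mathbb{D}$, normalized by $f(0)=f_z(0)-1=0$, of the form $f(z)=z+\sum_{k=2}^{\infty}a_kz^k+\overline{\sum_{k=1}^{\infty}b_kz^k}$. For $n\in\mathbb{N}$, $1<\alpha\le 3/2$ and $\lambda\in\mathbb{C}$ with $|\lambda|\le\frac1{n+1}$, $\mathcal{F}(\alpha,\lambda,n)$ is the class of $f=h+\overline{g}\in\mathcal{H}$ such that $\mathrm{Re}\left(1+\frac{zh''(z)}{h'(z)}\right)<\alpha$ and $g'(z)=\lambda z^nh'(z)$ for all $z\in\mathbb{D}$. *)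

(* Defs.v *)
(* MathComp-Analysis; C is modelled by R[i] (mathcomp-real-closed) for an
   arbitrary R : realType. *)
From HB Require Import structures.
From mathcomp Require Export all_boot all_order all_algebra.
From mathcomp Require Export complex.
From mathcomp Require Export all_classical all_reals all_analysis.
Set Implicit Arguments.
Unset Strict Implicit.
Unset Printing Implicit Defensive.
Export Order.TTheory GRing.Theory Num.Theory numFieldNormedType.Exports.
Export ComplexField.Normc.
Local Open Scope ring_scope.
Local Open Scope complex_scope.
Local Open Scope classical_set_scope.

(* The alias [^o] is what gives R[i] its topology and its structure of normed
   space over itself, so that [derivable] and [derive1] on [Cplx R -> Cplx R] are
   complex differentiability and the complex derivative. *)
Notation Cplx R := ((R[i])^o).

Definition disc (R : realType) (r : R) : set (Cplx R) := [set z | normc z < r].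

Definition analytic_in (R : realType) (D : set (Cplx R))
    (h : Cplx R -> Cplx R) : Prop :=
  forall z, D z -> derivable h z 1.

(* Derivative at the real point 0 of a complex-valued function of a real
   variable. *)
Definition derive_at0 (R : realType) (c : R -> Cplx R) : Cplx R :=
  (fun t => complex.Re (c t))^`() 0 +i* (fun t => complex.Im (c t))^`() 0.

(* f_z = (f_x - i f_y) / 2 *)
Definition wirtinger_z (R : realType) (f : Cplx R -> Cplx R) (z : Cplx R) :
    Cplx R :=
  2^-1 * (derive_at0 (fun t => f (z + (t +i* 0)))
          - 'i%C * derive_at0 (fun t => f (z + (0 +i* t)))).

(* f = h + conj g is in the class H, with h and g the analytic and
   co-analytic parts. *)
Definition classH_parts (R : realType) (f h g : Cplx R -> Cplx R) : Prop :=
  [/\ analytic_in (disc 1) h /\ analytic_in (disc 1) g,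
      forall z, disc 1 z -> f z = h z + conjc (g z),
      f 0 = 0 /\ wirtinger_z f 0 = 1 &
      exists a b : nat -> Cplx R, forall z, disc 1 z ->
        (fun N => z + \sum_(2 <= k < N) a k * z ^+ k) @ \oo --> h z /\
        (fun N => \sum_(1 <= k < N) b k * z ^+ k) @ \oo --> g z].

(* h' z != 0 is part of the first condition: the quotient has to be defined,
   whereas division by 0 in R[i] returns 0. *)
Definition classF (R : realType) (alpha : R) (lambda : Cplx R) (n : nat)
    (f : Cplx R -> Cplx R) : Prop :=
  exists h g : Cplx R -> Cplx R,
    [/\ classH_parts f h g,
        forall z, disc 1 z ->
          derive1 h z != 0 /\ complex.Re (1 + z * derive1 (derive1 h) z / derive1 h z) < alpha &
        forall z, disc 1 z -> derive1 g z = lambda * z ^+ n * derive1 h z].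

(* Planar Lebesgue measure, with C identified with R * R. *)
Definition area (R : realType) (A : set (Cplx R)) : \bar R :=
  (@lebesgue_measure R \x @lebesgue_measure R)%E
    [set p : R * R | A (p.1 +i* p.2)].

(* Main.v *)
Require Import Defs.
From HB Require Import structures.
From mathcomp Require Import measurable_realfun.
From mathcomp Require Import ring lra.
Set Implicit Arguments.
Unset Strict Implicit.
Unset Printing Implicit Defensive.
Local Open Scope ring_scope.
Local Open Scope complex_scope.
Local Open Scope classical_set_scope.

(** The Jacobian of f = h + conj g is |h'|^2 - |g'|^2 = |h'|^2 (1 - |lambda|^2 |z|^(2n)).
    So the theorem follows from three facts: the estimate
    1 - |z| <= |h' z| <= 1 + |z|, the univalence of f, and the area formula for f.

    The estimate on h' is a Schwarz lemma.  Write h' = 1 - z psi.  The hypothesis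
    gives Re (z h'' / h') < 1/2, and Jack's argument shows that |z psi| cannot
    reach 1: at a first point where it did, z h'' / h' would have real part at
    least 1/2 ([jack_omega_lt1]).  Hence |psi| <= 1 by the maximum principle
    ([jack_psi_le1]), so that |1 - h'| <= |z|; in particular Re h' > 0.  The
    functions are handled through their power series, with Taylor estimates
    that are uniform on smaller discs ([psum_taylor1], [psum_taylor2]); the
    maximum principle comes from averaging over four points.

    For the univalence, f is injective as soon as h + e g is for every unimodular
    e ([harmonic_inj]).  The derivative of h + e g is h' times 1 + mu z^n with
    mu = e lambda, and 1 + mu z^n is the derivative of
    phi z = z + mu z^(n+1) / (n+1), which maps discs to convex sets because
    |mu| <= 1 / (n+1) ([phi_convex]).  As Re h' > 0, the function h + e g is
    strictly monotone along the preimage under phi of a segment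
    ([close_to_convex_inj]): it is close to convex.

    The area is computed in polar coordinates, for the map
    (s, t) |-> f (s e^(it)) on [rho, r] x [0, 2 pi].  A fine grid is laid on this rectangle.
    The image of each cell lies between two parallelograms whose areas both
    are the Jacobian times the area of the cell, up to a factor tending to 1:
    the outer one by a first-order expansion, the inner one by minimising the
    distance to a given point ([cell_image_sub], [cell_image_sup]).  The areas of parallelograms
    come from Fubini's theorem ([area_parallelogram]).  Injectivity makes the
    images of the cells disjoint, and bounds of the Jacobian that depend on s
    alone turn the sums over the grid into Riemann sums ([area_le_integral],
    [integral_le_area]).  Finally rho tends to 0. *)

(** * The modulus of a complex number *)

Section Norm.
Variable R : realType.
Implicit Types (x y z w : R[i]).

Lemma normc_ge0 z : 0 <= normc z.
Proof. by case: z => a b; exact: sqrtr_ge0. Qed.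

Lemma sqr_normcE z : normc z ^+ 2 = complex.Re z ^+ 2 + complex.Im z ^+ 2.
Proof. by case: z => a b /=; rewrite sqr_sqrtr // addr_ge0 // sqr_ge0. Qed.

Lemma le_normcB x y : normc (x - y) <= normc x + normc y.
Proof. by rewrite -(normcN y); exact: le_normcD. Qed.

Lemma normcC x y : normc (x - y) = normc (y - x).
Proof. by rewrite -normcN opprB. Qed.

Lemma le_normc_tri x y z : normc (x - z) <= normc (x - y) + normc (y - z).
Proof. by apply: le_trans (le_normcD _ _); rewrite addrA subrK. Qed.

Lemma le_normc_sub x y : normc x - normc y <= normc (x - y).
Proof. by rewrite lerBlDr; apply: le_trans (le_normcD _ _); rewrite subrK. Qed.

Lemma normcX z n : normc (z ^+ n) = normc z ^+ n.
Proof. by elim: n => [|n IH]; rewrite ?expr0 ?normc1 // !exprS normcM IH. Qed.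

Lemma normcR (a : R) : normc a%:C = `|a|.
Proof. by rewrite /= expr0n addr0 sqrtr_sqr. Qed.

Lemma normc_nat n : normc (n%:R : R[i]) = n%:R.
Proof. by rewrite -(rmorph_nat (real_complex R)) normcR ger0_norm. Qed.

Lemma normc_conj z : normc z^* = normc z.
Proof. by case: z => a b /=; rewrite sqrrN. Qed.

Lemma normc_Re z : `|complex.Re z| <= normc z.
Proof.
by rewrite -(@ler_pXn2r _ 2) ?nnegrE ?normc_ge0 // sqr_normcE real_normK
  ?num_real // lerDl sqr_ge0.
Qed.

Lemma normc_Im z : `|complex.Im z| <= normc z.
Proof.
by rewrite -(@ler_pXn2r _ 2) ?nnegrE ?normc_ge0 // sqr_normcE real_normK
  ?num_real // lerDr sqr_ge0.
Qed.

Lemma Re_le_normc z : complex.Re z <= normc z.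
Proof. exact: le_trans (ler_norm _) (normc_Re z). Qed.

Lemma normc_le_ReIm z : normc z <= `|complex.Re z| + `|complex.Im z|.
Proof.
rewrite [in leLHS](complexE z); apply: le_trans (le_normcD _ _) _.
by rewrite normcM !normcR /= expr0n expr1n add0r sqrtr1 mul1r.
Qed.

Lemma normc_eq0 z : (normc z == 0) = (z == 0).
Proof. by apply/eqP/eqP => [/eq0_normc //|->]; exact: normc0. Qed.

Lemma normc_gt0 z : (0 < normc z) = (z != 0).
Proof. by rewrite lt_def normc_ge0 andbT normc_eq0. Qed.

Lemma normc_sum (I : Type) (r : seq I) (P : pred I) (F : I -> R[i]) :
  normc (\sum_(i <- r | P i) F i) <= \sum_(i <- r | P i) normc (F i).
Proof. exact: (@ler_norm_sum R (Rcomplex R)). Qed.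

Lemma mul_conj_normc z : z * z^* = (normc z ^+ 2)%:C.
Proof.
rewrite sqr_normcE; case: z => a b; apply/eqP.
rewrite eq_complex /=; apply/andP; split; apply/eqP; ring.
Qed.

Lemma normc_norm z : `|z| = (normc z)%:C.
Proof. by rewrite normc_def; case: z. Qed.

Lemma ReD z w : complex.Re (z + w) = complex.Re z + complex.Re w.
Proof. by case: z; case: w. Qed.
Lemma ReN z : complex.Re (- z) = - complex.Re z.
Proof. by case: z. Qed.
Lemma ReB z w : complex.Re (z - w) = complex.Re z - complex.Re w.
Proof. by rewrite ReD ReN. Qed.
Lemma ImD z w : complex.Im (z + w) = complex.Im z + complex.Im w.
Proof. by case: z; case: w. Qed.
Lemma ImN z : complex.Im (- z) = - complex.Im z.
Proof. by case: z. Qed.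
Lemma ReM z w : complex.Re (z * w) =
  complex.Re z * complex.Re w - complex.Im z * complex.Im w.
Proof. by case: z; case: w. Qed.
Lemma ImM z w : complex.Im (z * w) =
  complex.Re z * complex.Im w + complex.Im z * complex.Re w.
Proof. by case: z; case: w. Qed.

End Norm.

(** * Complex power series converging in the unit disc *)

Section PowerSeries.
Variable R : realType.
Implicit Types (z w l : R[i]) (c : nat -> R[i]).

Definition ctends (u : nat -> R[i]) l :=
  forall e : R, 0 < e -> exists N0, forall N, (N0 <= N)%N -> normc (u N - l) < e.

Lemma ctendsD u v l m : ctends u l -> ctends v m ->
  ctends (fun N => u N + v N) (l + m).
Proof.
move=> ul vm e e0; have e2 : 0 < e / 2 by rewrite divr_gt0.
have [N1 H1] := ul _ e2; have [N2 H2] := vm _ e2.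
exists (maxn N1 N2) => N; rewrite geq_max => /andP[/H1 n1 /H2 n2].
have -> : u N + v N - (l + m) = (u N - l) + (v N - m) by ring.
by apply: le_lt_trans (le_normcD _ _) _; lra.
Qed.

Lemma ctendsZ a u l : ctends u l -> ctends (fun N => a * u N) (a * l).
Proof.
move=> ul e e0; have a1 : 0 < normc a + 1 by rewrite ltr_wpDl // normc_ge0.
have [N1 H1] := ul _ (divr_gt0 e0 a1).
exists N1 => N /H1; rewrite -mulrBr normcM ltr_pdivlMr //; apply: le_lt_trans.
by rewrite mulrC ler_wpM2l ?normc_ge0 // lerDl.
Qed.

Lemma ctendsN u l : ctends u l -> ctends (fun N => - u N) (- l).
Proof.
move=> /(ctendsZ (-1)) H e /H [N0 HN]; exists N0 => N /HN.
by rewrite !mulN1r.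
Qed.

Lemma ctendsB u v l m : ctends u l -> ctends v m ->
  ctends (fun N => u N - v N) (l - m).
Proof. by move=> ul /ctendsN; exact: ctendsD. Qed.

Lemma ctends_shift m u l : ctends u l -> ctends (fun N => u (N + m)%N) l.
Proof.
by move=> ul e /ul [N0 H]; exists N0 => N N0N; apply: H; rewrite (leq_trans N0N) ?leq_addr.
Qed.

Lemma ctends_ext u v l : u =1 v -> ctends u l -> ctends v l.
Proof. by move=> uv ul e /ul [N0 H]; exists N0 => N /H; rewrite uv. Qed.

Lemma ctends_uniq u l m : ctends u l -> ctends u m -> l = m.
Proof.
move=> ul um; apply/eqP; rewrite -subr_eq0 -normc_eq0 eq_le normc_ge0 andbT.
apply/ler_addgt0Pl => e e0; rewrite addr0.
have e2 : 0 < e / 2 by rewrite divr_gt0.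
have [N1 H1] := ul _ e2; have [N2 H2] := um _ e2.
have := H1 _ (leq_maxl N1 N2); have := H2 _ (leq_maxr N1 N2) => n1 n2.
apply: le_trans (le_normc_tri _ (u (maxn N1 N2)) _) _.
by rewrite normcC; lra.
Qed.

Lemma ctends_bound u l (B : R) : (forall N, normc (u N) <= B) -> ctends u l ->
  normc l <= B.
Proof.
move=> uB ul; apply/ler_addgt0Pr => e /ul[N /(_ N (leqnn N)) H].
rewrite normcC in H.
by have := le_normcD (l - u N) (u N); rewrite subrK; have := uB N; lra.
Qed.

(** Equivalent to a radius of convergence at least 1 when u is the sequence of the
    moduli of the coefficients; this form passes at once to derived series. *)
Definition radius_ge1 (u : nat -> R) :=
  forall s : R, 0 < s -> s < 1 -> exists M, forall k, u k * s ^+ k <= M.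

Lemma radius_ge1_le (u v : nat -> R) : (forall k, u k <= v k) -> radius_ge1 v -> radius_ge1 u.
Proof.
move=> uv tv s s0 s1; have [M H] := tv s s0 s1; exists M => k.
by apply: le_trans (H k); rewrite ler_wpM2r // exprn_ge0 // ltW.
Qed.

(** The bound t / (1 - t) is what an induction on k sustains: it is Bernoulli's
    inequality for 1 / t. *)
Lemma natX_bounded (t : R) : 0 < t -> t < 1 -> exists M, forall k : nat,
  k%:R * t ^+ k <= M.
Proof.
move=> t0 t1; exists (t / (1 - t)) => k.
have d0 : 0 < 1 - t by lra.
rewrite ler_pdivlMr //.
elim: k => [|k IH]; first by rewrite mul0r mul0r ltW.
have tk : t ^+ k <= 1 by rewrite exprn_ile1 // ltW.
have tk0 : 0 <= t ^+ k by rewrite exprn_ge0 // ltW.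
rewrite exprS -[k.+1]addn1 natrD.
have : (k%:R * t ^+ k * (1 - t)) * t <= t * t by rewrite ler_wpM2r // ltW.
have : t * (1 - t) * t ^+ k <= t * (1 - t) * 1.
  by rewrite ler_wpM2l // mulr_ge0 // ltW.
by lra.
Qed.

Lemma mid_radius (s : R) : s < 1 -> exists2 s', s < s' & s' < 1.
Proof. by move=> s1; exists ((s + 1) / 2); lra. Qed.

Lemma radius_ge1_nat (u : nat -> R) : (forall k, 0 <= u k) -> radius_ge1 u ->
  radius_ge1 (fun k => k%:R * u k).
Proof.
move=> u0 tu s s0 s1; have [s' ss' s'1] := mid_radius s1.
have s'0 := lt_trans s0 ss'.
have [M HM] := tu s' s'0 s'1.
have [||K HK] := @natX_bounded (s / s'); rewrite ?divr_gt0 ?ltr_pdivrMr ?mul1r //.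
exists (M * K) => k.
have -> : k%:R * u k * s ^+ k = (u k * s' ^+ k) * (k%:R * (s / s') ^+ k).
  by rewrite expr_div_n; field; rewrite expf_neq0 // gt_eqF.
apply: ler_pM (HM k) (HK k); rewrite ?mulr_ge0 ?exprn_ge0 ?divr_ge0 //; lra.
Qed.

Lemma radius_ge1_shift (u : nat -> R) m : (forall k, 0 <= u k) -> radius_ge1 u ->
  radius_ge1 (fun k => u (k + m)%N).
Proof.
move=> u0 tu s s0 s1; have [M H] := tu s s0 s1; exists (M / s ^+ m) => k.
by rewrite ler_pdivlMr ?exprn_gt0 // -mulrA -exprD.
Qed.

Lemma radius_ge1_sum (u : nat -> R) (s : R) : (forall k, 0 <= u k) -> radius_ge1 u ->
  0 < s -> s < 1 -> exists M, forall N, \sum_(k < N) u k * s ^+ k <= M.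
Proof.
move=> u0 tu s0 s1; have [s' ss' s'1] := mid_radius s1.
have s'0 := lt_trans s0 ss'.
have [M HM] := tu s' s'0 s'1; set t := s / s'.
have t0 : 0 <= t by rewrite divr_ge0 // ltW.
have t1 : t < 1 by rewrite ltr_pdivrMr ?mul1r.
have M0 : 0 <= M by apply: le_trans (HM 0%N); rewrite mulr_ge0.
exists (M / (1 - t)) => N.
apply: (@le_trans _ _ (\sum_(k < N) M * t ^+ k)).
  apply: ler_sum => k _.
  have -> : u k * s ^+ k = (u k * s' ^+ k) * t ^+ k.
    by rewrite /t expr_div_n; field; rewrite expf_neq0 // gt_eqF.
  by rewrite ler_wpM2r // exprn_ge0.
rewrite -mulr_sumr ler_wpM2l //.
have d0 : 0 < 1 - t by lra.
rewrite -[_^-1]mul1r ler_pdivlMr // mulrC -opprB mulNr -subrX1.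
by rewrite opprB lerBlDr lerDl exprn_ge0.
Qed.

Lemma leq_bin_exp n m : ('C(n, m) <= n ^ m)%N.
Proof.
apply: (@leq_trans (n ^_ m)); first by rewrite -bin_ffact leq_pmulr // fact_gt0.
elim: m => [|m IH]; first by rewrite ffactn0.
by rewrite ffactnSr expnSr leq_mul // leq_subr.
Qed.

(** The coefficients of the m-th derivative divided by m!. *)
Definition dcoef m c k : R[i] := 'C(k + m, m)%:R * c (k + m)%N.

Lemma radius_ge1_dcoef m c : radius_ge1 (fun k => normc (c k)) ->
  radius_ge1 (fun k => normc (dcoef m c k)).
Proof.
move=> tc; have tp : radius_ge1 (fun k => k%:R ^+ m * normc (c k)).
  elim: m => [|m IH]; first by apply: radius_ge1_le tc => k; rewrite expr0 mul1r.
  apply: radius_ge1_le (radius_ge1_nat _ IH) => k; first by rewrite exprS mulrA.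
  by rewrite mulr_ge0 ?exprn_ge0 // normc_ge0.
apply: radius_ge1_le (radius_ge1_shift m _ tp) => k.
  rewrite /dcoef normcM normc_nat ler_wpM2r ?normc_ge0 // -natrX ler_nat.
  exact: leq_bin_exp.
by rewrite mulr_ge0 ?exprn_ge0 // normc_ge0.
Qed.

End PowerSeries.

(** The real and imaginary parts are summed apart, so that the completeness of the
    reals suffices.  The definition is sealed to keep conversion from unfolding
    these limits. *)
HB.lock Definition psum (R : realType) (c : nat -> R[i]) (z : R[i]) : R[i] :=
  limn (fun N => \sum_(k < N) complex.Re (c k * z ^+ k)) +i*
  limn (fun N => \sum_(k < N) complex.Im (c k * z ^+ k)).

Section PowerSeriesSums.
Variable R : realType.
Implicit Types (z w l : R[i]) (c : nat -> R[i]).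

Lemma is_cvg_abs_bounded (v w : nat -> R) (M : R) :
  (forall k, `|v k| <= w k) -> (forall N, \sum_(k < N) w k <= M) ->
  cvgn (fun N => \sum_(k < N) v k).
Proof.
move=> vw wM.
have -> : (fun N => \sum_(k < N) v k) = series v.
  by rewrite seriesEord.
apply: normed_cvg; apply: nondecreasing_is_cvgn.
  by apply: nondecreasing_series => k _ _; exact: normr_ge0.
exists M => _ [N _ <-]; apply: le_trans (wM N).
rewrite /normed_series_of seriesEord; apply: ler_sum => k _; exact: vw.
Qed.

Lemma ctends_ReIm (u : nat -> R[i]) (a b : R) :
  (fun N => complex.Re (u N)) @ \oo --> a ->
  (fun N => complex.Im (u N)) @ \oo --> b -> ctends u (a +i* b).
Proof.
move=> /cvgrPdist_lt Ha /cvgrPdist_lt Hb e e0.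
have e2 : 0 < e / 2 by rewrite divr_gt0.
have [N1 _ H1] := Ha _ e2; have [N2 _ H2] := Hb _ e2.
exists (maxn N1 N2) => N; rewrite geq_max => /andP[/H1 /= n1 /H2 /= n2].
rewrite normcC; apply: le_lt_trans (normc_le_ReIm _) _.
have -> : complex.Re (a +i* b - u N) = a - complex.Re (u N) by rewrite ReB.
have -> : complex.Im (a +i* b - u N) = b - complex.Im (u N).
  by rewrite ImD ImN.
by lra.
Qed.

Lemma psum_ctends c z : radius_ge1 (fun k => normc (c k)) -> normc z < 1 ->
  ctends (fun N => \sum_(k < N) c k * z ^+ k) (psum c z).
Proof.
move=> tc z1; pose s := (normc z + 1) / 2; have z0 := normc_ge0 z.
have [||M HM] := radius_ge1_sum (fun k => normc_ge0 (c k)) tc (s := s);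
  rewrite /s; try lra.
have Hk k : normc (c k * z ^+ k) <= normc (c k) * s ^+ k.
  rewrite normcM normcX ler_wpM2l ?normc_ge0 // lerXn2r ?nnegrE // /s; lra.
have -> : (fun N => \sum_(k < N) c k * z ^+ k) =
  (fun N => (\sum_(k < N) complex.Re (c k * z ^+ k)) +i*
            (\sum_(k < N) complex.Im (c k * z ^+ k))).
  apply/funext => N; elim: N => [|N IH]; first by rewrite !big_ord0.
  rewrite !big_ord_recr /= IH; case: (c N * z ^+ N) => a b; exact: erefl.
rewrite psum.unlock; apply: ctends_ReIm => /=.
- have HR k : `|complex.Re (c k * z ^+ k)| <= normc (c k) * s ^+ k.
    exact: le_trans (normc_Re _) (Hk k).
  exact: is_cvg_abs_bounded HR HM.
- have HI k : `|complex.Im (c k * z ^+ k)| <= normc (c k) * s ^+ k.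
    exact: le_trans (normc_Im _) (Hk k).
  exact: is_cvg_abs_bounded HI HM.
Qed.

Lemma partial_dcoef m c z N :
  \sum_(k < N + m) 'C(k, m)%:R * c k * z ^+ (k - m) =
  \sum_(k < N) dcoef m c k * z ^+ k.
Proof.
rewrite addnC big_split_ord /= big1 ?add0r => [|i _].
  by apply: eq_bigr => i _; rewrite /dcoef addnC addnK.
by rewrite bin_small ?mul0r.
Qed.

Lemma psum_dcoef_ctends m c z : radius_ge1 (fun k => normc (c k)) -> normc z < 1 ->
  ctends (fun N => \sum_(k < N + m) 'C(k, m)%:R * c k * z ^+ (k - m))
         (psum (dcoef m c) z).
Proof.
move=> tc z1; apply: ctends_ext (psum_ctends (radius_ge1_dcoef m tc) z1) => N.
by rewrite partial_dcoef.
Qed.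

Lemma binX_shift (A : comNzRingType) (s : A) k j :
  'C(k, j.+1)%:R * s ^+ (k - j) = 'C(k, j.+1)%:R * (s ^+ (k - j.+1) * s).
Proof.
have [jk|kj] := ltnP j k; last by rewrite bin_small // !mul0r.
by rewrite -exprSr subnSK.
Qed.

(** Induction on k: the remainder E_k satisfies E_(k+1) = (z + w) E_k + k w^2 z^(k-1). *)
Lemma pow_taylor1 z w (s : R) k : normc z <= s -> normc (z + w) <= s ->
  normc ((z + w) ^+ k - z ^+ k - w * ('C(k, 1)%:R * z ^+ (k - 1)))
    <= 'C(k, 2)%:R * s ^+ (k - 2) * normc w ^+ 2.
Proof.
move=> zs zws; have s0 : 0 <= s := le_trans (normc_ge0 z) zs.
elim: k => [|k IH].
  by rewrite !expr0 subrr !bin0n /= mulr0n !mul0r mulr0 subr0 normc0.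
have -> : (z + w) ^+ k.+1 - z ^+ k.+1 - w * ('C(k.+1, 1)%:R * z ^+ (k.+1 - 1))
  = (z + w) * ((z + w) ^+ k - z ^+ k - w * ('C(k, 1)%:R * z ^+ (k - 1)))
    + w ^+ 2 * ('C(k, 1)%:R * z ^+ (k - 1)).
  have H : 'C(k, 1)%:R * z ^+ k = 'C(k, 1)%:R * (z ^+ (k - 1) * z).
    by rewrite -(binX_shift z k 0) subn0.
  rewrite binS bin0 natrD subn1 /= !exprS [(_ + _) * z ^+ _]mulrDl H.
  by ring.
apply: le_trans (le_normcD _ _) _.
rewrite !(normcX, normcM, normc_nat).
have -> : 'C(k.+1, 2)%:R * s ^+ (k.+1 - 2) * normc w ^+ 2 =
   s * ('C(k, 2)%:R * s ^+ (k - 2) * normc w ^+ 2)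
   + normc w ^+ 2 * ('C(k, 1)%:R * s ^+ (k - 1)).
  by rewrite binS natrD subSS [in LHS]mulrDl (binX_shift s k 1); ring.
apply: lerD.
  by apply: ler_pM => //; exact: normc_ge0.
rewrite ler_wpM2l ?exprn_ge0 ?normc_ge0 // ler_wpM2l //.
by rewrite lerXn2r ?nnegrE // normc_ge0.
Qed.

Lemma pow_taylor2 z w (s : R) k : normc z <= s -> normc (z + w) <= s ->
  normc ((z + w) ^+ k - z ^+ k - w * ('C(k, 1)%:R * z ^+ (k - 1))
     - w ^+ 2 * ('C(k, 2)%:R * z ^+ (k - 2)))
    <= 'C(k, 3)%:R * s ^+ (k - 3) * normc w ^+ 3.
Proof.
move=> zs zws; have s0 : 0 <= s := le_trans (normc_ge0 z) zs.
elim: k => [|k IH].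
  by rewrite !expr0 subrr !bin0n /= mulr0n !mul0r !mulr0 !subr0 normc0.
have -> : (z + w) ^+ k.+1 - z ^+ k.+1 - w * ('C(k.+1, 1)%:R * z ^+ (k.+1 - 1))
     - w ^+ 2 * ('C(k.+1, 2)%:R * z ^+ (k.+1 - 2))
  = (z + w) * ((z + w) ^+ k - z ^+ k - w * ('C(k, 1)%:R * z ^+ (k - 1))
     - w ^+ 2 * ('C(k, 2)%:R * z ^+ (k - 2)))
    + w ^+ 3 * ('C(k, 2)%:R * z ^+ (k - 2)).
  have H : 'C(k, 1)%:R * z ^+ k = 'C(k, 1)%:R * (z ^+ (k - 1) * z).
    by rewrite -(binX_shift z k 0) subn0.
  rewrite !binS bin0 !natrD subn1 subSS /= !exprS.
  rewrite ![(_ + _) * z ^+ _]mulrDl H (binX_shift z k 1).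
  by ring.
apply: le_trans (le_normcD _ _) _.
rewrite !(normcX, normcM, normc_nat).
have -> : 'C(k.+1, 3)%:R * s ^+ (k.+1 - 3) * normc w ^+ 3 =
   s * ('C(k, 3)%:R * s ^+ (k - 3) * normc w ^+ 3)
   + normc w ^+ 3 * ('C(k, 2)%:R * s ^+ (k - 2)).
  by rewrite binS natrD subSS [in LHS]mulrDl (binX_shift s k 2); ring.
apply: lerD.
  by apply: ler_pM => //; exact: normc_ge0.
rewrite ler_wpM2l ?exprn_ge0 ?normc_ge0 // ler_wpM2l //.
by rewrite lerXn2r ?nnegrE // normc_ge0.
Qed.

(** Uniform in the length N of the partial sum, so that the Taylor estimates of
    monomials sum up and pass to the limit. *)
Lemma sum_dcoef_bound m c (s : R) : radius_ge1 (fun k => normc (c k)) ->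
  0 < s -> s < 1 -> exists2 M, 0 <= M & forall N,
    \sum_(k < N) 'C(k, m)%:R * normc (c k) * s ^+ (k - m) <= M.
Proof.
move=> tc s0 s1.
have [M HM] := radius_ge1_sum (fun k => normc_ge0 (dcoef m c k)) (radius_ge1_dcoef m tc) s0 s1.
exists M; first by have := HM 0%N; rewrite big_ord0.
move=> N; apply: (@le_trans _ _
  (\sum_(k < N + m) 'C(k, m)%:R * normc (c k) * s ^+ (k - m))).
  rewrite big_split_ord /= lerDl sumr_ge0 // => i _.
  by rewrite !mulr_ge0 ?normc_ge0 ?exprn_ge0 // ltW.
apply: le_trans (HM N); rewrite addnC big_split_ord /= big1 ?add0r => [|i _].
  apply: ler_sum => i _; rewrite /dcoef normcM normc_nat [(m + i)%N]addnC addnK.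
  exact: lexx.
by rewrite bin_small ?mul0r.
Qed.

Lemma psum_taylor1 c (s : R) : radius_ge1 (fun k => normc (c k)) -> 0 < s -> s < 1 ->
  exists2 M, 0 <= M & forall z w, normc z <= s -> normc (z + w) <= s ->
  normc (psum c (z + w) - psum c z - w * psum (dcoef 1 c) z) <= M * normc w ^+ 2.
Proof.
move=> tc s0 s1; have [M M0 HM] := sum_dcoef_bound 2 tc s0 s1.
exists M => // z w zs zws.
have P x : normc x <= s -> ctends (fun N => \sum_(k < N + 1) c k * x ^+ k) (psum c x).
  move=> xs; apply: (@ctends_shift _ 1 (fun N => \sum_(k < N) c k * x ^+ k)).
  by apply: psum_ctends => //; exact: le_lt_trans s1.
have P1 := psum_dcoef_ctends 1 tc (le_lt_trans zs s1).
apply: ctends_bound (ctendsB (ctendsB (P _ zws) (P _ zs)) (ctendsZ w P1)) => N.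
rewrite mulr_sumr -!sumrB; apply: le_trans (normc_sum _ _ _) _.
apply: le_trans (ler_wpM2r (exprn_ge0 2 (normc_ge0 w)) (HM (N + 1)%N)).
rewrite mulr_suml; apply: ler_sum => k _.
have -> : c k * (z + w) ^+ k - c k * z ^+ k - w * ('C(k, 1)%:R * c k * z ^+ (k - 1))
  = c k * ((z + w) ^+ k - z ^+ k - w * ('C(k, 1)%:R * z ^+ (k - 1))) by ring.
rewrite normcM.
have -> : 'C(k, 2)%:R * normc (c k) * s ^+ (k - 2) * normc w ^+ 2 =
  normc (c k) * ('C(k, 2)%:R * s ^+ (k - 2) * normc w ^+ 2) by ring.
by rewrite ler_wpM2l ?normc_ge0 // pow_taylor1.
Qed.

Lemma psum_taylor2 c (s : R) : radius_ge1 (fun k => normc (c k)) -> 0 < s -> s < 1 ->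
  exists2 M, 0 <= M & forall z w, normc z <= s -> normc (z + w) <= s ->
  normc (psum c (z + w) - psum c z - w * psum (dcoef 1 c) z
     - w ^+ 2 * psum (dcoef 2 c) z) <= M * normc w ^+ 3.
Proof.
move=> tc s0 s1; have [M M0 HM] := sum_dcoef_bound 3 tc s0 s1.
exists M => // z w zs zws.
have P x : normc x <= s -> ctends (fun N => \sum_(k < N + 2) c k * x ^+ k) (psum c x).
  move=> xs; apply: (@ctends_shift _ 2 (fun N => \sum_(k < N) c k * x ^+ k)).
  by apply: psum_ctends => //; exact: le_lt_trans s1.
have P1 := ctends_shift 1 (psum_dcoef_ctends 1 tc (le_lt_trans zs s1)).
have P2 := psum_dcoef_ctends 2 tc (le_lt_trans zs s1).
apply: ctends_bound (ctendsB (ctendsB (ctendsB (P _ zws) (P _ zs)) (ctendsZ w P1))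
  (ctendsZ (w ^+ 2) P2)) => N.
rewrite -[(N + 1 + 1)%N]addnA [(1 + 1)%N]addn1 !mulr_sumr -!sumrB.
apply: le_trans (normc_sum _ _ _) _.
apply: le_trans (ler_wpM2r (exprn_ge0 3 (normc_ge0 w)) (HM (N + 2)%N)).
rewrite mulr_suml; apply: ler_sum => k _.
have -> : c k * (z + w) ^+ k - c k * z ^+ k - w * ('C(k, 1)%:R * c k * z ^+ (k - 1))
   - w ^+ 2 * ('C(k, 2)%:R * c k * z ^+ (k - 2))
  = c k * ((z + w) ^+ k - z ^+ k - w * ('C(k, 1)%:R * z ^+ (k - 1))
     - w ^+ 2 * ('C(k, 2)%:R * z ^+ (k - 2))) by ring.
rewrite normcM.
have -> : 'C(k, 3)%:R * normc (c k) * s ^+ (k - 3) * normc w ^+ 3 =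
  normc (c k) * ('C(k, 3)%:R * s ^+ (k - 3) * normc w ^+ 3) by ring.
by rewrite ler_wpM2l ?normc_ge0 // pow_taylor2.
Qed.

Lemma psum_bounded c (s : R) : radius_ge1 (fun k => normc (c k)) -> 0 < s -> s < 1 ->
  exists2 M, 0 <= M & forall z, normc z <= s -> normc (psum c z) <= M.
Proof.
move=> tc s0 s1; have [M M0 HM] := sum_dcoef_bound 0 tc s0 s1.
exists M => // z zs.
apply: ctends_bound (psum_ctends tc (le_lt_trans zs s1)) => N.
apply: le_trans (normc_sum _ _ _) _; apply: le_trans (HM N).
apply: ler_sum => k _; rewrite normcM normcX bin0 mul1r subn0.
by rewrite ler_wpM2l ?normc_ge0 // lerXn2r ?nnegrE ?normc_ge0 // ltW.
Qed.

Lemma psum_lipschitz c (s : R) : radius_ge1 (fun k => normc (c k)) -> 0 < s -> s < 1 ->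
  exists2 L, 0 <= L & forall z w, normc z <= s -> normc w <= s ->
    normc (psum c z - psum c w) <= L * normc (z - w).
Proof.
move=> tc s0 s1; have [M M0 HM] := psum_taylor1 tc s0 s1.
have [K K0 HK] := psum_bounded (radius_ge1_dcoef 1 tc) s0 s1.
exists (M * (s + s) + K) => [|z w zs ws].
  by rewrite addr_ge0 // mulr_ge0 // addr_ge0 ?ltW.
have := HM w (z - w) ws; rewrite [w + _]addrC subrK => /(_ zs) H.
have -> : psum c z - psum c w = (psum c z - psum c w - (z - w) * psum (dcoef 1 c) w)
  + (z - w) * psum (dcoef 1 c) w by ring.
apply: le_trans (le_normcD _ _) _; rewrite [leRHS]mulrDl; apply: lerD.
  apply: le_trans H _; rewrite -mulrA ler_wpM2l // expr2 ler_wpM2r ?normc_ge0 //.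
  by apply: le_trans (le_normcB _ _) _; exact: lerD.
by rewrite normcM mulrC ler_wpM2r ?normc_ge0 // HK.
Qed.

End PowerSeriesSums.

(** * Extrema of Lipschitz functions on compact subsets of the plane *)

Section EVT.
Variable R : realType.
Implicit Types (z w : R[i]).

Definition toC (p : R * R) : R[i] := p.1 +i* p.2.

Lemma normc_toC_le (p q : R * R) (d : R) : ball p d q -> normc (toC p - toC q) < d + d.
Proof.
case=> h1 h2; apply: le_lt_trans (normc_le_ReIm _) _.
by rewrite ImD ImN ReB; apply: ltrD; [exact: h1 | exact: h2].
Qed.

(** A separation criterion for closedness phrased with the modulus, which is how all
    the sets below are described. *)
Lemma closed_toC (K : set R[i]) :
  (forall p, ~ K p -> exists2 d : R, 0 < d & forall q, normc (p - q) < d -> ~ K q) ->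
  closed [set p : R * R | K (toC p)].
Proof.
move=> HK; rewrite -openC openE => p /= /HK [d d0 Hd].
apply/nbhs_ballP; exists (d / 2) => /=; first by rewrite divr_gt0.
move=> q pq; apply: Hd; apply: lt_le_trans (normc_toC_le pq) _; lra.
Qed.

Lemma compact_toC (K : set R[i]) (a : R) :
  (forall z, K z -> normc z <= a) ->
  (forall p, ~ K p -> exists2 d : R, 0 < d & forall q, normc (p - q) < d -> ~ K q) ->
  compact [set p : R * R | K (toC p)].
Proof.
move=> Ka /closed_toC cK.
apply: (subclosed_compact cK (compact_setX (@segment_compact R (- a) a)
  (@segment_compact R (- a) a))).
move=> p /= /Ka pa; split => /=; rewrite in_itv /= -ler_norml;
  [exact: le_trans (normc_Re _) pa|exact: le_trans (normc_Im _) pa].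
Qed.

Lemma EVT_min_lip (K : set R[i]) (a L : R) (u : R[i] -> R) : K !=set0 ->
  (forall z, K z -> normc z <= a) ->
  (forall p, ~ K p -> exists2 d : R, 0 < d & forall q, normc (p - q) < d -> ~ K q) ->
  0 <= L -> (forall z w, K z -> K w -> u z - u w <= L * normc (z - w)) ->
  exists2 z0, K z0 & forall z, K z -> u z0 <= u z.
Proof.
move=> [z1 Kz1] Ka cK L0 uL.
have := compact_toC Ka cK; set A := [set p | _] => cA.
have [||p pA Hp] := @compact_EVT_min _ R (u \o toC) A _ cA.
- by exists (complex.Re z1, complex.Im z1); rewrite /A /toC /=; case: (z1) Kz1.
- rewrite continuous_subspace_in => p; rewrite inE => pA.
  apply/cvgrPdist_lt => e e0; rewrite -nbhs_subspace_in //.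
  apply/nbhs_ballP; exists (e / (2 * (L + 1))) => /=.
    by rewrite divr_gt0 // mulr_gt0 // ltr_wpDl.
  move=> q pq qA /=.
  have L1 : 0 < L + 1 by lra.
  have H : L * normc (toC p - toC q) < e.
    have H0 := normc_toC_le pq.
    have H1 : (L + 1) * normc (toC p - toC q) < e.
      rewrite mulrC -ltr_pdivlMr //; apply: lt_le_trans H0 _.
      by rewrite le_eqVlt; apply/orP; left; apply/eqP; field; rewrite gt_eqF.
    apply: le_lt_trans H1; rewrite mulrDl mul1r lerDl; exact: normc_ge0.
  have h1 := uL _ _ pA qA; have h2 := uL _ _ qA pA; rewrite normcC in h2.
  by rewrite [from_subspace]lock ltr_norml -lock /from_subspace /=; apply/andP; split; lra.
exists (toC p); first by rewrite inE in pA.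
move=> z Kz; have := Hp (complex.Re z, complex.Im z).
by rewrite /= /toC /=; case: z Kz => x y Kz; apply; rewrite inE.
Qed.

Lemma closed_disc_sep (a : R) (p : R[i]) : ~ (normc p <= a) ->
  exists2 d : R, 0 < d & forall q, normc (p - q) < d -> ~ (normc q <= a).
Proof.
move=> /negP; rewrite -ltNge => ap; exists (normc p - a); first by lra.
by move=> q pq; have := le_normc_sub p q; lra.
Qed.

Lemma EVT_min_disc (a L : R) (u : R[i] -> R) : 0 <= a -> 0 <= L ->
  (forall z w, normc z <= a -> normc w <= a -> u z - u w <= L * normc (z - w)) ->
  exists2 z0, normc z0 <= a & forall z, normc z <= a -> u z0 <= u z.
Proof.
move=> a0 L0 uL; apply: (@EVT_min_lip [set z | normc z <= a] a L u) => //.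
  by exists 0; rewrite /mkset normc0.
exact: closed_disc_sep.
Qed.

End EVT.

(** * The maximum principle *)

Section MaxPrinciple.
Variable R : realType.
Implicit Types (z w : R[i]) (c : nat -> R[i]).

Lemma sqr_normc_addr z w : normc z ^+ 2 - 2 * normc z * normc w <= normc (z + w) ^+ 2.
Proof.
have h : `|normc z - normc w| <= normc (z + w).
  rewrite ler_norml; have := le_normc_sub z (- w); have := le_normc_sub w (- z).
  by rewrite !opprK !normcN [w + z]addrC => h1 h2; apply/andP; split; lra.
have : `|normc z - normc w| ^+ 2 <= normc (z + w) ^+ 2.
  by rewrite lerXn2r ?nnegrE ?normc_ge0.
rewrite real_normK ?num_real //.
have := sqr_ge0 (normc w).
rewrite [(normc z - normc w) ^+ 2]sqrrB -mulr_natr; lra.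
Qed.

(** All cross terms cancel because w and w^2 have mean zero over w = d, -d, id, -id.
    The term d^2 |b|^2 is the discrete trace of the subharmonicity of |P|^2. *)
Lemma four_point_mean (a b e : R[i]) (d : R) :
  normc (a + d%:C * b + d%:C ^+ 2 * e) ^+ 2
  + normc (a + (- d)%:C * b + (- d)%:C ^+ 2 * e) ^+ 2
  + normc (a + (0 +i* d) * b + (0 +i* d) ^+ 2 * e) ^+ 2
  + normc (a + (0 +i* (- d)) * b + (0 +i* (- d)) ^+ 2 * e) ^+ 2
  = 4 * (normc a ^+ 2 + d ^+ 2 * normc b ^+ 2 + d ^+ 4 * normc e ^+ 2).
Proof.
rewrite !sqr_normcE; case: a => a1 a2; case: b => b1 b2; case: e => e1 e2.
rewrite !(ReD, ImD, ReM, ImM) /=.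
ring.
Qed.

(** The function |P|^2 + e |z|^2 has no interior maximum on the disc: by
    [four_point_mean] its mean over four points at distance d exceeds its value at
    the centre by at least e d^2 - O(d^3).  Then e tends to 0. *)
Lemma psum_max_principle c (rho B : R) : radius_ge1 (fun k => normc (c k)) ->
  0 < rho -> rho < 1 -> (forall z, normc z = rho -> normc (psum c z) <= B) ->
  forall z, normc z <= rho -> normc (psum c z) <= B.
Proof.
move=> tc r0 r1 HB.
have B0 : 0 <= B.
  by apply: le_trans (normc_ge0 (psum c rho%:C)) (HB _ _); rewrite normcR gtr0_norm.
suff H e : 0 < e -> forall z, normc z <= rho -> normc (psum c z) ^+ 2 <= B ^+ 2 + e.
  move=> z zr; rewrite -(@ler_pXn2r _ 2) ?nnegrE ?normc_ge0 //.
  by apply/ler_addgt0Pr => e e0; exact: H.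
move=> e0.
pose u z := - (normc (psum c z) ^+ 2 + e * normc z ^+ 2).
have [L L0 HL] := psum_lipschitz tc r0 r1.
have [K K0 HK] := psum_bounded tc r0 r1.
have uL z w : normc z <= rho -> normc w <= rho ->
    u z - u w <= (L * (K + K) + e * 2) * normc (z - w).
  move=> zr wr; rewrite /u.
  have nz := normc_ge0 z; have nw := normc_ge0 w.
  have pz := normc_ge0 (psum c z); have pw := normc_ge0 (psum c w).
  have e1 : normc w ^+ 2 - normc z ^+ 2 <= 2 * normc (z - w).
    rewrite subr_sqr mulrC; apply: (@le_trans _ _ ((normc w + normc z) * normc (z - w))).
      by rewrite ler_wpM2l ?addr_ge0 // normcC le_normc_sub.
    by rewrite ler_wpM2r ?normc_ge0 //; lra.
  have e2 : normc (psum c w) ^+ 2 - normc (psum c z) ^+ 2 <= (K + K) * (L * normc (z - w)).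
    rewrite subr_sqr mulrC; apply: (@le_trans _ _ ((normc (psum c w) + normc (psum c z)) * (L * normc (z - w)))).
      rewrite ler_wpM2l ?addr_ge0 // [normc (z - w)]normcC.
      by apply: le_trans (le_normc_sub _ _) _; exact: HL.
    by rewrite ler_wpM2r ?mulr_ge0 ?normc_ge0 //; apply: lerD; exact: HK.
  have : e * (normc w ^+ 2 - normc z ^+ 2) <= e * (2 * normc (z - w)).
    by rewrite ler_wpM2l // ltW.
  by lra.
have CL : 0 <= L * (K + K) + e * 2.
  by rewrite addr_ge0 ?mulr_ge0 ?addr_ge0 // ltW.
have [z0 z0r Hz0] := EVT_min_disc (ltW r0) CL uL.
have z00 := normc_ge0 z0.
have [z0b|z0i] : rho <= normc z0 \/ normc z0 < rho.
  by have [|] := ltP (normc z0) rho; [right|left].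
  have z0e : normc z0 = rho by apply/eqP; rewrite eq_le z0r.
  move=> z zr; have := Hz0 z zr; rewrite /u lerN2 z0e => H.
  have h1 : normc (psum c z0) ^+ 2 <= B ^+ 2.
    by rewrite lerXn2r ?nnegrE ?normc_ge0 // HB.
  have h2 : e * rho ^+ 2 <= e * 1 by rewrite ler_wpM2l ?exprn_ile1 ?ltW.
  have h3 : 0 <= e * normc z ^+ 2 by rewrite mulr_ge0 ?exprn_ge0 ?normc_ge0 ?ltW.
  by lra.
exfalso.
have [M M0 HM] := psum_taylor2 tc r0 r1.
set a := psum c z0 in HM; set b := psum (dcoef 1 c) z0; set g := psum (dcoef 2 c) z0.
(* Q bounds the second-order Taylor polynomial on the unit disc of increments, and d
   is so small that the cubic error cannot absorb e d^2. *)
pose Q := normc a + normc b + normc g.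
have Q0 : 0 <= Q by rewrite !addr_ge0 ?normc_ge0.
have D0 : 0 < 2 * Q * M + 1 by rewrite ltr_wpDl // !mulr_ge0.
pose d := Num.min (rho - normc z0) (e / (2 * Q * M + 1) / 2).
have d0 : 0 < d by rewrite lt_min subr_gt0 z0i !divr_gt0.
have dr : d <= rho - normc z0 by rewrite ge_min lexx.
have d1 : d <= 1 by lra.
have de : d <= e / (2 * Q * M + 1) / 2 by rewrite ge_min lexx orbT.
have pt w : normc w = d -> normc (a + w * b + w ^+ 2 * g) ^+ 2 - 2 * Q * M * d ^+ 3
     <= normc a ^+ 2 + e * normc z0 ^+ 2 - e * normc (z0 + w) ^+ 2.
  move=> wd.
  have zwr : normc (z0 + w) <= rho by apply: le_trans (le_normcD _ _) _; lra.
  have := Hz0 _ zwr; rewrite /u lerN2 -/a => H1.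
  have H2 := HM z0 w z0r zwr; rewrite -/a -/b -/g wd in H2.
  have H3 := sqr_normc_addr (a + w * b + w ^+ 2 * g)
     (psum c (z0 + w) - a - w * b - w ^+ 2 * g).
  have E : a + w * b + w ^+ 2 * g + (psum c (z0 + w) - a - w * b - w ^+ 2 * g)
    = psum c (z0 + w) by ring.
  rewrite E in H3.
  have H4 : normc (a + w * b + w ^+ 2 * g) <= Q.
    apply: le_trans (le_normcD _ _) _; rewrite lerD //.
      apply: le_trans (le_normcD _ _) _; rewrite lerD // normcM wd.
      by rewrite ler_piMl ?normc_ge0.
    by rewrite normcM normcX wd ler_piMl ?normc_ge0 // exprn_ile1 // ltW.
  have H5 : normc (a + w * b + w ^+ 2 * g) *
     normc (psum c (z0 + w) - a - w * b - w ^+ 2 * g) <= Q * (M * d ^+ 3).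
    by apply: ler_pM => //; exact: normc_ge0.
  by lra.
have nd : normc d%:C = d by rewrite normcR gtr0_norm.
have nNd : normc (- d)%:C = d by rewrite normcR normrN gtr0_norm.
have nid : normc (0 +i* d) = d by rewrite /= expr0n add0r sqrtr_sqr gtr0_norm.
have nNid : normc (0 +i* (- d)) = d.
  by rewrite /= expr0n add0r sqrtr_sqr normrN gtr0_norm.
have := four_point_mean a b g d.
have := four_point_mean z0 1 0 d.
rewrite !mulr0 !addr0 !mulr1 normc1 normc0 expr0n /= mulr0 addr0 expr1n mulr1.
have := pt _ nd; have := pt _ nNd; have := pt _ nid; have := pt _ nNid.
set A1 := normc (a + _ + _) ^+ 2; set A2 := normc (a + _ + _) ^+ 2.
set A3 := normc (a + _ + _) ^+ 2; set A4 := normc (a + _ + _) ^+ 2.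
set B1 := normc (z0 + _) ^+ 2; set B2 := normc (z0 + _) ^+ 2.
set B3 := normc (z0 + _) ^+ 2; set B4 := normc (z0 + _) ^+ 2.
move=> h1 h2 h3 h4 hB hA.
have hb : 0 <= d ^+ 2 * normc b ^+ 2 by rewrite mulr_ge0 ?exprn_ge0 ?normc_ge0 // ltW.
have hg : 0 <= d ^+ 4 * normc g ^+ 2 by rewrite mulr_ge0 ?exprn_ge0 ?normc_ge0 // ltW.
have heB : e * B4 + e * B3 + e * B2 + e * B1 = 4 * (e * normc z0 ^+ 2) + 4 * (e * d ^+ 2).
  by rewrite -!mulrDr; have -> : B4 + B3 + B2 + B1 = 4 * (normc z0 ^+ 2 + d ^+ 2) by []; ring.
have : e * d ^+ 2 <= 2 * Q * M * d * d ^+ 2.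
  have -> : 2 * Q * M * d * d ^+ 2 = 2 * Q * M * d ^+ 3 by ring.
  by lra.
rewrite ler_pM2r ?exprn_gt0 // leNgt => /negP; apply.
have : d * (2 * Q * M + 1) <= e / 2.
  have -> : e / 2 = e / (2 * Q * M + 1) / 2 * (2 * Q * M + 1).
    by field; rewrite gt_eqF.
  by rewrite ler_wpM2r // ltW.
by lra.
Qed.

End MaxPrinciple.

(** * Jack's lemma and the estimate of h' *)

Section Jack.
Variable R : realType.
Implicit Types (z w : R[i]) (c : nat -> R[i]).

(** The first-order condition at a maximum of |psi| on the closed disc at a boundary
    point z0, with k = z0 psi'(z0) / psi(z0) and z = z0 (1 + s). *)
Lemma tangent_real_ge0 (k : R[i]) (C d : R) : 0 < d -> 0 <= C ->
  (forall s, normc s <= d -> normc (1 + s) <= 1 -> normc (1 + s * k) <= 1 + C * normc s ^+ 2) ->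
  complex.Im k = 0 /\ 0 <= complex.Re k.
Proof.
move=> d0 C0 H.
have Rek : 0 <= complex.Re k.
  apply/ler_addgt0Pr => e e0; pose t := Num.min 1 (Num.min d (e / (C + 1))).
  have C1 : 0 < C + 1 by lra.
  have t0 : 0 < t by rewrite !lt_min ltr01 d0 divr_gt0.
  have t1 : t <= 1 by rewrite ge_min lexx.
  have td : t <= d by rewrite !ge_min lexx orbT.
  have te : t * (C + 1) <= e by rewrite -ler_pdivlMr // !ge_min lexx !orbT.
  have ns : normc (- t)%:C = t by rewrite normcR normrN gtr0_norm.
  have := H (- t)%:C; rewrite ns => /(_ td) H1.
  have : normc (1 + (- t)%:C) <= 1.
    have -> : 1 + (- t)%:C = (1 - t)%:C :> R[i] by rewrite rmorphB rmorph1 rmorphN.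
    by rewrite normcR ler_norml; apply/andP; split; lra.
  move=> /H1 H2; have := le_trans (Re_le_normc _) H2.
  rewrite ReD ReM /= mul0r subr0 => H3.
  have H4 : t * (C * t) <= t * e.
    by rewrite ler_wpM2l ?ltW // mulrC; lra.
  have : t * (- complex.Re k) <= t * e by lra.
  by rewrite ler_pM2l //; lra.
split => //.
(* The direction -t^2 + i t (up to sign) is tangent to the circle and bends inwards
   enough to stay in the disc. *)
have key (sg : R) : sg ^+ 2 = 1 -> sg * complex.Im k <= 0.
  move=> sg1; apply/ler_addgt0Pr => e e0; rewrite add0r.
  pose D := 2 * C + complex.Re k.
  have D0 : 0 <= D by rewrite /D; lra.
  have D1 : 0 < D + 1 by lra.
  pose t := Num.min 1 (Num.min (d / 2) (e / (D + 1))).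
  have t0 : 0 < t by rewrite !lt_min ltr01 !divr_gt0.
  have t1 : t <= 1 by rewrite ge_min lexx.
  have td : t <= d / 2 by rewrite !ge_min lexx orbT.
  have te : t * (D + 1) <= e by rewrite -ler_pdivlMr // !ge_min lexx !orbT.
  pose s : R[i] := (- t ^+ 2) +i* (- (sg * t)).
  have t21 : t ^+ 2 <= t by rewrite expr2 ler_piMl // ltW.
  have s2 : normc s ^+ 2 = t ^+ 2 * (t ^+ 2 + 1).
    rewrite sqr_normcE /=.
    have -> : (- t ^+ 2) ^+ 2 + (- (sg * t)) ^+ 2 = (t ^+ 2) ^+ 2 + sg ^+ 2 * t ^+ 2 by ring.
    by rewrite sg1; ring.
  have t2le : t ^+ 2 * (t ^+ 2 + 1) <= t ^+ 2 * 2.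
    by rewrite ler_wpM2l ?exprn_ge0 ?(ltW t0) //; lra.
  have sd : normc s <= d.
    rewrite -(@ler_pXn2r _ 2) ?nnegrE ?normc_ge0 ?(ltW d0) // s2.
    apply: le_trans t2le _.
    have : t ^+ 2 <= (d / 2) ^+ 2 by rewrite lerXn2r ?nnegrE ?(ltW t0) ?divr_ge0 ?(ltW d0).
    have := sqr_ge0 d; rewrite expr_div_n; lra.
  have s1 : normc (1 + s) <= 1.
    rewrite -(@ler_pXn2r _ 2) ?nnegrE ?normc_ge0 // sqr_normcE ReD ImD /= add0r.
    have -> : (- (sg * t)) ^+ 2 = sg ^+ 2 * t ^+ 2 by ring.
    rewrite sg1 expr1n mul1r.
    have := ler_wpM2l (exprn_ge0 2 (ltW t0)) t1.
    have : t ^+ 2 * t ^+ 2 <= t ^+ 2 * 1 by rewrite ler_wpM2l ?exprn_ge0 ?(ltW t0) //; lra.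
    by rewrite (_ : (1 - t ^+ 2) ^+ 2 = 1 - 2 * t ^+ 2 + t ^+ 2 * t ^+ 2); [lra|ring].
  have := le_trans (Re_le_normc _) (H s sd s1).
  rewrite ReD ReM /= s2 => H3.
  have H4 : C * (t ^+ 2 * (t ^+ 2 + 1)) <= C * (t ^+ 2 * 2) by rewrite ler_wpM2l.
  have H5 : t * (sg * complex.Im k) <= t * e.
    have : t * (t * (D + 1)) <= t * e by rewrite ler_wpM2l // ltW.
    have : 0 <= t * t by rewrite mulr_ge0 // ltW.
    by rewrite /D; lra.
  by rewrite ler_pM2l in H5.
have := key 1 (expr1n _ _); have : (-1) * complex.Im k <= 0.
  by apply: key; rewrite sqrrN expr1n.
by lra.
Qed.

(** The map v |-> v / (1 - v) sends the unit circle to the line Re = -1/2. *)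
Lemma Re_div_unit (v : R[i]) : normc v = 1 -> v != 1 ->
  complex.Re (v / (1 - v)) = - (1 / 2).
Proof.
move=> v1 vn1; have nv : normc (1 - v) ^+ 2 != 0.
  by rewrite expf_neq0 // normc_eq0 subr_eq0 eq_sym.
have E : v / (1 - v) = v * (1 - v)^* * ((normc (1 - v) ^+ 2)^-1)%:C.
  have nz : 1 - v != 0 by rewrite subr_eq0 eq_sym.
  apply: (mulIf nz); rewrite divfK // -!mulrA [_%:C * _]mulrC 2!mulrA.
  rewrite -[v * _ * _]mulrA [_^* * _]mulrC mul_conj_normc -mulrA -rmorphM /=.
  by rewrite mulfV // mulr1.
rewrite E ReM [complex.Im _%:C]/= mulr0 subr0 [complex.Re _%:C]/=.
have : normc v ^+ 2 = 1 by rewrite v1 expr1n.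
rewrite sqr_normcE in nv *; rewrite sqr_normcE.
move: nv; case: v {v1 vn1 E} => a b; rewrite ReM ReD ReN ImD ImN /= => nv h.
apply: (mulIf nv); rewrite mulfVK //.
by move: h; rewrite !expr2; lra.
Qed.

Section Psi.
Variable c : nat -> R[i].
Hypothesis tc : radius_ge1 (fun k => normc (c k)).
Let psi := psum c.
Let dpsi := psum (dcoef 1 c).
Let om z := z * psi z.
Hypothesis om1 : forall z, normc z < 1 -> om z != 1.
Hypothesis Hre : forall z, normc z < 1 ->
  complex.Re (z * - (psi z + z * dpsi z) / (1 - om z)) < 1 / 2.

(** On the circle |z| = rho one has |psi| = |om| / rho, and the maximum principle
    applies to psi. *)
Lemma schwarz_disc (rho : R) : 0 < rho -> rho < 1 ->
  (forall z, normc z = rho -> normc (om z) <= 1) ->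
  forall z, normc z <= rho -> normc (psi z) <= rho^-1.
Proof.
move=> r0 r1 H; apply: (psum_max_principle tc r0 r1) => z zr.
by have := H z zr; rewrite /om normcM zr -[rho^-1]mul1r ler_pdivlMr // mulrC.
Qed.

(** Let z0 be a point of smallest modulus with |om z0| >= 1.  Then |om z0| = 1 and
    |psi| attains at z0 its maximum over the disc of radius |z0|, so that
    z0 om'(z0) / om(z0) = 1 + k with k real and nonnegative.  Hence
    z0 h''(z0) / h'(z0) = - (1 + k) om / (1 - om) has real part (1 + k) / 2 >= 1/2,
    which [Hre] forbids. *)
Lemma jack_omega_lt1 z : normc z < 1 -> normc (om z) < 1.
Proof.
move=> z1; rewrite ltNge; apply/negP => omz.
have rz0 : 0 < normc z.
  rewrite normc_gt0; apply/eqP => z0; move: omz; rewrite z0 /om mul0r normc0; lra.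
have [L L0 HL] := psum_lipschitz tc rz0 z1.
have [B B0 HB] := psum_bounded tc rz0 z1.
pose L' := B + L.
have L'0 : 0 <= L' by rewrite addr_ge0.
have omL x y : normc x <= normc z -> normc y <= normc z ->
   normc (om x) - normc (om y) <= L' * normc (x - y).
  move=> xz yz; apply: le_trans (le_normc_sub _ _) _.
  have -> : om x - om y = (x - y) * psi x + y * (psi x - psi y).
    by rewrite /om; ring.
  apply: le_trans (le_normcD _ _) _; rewrite !normcM /L' [leRHS]mulrDl; apply: lerD.
    by rewrite mulrC ler_wpM2r ?normc_ge0 // HB.
  apply: (@le_trans _ _ (1 * (L * normc (x - y)))); last by rewrite mul1r.
  by apply: ler_pM; rewrite ?normc_ge0 // ?HL //; lra.
pose K := [set x | normc x <= normc z /\ 1 <= normc (om x)].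
have [|||||z0 [z0z omz0] Hz0] := @EVT_min_lip R K (normc z) 1 (@normc R).
- by exists z.
- by move=> x [].
- move=> p /not_andP[/closed_disc_sep [d d0 Hd]|/negP].
    by exists d => // q /Hd Hq [].
  have [pz|/negP/closed_disc_sep [d d0 Hd] _] := boolP (normc p <= normc z); last first.
    by exists d => // q /Hd Hq [].
  rewrite -ltNge => omp; exists ((1 - normc (om p)) / (L' + 1)).
    by rewrite divr_gt0 //; lra.
  move=> q; rewrite ltr_pdivlMr; last by lra.
  move=> pq [qz omq]; have := omL _ _ qz pz; rewrite normcC.
  by have := normc_ge0 (p - q); lra.
- exact: ler01.
- by move=> x y _ _; rewrite mul1r le_normc_sub.
have z01 : normc z0 < 1 by exact: le_lt_trans z0z z1.
have m0 : 0 < normc z0.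
  rewrite normc_gt0; apply/eqP => E; move: omz0; rewrite E /om mul0r normc0; lra.
set m := normc z0 in m0 z0z z01 Hz0 *.
have omlt x : normc x < m -> normc (om x) < 1.
  move=> xm; rewrite ltNge; apply/negP => omx.
  have /Hz0 : K x by split => //; lra.
  by lra.
(* By continuity from inside the disc: x is compared with (1 - t) x. *)
have omle x : normc x <= m -> normc (om x) <= 1.
  move=> xm; apply/ler_addgt0Pr => e e0.
  pose t := Num.min (1 / 2) (e / (L' + 1)).
  have L'1 : 0 < L' + 1 by lra.
  have t0 : 0 < t by rewrite lt_min !divr_gt0.
  have th : t <= 1 / 2 by rewrite ge_min lexx.
  have te : t * (L' + 1) <= e by rewrite -ler_pdivlMr // ge_min lexx orbT.
  pose y := (1 - t)%:C * x.
  have ny : normc y = (1 - t) * normc x by rewrite normcM normcR ger0_norm //; lra.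
  have nx := normc_ge0 x.
  have ym : normc y < m.
    have [x0|] := eqVneq (normc x) 0; first by rewrite ny x0 mulr0.
    rewrite lt_neqAle => *; rewrite ny.
    have : 0 < normc x by rewrite lt_def nx andbT.
    by move=> x0; have := mulr_gt0 t0 x0; lra.
  have := omlt _ ym; have := @omL x y; rewrite (le_trans xm z0z) => /(_ isT).
  have -> : normc y <= normc z by lra.
  move=> /(_ isT).
  have -> : x - y = t%:C * x by rewrite /y rmorphB rmorph1; ring.
  have -> : normc (t%:C * x) = t * normc x by rewrite normcM normcR gtr0_norm.
  have : t * normc x <= t * 1 by rewrite ler_wpM2l ?(ltW t0) //; lra.
  move=> h1 h2; have : L' * (t * normc x) <= L' * (t * 1) by rewrite ler_wpM2l.
  by move: h2; lra.
have om01 : normc (om z0) = 1 by apply/eqP; rewrite eq_le omz0 omle.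
have psile : forall x, normc x <= m -> normc (psi x) <= m^-1.
  by apply: schwarz_disc => // x xm; apply: omle; rewrite xm.
have psi0 : normc (psi z0) = m^-1.
  have := om01; rewrite /om normcM -/m => E.
  by apply: (mulfI (x := m)); rewrite ?gt_eqF // E mulfV // gt_eqF.
have psin0 : psi z0 != 0 by rewrite -normc_gt0 psi0 invr_gt0.
have [M M0 HM] := psum_taylor1 tc m0 z01.
pose k := z0 * dpsi z0 / psi z0.
have [|||Imk Rek] := @tangent_real_ge0 k (M * m ^+ 3) 1.
- exact: ltr01.
- by rewrite mulr_ge0 // exprn_ge0 // ltW.
- move=> s _ s1.
  have xm : normc (z0 + z0 * s) <= m.
    have -> : z0 + z0 * s = z0 * (1 + s) by ring.
    by rewrite normcM -/m ler_piMr // ltW.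
  have := HM z0 (z0 * s) (lexx _) xm => H1.
  have E : 1 + s * k = (psi (z0 + z0 * s) -
     (psi (z0 + z0 * s) - psi z0 - z0 * s * dpsi z0)) / psi z0.
    by rewrite /k; field.
  rewrite E normcM normcV psi0 invrK.
  have H2 := le_trans (le_normcB (psi (z0 + z0 * s)) _) (lerD (psile _ xm) H1).
  apply: le_trans (ler_wpM2r (ltW m0) H2) _.
  rewrite normcM -/m; rewrite le_eqVlt; apply/orP; left; apply/eqP.
  by field; rewrite gt_eqF.
have omz01 := om1 z01.
have nz : 1 - om z0 != 0 by rewrite subr_eq0 eq_sym.
have := Hre z01.
have -> : z0 * - (psi z0 + z0 * dpsi z0) / (1 - om z0) =
   - ((1 + k) * (om z0 / (1 - om z0))).
  by rewrite /k /om; field; rewrite psin0 nz.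
rewrite ReN ReM ImD ReD Imk [complex.Im 1]/= addr0 mul0r subr0.
by rewrite Re_div_unit //= ; lra.
Qed.

Lemma jack_psi_le1 z : normc z < 1 -> normc (psi z) <= 1.
Proof.
move=> z1; apply/ler_addgt0Pr => e e0.
have z0 := normc_ge0 z.
pose rho := Num.max ((normc z + 1) / 2) (1 / (1 + e)).
have r0 : 0 < rho by rewrite lt_max; apply/orP; left; lra.
have r1 : rho < 1.
  rewrite gt_max; apply/andP; split; first by lra.
  by rewrite ltr_pdivrMr; lra.
have zr : normc z <= rho by rewrite le_max; apply/orP; left; lra.
apply: le_trans (schwarz_disc r0 r1 _ zr) _.
  by move=> x xr; rewrite ltW // jack_omega_lt1 // xr.
have e1 : 0 < 1 + e by lra.
rewrite -[rho^-1]mul1r ler_pdivrMr // mulrC -ler_pdivrMr //.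
by rewrite le_max lexx orbT.
Qed.

End Psi.
End Jack.

(** * The convex polynomial z + mu z^(n+1) / (n+1) *)

Section Convex.
Variable R : realType.
Implicit Types (z w q v : R[i]).
Variables (n : nat) (mu : R[i]).
Hypothesis n0 : (0 < n)%N.
Hypothesis mu_le : normc mu <= (n%:R + 1)^-1.

Definition phi z := z + mu / (n.+1)%:R * z ^+ n.+1.
Definition dphi z := 1 + mu * z ^+ n.

Lemma natC_neq0 m : m.+1%:R != 0 :> R[i].
Proof. by rewrite pnatr_eq0. Qed.

Lemma normc_mu_half : normc mu <= 1 / 2.
Proof.
apply: le_trans mu_le _; rewrite div1r lef_pV2 ?posrE ?ltr0n //.
by rewrite (_ : 2 = 1 + 1) // lerD2r ler1n.
Qed.

(** The sum is compared with its value at q = 1, and each 1 - q^i has the factor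
    1 - q. *)
Lemma geom_sum_near q m : normc q <= 1 ->
  normc (m%:R - \sum_(i < m) q ^+ i) <= normc (1 - q) * (m%:R * (m%:R - 1) / 2).
Proof.
move=> q1; elim: m => [|m IH].
  by rewrite big_ord0 subr0 normc0 !mul0r mulr0.
have -> : m.+1%:R - \sum_(i < m.+1) q ^+ i =
   (m%:R - \sum_(i < m) q ^+ i) + (1 - q ^+ m).
  by rewrite big_ord_recr /= -[m.+1]addn1 natrD; ring.
apply: le_trans (le_normcD _ _) _.
have H : normc (1 - q ^+ m) <= normc (1 - q) * m%:R.
  rewrite -opprB normcN subrX1 normcM [X in X * _]normcC ler_wpM2l ?normc_ge0 //.
  apply: le_trans (normc_sum _ _ _) _.
  apply: (@le_trans _ _ (\sum_(i < m) 1)); last by rewrite sumr_const card_ord.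
  by apply: ler_sum => i _; rewrite normcX exprn_ile1 ?normc_ge0.
apply: le_trans (lerD IH H) _.
by rewrite -mulrDr ler_wpM2l ?normc_ge0 // -[m.+1]addn1 natrD; lra.
Qed.

(** Put a = 1 - q.  As |q| <= 1, the real part of a is at least |a|^2 / 2.  The
    expression is a |1 + v|^2 minus an error which is at most |a|^2 |v| |1 + v| n / 2 by
    [geom_sum_near].  What remains has the factor 1 - (n + 1) |v|, and this is where
    the bound 1 / (n + 1) is sharp. *)
Lemma convex_core q v : normc q <= 1 -> normc v <= (n%:R + 1)^-1 ->
  0 <= complex.Re ((1 + v)^* * ((1 - q) + v / (n.+1)%:R * (1 - q ^+ n.+1))).
Proof.
move=> q1 v1.
set a := 1 - q; pose S := \sum_(i < n.+1) q ^+ i.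
have nC := natC_neq0 n.
have E : (1 + v)^* * (a + v / n.+1%:R * (1 - q ^+ n.+1)) =
  a * ((1 + v) * (1 + v)^*) - a * v * (1 + v)^* * ((n.+1%:R - S) / n.+1%:R).
  have -> : 1 - q ^+ n.+1 = a * S by rewrite -opprB subrX1 /a -/S; ring.
  by field.
rewrite E ReB mul_conj_normc ReM [complex.Im _%:C]/= mulr0 subr0 [complex.Re _%:C]/=.
have Rea : normc a ^+ 2 <= 2 * complex.Re a.
  have : normc q ^+ 2 <= 1 by rewrite exprn_ile1 ?normc_ge0.
  rewrite !sqr_normcE /a !(ReB, ImD, ImN) /= => h.
  rewrite (_ : (1 - complex.Re q) ^+ 2 = 1 - 2 * complex.Re q + complex.Re q ^+ 2); last by ring.
  by rewrite sub0r sqrrN; lra.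
have nR : 0 < n%:R + 1 :> R by rewrite ltr_wpDl.
have nE : n.+1%:R = n%:R + 1 :> R by rewrite -natr1.
have HS : normc ((n.+1%:R - S) / n.+1%:R) <= normc a * (n%:R / 2).
  rewrite normcM normcV normc_nat ler_pdivrMr ?ltr0n //.
  apply: le_trans (geom_sum_near n.+1 q1) _; rewrite -/a nE -[leRHS]mulrA ler_wpM2l ?normc_ge0 //.
  by rewrite addrK; lra.
have Hv : normc v * (n%:R + 1) <= 1 by rewrite -ler_pdivlMr // div1r.
have H1v : 1 - normc v <= normc (1 + v).
  by have := le_normc_sub 1 (- v); rewrite opprK normcN normc1.
have a0 := normc_ge0 a; have v0 := normc_ge0 v; have w0 := normc_ge0 (1 + v).
apply: (@le_trans _ _ (normc a ^+ 2 / 2 * normc (1 + v) ^+ 2 -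
   normc a * normc v * normc (1 + v) * (normc a * (n%:R / 2)))).
  have -> : normc a ^+ 2 / 2 * normc (1 + v) ^+ 2 -
     normc a * normc v * normc (1 + v) * (normc a * (n%:R / 2)) =
     normc a ^+ 2 * normc (1 + v) / 2 * (normc (1 + v) - normc v * n%:R).
    by field.
  by apply: mulr_ge0; [rewrite !mulr_ge0 ?exprn_ge0 ?invr_ge0 |lra].
apply: lerB.
  by rewrite ler_wpM2r ?exprn_ge0 //; lra.
apply: le_trans (Re_le_normc _) _.
rewrite normcM; apply: le_trans (ler_wpM2l (normc_ge0 _) HS) _.
by rewrite !normcM normc_conj.
Qed.

(** The vector zeta phi'(zeta) is the outer normal of the image of the disc of radius
    |zeta| at phi zeta, and this image lies on the inner side of the tangent.  It is
    [convex_core] for q = z / zeta and v = mu zeta^n. *)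
Lemma phi_normal zeta z : normc zeta <= 1 -> normc z <= normc zeta ->
  0 <= complex.Re ((zeta * dphi zeta)^* * (phi zeta - phi z)).
Proof.
move=> zeta1 zz.
have [zeta0|zetan0] := eqVneq zeta 0.
  by rewrite zeta0 mul0r rmorph0 mul0r.
pose q := z / zeta; pose v := mu * zeta ^+ n.
have zE : z = zeta * q by rewrite /q mulrC divfK.
have q1 : normc q <= 1.
  by rewrite /q normcM normcV ler_pdivrMr ?normc_gt0 // mul1r.
have v1 : normc v <= (n%:R + 1)^-1.
  rewrite /v normcM normcX; apply: le_trans mu_le.
  by rewrite ler_piMr ?normc_ge0 // exprn_ile1 ?normc_ge0.
have -> : (zeta * dphi zeta)^* * (phi zeta - phi z) =
   (normc zeta ^+ 2)%:C * ((1 + v)^* * ((1 - q) + v / (n.+1)%:R * (1 - q ^+ n.+1))).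
  rewrite -mul_conj_normc rmorphM /= /dphi -/v /phi zE exprMn exprS /v.
  by set k1 := zeta^*; ring.
rewrite ReM [complex.Im _%:C]/= mul0r subr0 [complex.Re _%:C]/=.
by rewrite mulr_ge0 ?exprn_ge0 ?normc_ge0 // convex_core.
Qed.

Lemma phi_diff z w : phi z - phi w =
  (z - w) * (1 + mu / n.+1%:R * \sum_(i < n.+1) z ^+ (n - i) * w ^+ i).
Proof.
have -> : phi z - phi w = (z - w) + mu / n.+1%:R * (z ^+ n.+1 - w ^+ n.+1).
  by rewrite /phi; ring.
by rewrite subrXX /=; ring.
Qed.

Lemma phi_sum_le z w : normc z <= 1 -> normc w <= 1 ->
  normc (mu / n.+1%:R * \sum_(i < n.+1) z ^+ (n - i) * w ^+ i) <= 1 / 2.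
Proof.
move=> z1 w1; apply: le_trans normc_mu_half.
rewrite -mulrA normcM ler_piMr ?normc_ge0 //.
rewrite normcM normcV normc_nat mulrC ler_pdivrMr ?ltr0n // mul1r.
apply: le_trans (normc_sum _ _ _) _.
apply: (@le_trans _ _ (\sum_(i < n.+1) 1)); last by rewrite sumr_const card_ord.
apply: ler_sum => i _; rewrite normcM !normcX.
by rewrite mulr_ile1 ?exprn_ge0 ?exprn_ile1 ?normc_ge0.
Qed.

Lemma phi_lower z w : normc z <= 1 -> normc w <= 1 ->
  normc (z - w) <= 2 * normc (phi z - phi w).
Proof.
move=> z1 w1; have := phi_sum_le z1 w1; rewrite phi_diff.
set X := _ * \sum_(i < _) _ => HX; rewrite normcM.
have : 1 / 2 <= normc (1 + X).
  by have := le_normc_sub 1 (- X); rewrite opprK normcN normc1; lra.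
move=> /(ler_wpM2l (normc_ge0 (z - w))); lra.
Qed.

Lemma phi_upper z w : normc z <= 1 -> normc w <= 1 ->
  normc (phi z - phi w) <= 2 * normc (z - w).
Proof.
move=> z1 w1; have := phi_sum_le z1 w1; rewrite phi_diff.
set X := _ * \sum_(i < _) _ => HX; rewrite normcM.
have : normc (1 + X) <= 2 by have := le_normcD 1 X; rewrite normc1; lra.
move=> /(ler_wpM2l (normc_ge0 (z - w))); lra.
Qed.

Lemma phi_inj z w : normc z <= 1 -> normc w <= 1 -> phi z = phi w -> z = w.
Proof.
move=> z1 w1 E; have := phi_lower z1 w1; rewrite E subrr normc0 mulr0 => H.
apply/eqP; rewrite -subr_eq0 -normc_eq0 eq_le H normc_ge0 //.
Qed.

Lemma phi_taylor z w : normc z <= 1 -> normc (z + w) <= 1 ->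
  normc (phi (z + w) - phi z - w * dphi z) <= 'C(n.+1, 2)%:R * normc w ^+ 2.
Proof.
move=> z1 zw1; have := pow_taylor1 n.+1 z1 zw1; rewrite expr1n mulr1 => H.
have -> : phi (z + w) - phi z - w * dphi z =
  mu / n.+1%:R * ((z + w) ^+ n.+1 - z ^+ n.+1 - w * ('C(n.+1, 1)%:R * z ^+ (n.+1 - 1))).
  by rewrite /phi /dphi bin1 subn1 /=; have nC := natC_neq0 n; field.
rewrite normcM; apply: le_trans H; rewrite ler_piMl ?normc_ge0 //.
rewrite normcM normcV normc_nat ler_pdivrMr ?ltr0n // mul1r.
by apply: le_trans normc_mu_half _; have : 1 <= n.+1%:R :> R; [rewrite ler1n|lra].
Qed.

Lemma dphi_neq0 z : normc z <= 1 -> dphi z != 0.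
Proof.
move=> z1; rewrite -normc_gt0 /dphi.
have h : normc (mu * z ^+ n) <= 1 / 2.
  rewrite normcM normcX; apply: le_trans normc_mu_half.
  by rewrite ler_piMr ?normc_ge0 // exprn_ile1 ?normc_ge0.
have := le_normc_sub 1 (- (mu * z ^+ n)); rewrite opprK normcN normc1; lra.
Qed.

(** Minimise |phi - w| over the disc.  If the minimum r = phi z0 - w were nonzero,
    moving z0 by - s r / phi'(z0) would decrease it to first order.  For z0 on the
    boundary this direction points into the disc up to O(s^2), because r has a
    nonnegative component along the outer normal by [phi_normal]. *)
Lemma phi_convex (rho t : R) z1 z2 : 0 < rho -> rho < 1 ->
  normc z1 <= rho -> normc z2 <= rho -> 0 <= t -> t <= 1 ->
  exists2 z, normc z <= rho & phi z = phi z1 + t%:C * (phi z2 - phi z1).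
Proof.
move=> r0 r1 z1r z2r t0 t1; set w := _ + _.
have uL x y : normc x <= rho -> normc y <= rho ->
   normc (phi x - w) - normc (phi y - w) <= 2 * normc (x - y).
  move=> xr yr; apply: le_trans (le_normc_sub _ _) _.
  have -> : phi x - w - (phi y - w) = phi x - phi y by ring.
  by apply: phi_upper; lra.
have [z0 z0r Hz0] := EVT_min_disc (ltW r0) (ler0n _ 2) uL.
exists z0 => //; apply/eqP; rewrite -subr_eq0; apply/negPn/negP => rn0.
set r := phi z0 - w in rn0 Hz0.
have z01 : normc z0 <= 1 by lra.
have dn0 := dphi_neq0 z01.
pose e := r / dphi z0.
have re : r = e * dphi z0 by rewrite /e divfK.
have rpos : 0 < normc r by rewrite normc_gt0.
(* A point of the disc within O(s^2) of z0 - s e. *)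
have feas : exists2 K, 0 <= K & exists2 s0, 0 < s0 & forall s : R, 0 < s -> s <= s0 ->
   exists2 y, normc y <= rho & normc (y - (z0 - s%:C * e)) <= K * s ^+ 2.
  have e0 := normc_ge0 e.
  have e1 : 0 < normc e + 1 by lra.
  have [zlt|zge] := ltP (normc z0) rho.
    exists 0 => //; exists ((rho - normc z0) / (normc e + 1)).
      by rewrite divr_gt0 //; lra.
    move=> s s0; rewrite ler_pdivlMr // => ss.
    exists (z0 - s%:C * e); last by rewrite subrr normc0 mul0r.
    apply: le_trans (le_normcB _ _) _.
    by rewrite normcM normcR gtr0_norm //; lra.
  have zE : normc z0 = rho by apply/eqP; rewrite eq_le z0r.
  have Hn : 0 <= complex.Re ((z0 * dphi z0)^* * r).
    have -> : (z0 * dphi z0)^* * r =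
      (1 - t)%:C * ((z0 * dphi z0)^* * (phi z0 - phi z1)) +
      t%:C * ((z0 * dphi z0)^* * (phi z0 - phi z2)).
      by rewrite /r /w rmorphB rmorph1; ring.
    rewrite ReD !(ReM _%:C) ![complex.Im _%:C]/= !mul0r !subr0 ![complex.Re _%:C]/=.
    by rewrite addr_ge0 // mulr_ge0 ?phi_normal // ?zE //; lra.
  have He : 0 <= complex.Re (z0^* * e).
    move: Hn; have -> : (z0 * dphi z0)^* * r = (normc (dphi z0) ^+ 2)%:C * (z0^* * e).
      by rewrite -mul_conj_normc rmorphM re; ring.
    rewrite ReM [complex.Im _%:C]/= mul0r subr0 [complex.Re _%:C]/=.
    by rewrite pmulr_rge0 // exprn_gt0 // normc_gt0.
  pose K := (normc e / rho) ^+ 2.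
  have K0 : 0 <= K by rewrite exprn_ge0 // divr_ge0 // ltW.
  exists (K * (1 + normc e)); first by rewrite mulr_ge0 //; lra.
  exists 1 => // s s0 s1.
  pose y0 := z0 - s%:C * e.
  have s2 : 0 <= s ^+ 2 by rewrite exprn_ge0 // ltW.
  have k1 : 0 < 1 + K * s ^+ 2 by rewrite ltr_pwDl // mulr_ge0.
  have y0n : normc y0 <= rho * (1 + K * s ^+ 2).
    have y02 : normc y0 ^+ 2 <= rho ^+ 2 * (1 + K * s ^+ 2).
      have -> : rho ^+ 2 * (1 + K * s ^+ 2) = rho ^+ 2 + s ^+ 2 * normc e ^+ 2.
        by rewrite /K; field; rewrite gt_eqF.
      rewrite -zE; move: He; rewrite !sqr_normcE /y0 ReM.
      case: (z0) => x1 x2; case: (e) => e1' e2' /= h.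
      have : 0 <= s * (x1 * e1' - - x2 * e2') by rewrite mulr_ge0 // ltW.
      by rewrite !mul0r subr0 addr0; lra.
    rewrite -(@ler_pXn2r _ 2) ?nnegrE ?normc_ge0 ?mulr_ge0 ?(ltW r0) ?(ltW k1) //.
    apply: le_trans y02 _; rewrite exprMn ler_wpM2l ?exprn_ge0 ?(ltW r0) //.
    by rewrite expr2 ler_peMl ?(ltW k1) // lerDl mulr_ge0.
  (* The point y0 may leave the disc by O(s^2); shrinking brings it back. *)
  exists (((1 + K * s ^+ 2)^-1)%:C * y0).
    rewrite normcM normcR ger0_norm ?invr_ge0 ?(ltW k1) //.
    by rewrite mulrC ler_pdivrMr.
  have -> : ((1 + K * s ^+ 2)^-1)%:C * y0 - y0 =
     ((1 + K * s ^+ 2)^-1 * - (K * s ^+ 2))%:C * y0.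
    have -> : (1 + K * s ^+ 2)^-1 * - (K * s ^+ 2) = (1 + K * s ^+ 2)^-1 - 1.
      by field; rewrite gt_eqF.
    by rewrite rmorphB rmorph1; ring.
  rewrite normcM normcR normrM normrN.
  rewrite (ger0_norm (mulr_ge0 K0 s2)) ger0_norm ?invr_ge0 ?(ltW k1) //.
  have y1 : normc y0 <= 1 + normc e.
    apply: le_trans (le_normcB _ _) _; apply: lerD => //.
    by rewrite normcM normcR gtr0_norm // ler_piMl.
  have i1 : (1 + K * s ^+ 2)^-1 <= 1.
    by rewrite invf_le1 // lerDl mulr_ge0.
  have i0 : 0 <= (1 + K * s ^+ 2)^-1 by rewrite invr_ge0 ltW.
  have : K * s ^+ 2 * normc y0 <= K * s ^+ 2 * (1 + normc e).
    by rewrite ler_wpM2l // mulr_ge0.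
  have : (1 + K * s ^+ 2)^-1 * (K * s ^+ 2 * normc y0) <= 1 * (K * s ^+ 2 * normc y0).
    exact: ler_wpM2r (mulr_ge0 (mulr_ge0 K0 s2) (normc_ge0 y0)) _ _ i1.
  by lra.
have [K K0 [s0 s00 Hs]] := feas.
pose B := 'C(n.+1, 2)%:R : R.
have B0 : 0 <= B by rewrite ler0n.
have e0 := normc_ge0 e.
(* The choice of D makes |phi y - w| <= (1 - s) |r| + D s^2. *)
pose D := 2 * K + B * (normc e) ^+ 2.
have D0 : 0 <= D by rewrite addr_ge0 // mulr_ge0 // exprn_ge0.
pose s := Num.min s0 (Num.min 1 (Num.min ((1 - rho) / (normc e + 1)) (normc r / (D + 1) / 2))).
have spos : 0 < s by rewrite !lt_min s00 ltr01 !divr_gt0 //; lra.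
have ss0 : s <= s0 by rewrite ge_min lexx.
have s1 : s <= 1 by rewrite !ge_min lexx !orbT.
have se : s * (normc e + 1) <= 1 - rho.
  by rewrite -ler_pdivlMr ?ge_min ?lexx ?orbT //; lra.
have sD : s * (D + 1) <= normc r / 2.
  have -> : normc r / 2 = normc r / (D + 1) / 2 * (D + 1) by field; rewrite gt_eqF //; lra.
  by rewrite ler_wpM2r ?ge_min ?lexx ?orbT //; lra.
have [y yr yd] := Hs s spos ss0.
have y0r : normc (z0 + - (s%:C * e)) <= 1.
  apply: le_trans (le_normcB _ _) _; rewrite normcM normcR gtr0_norm //; lra.
have h1 := phi_taylor z01 y0r.
have h2 : normc (phi y - phi (z0 - s%:C * e)) <= 2 * normc (y - (z0 - s%:C * e)).
  by apply: phi_upper => //; lra.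
have := Hz0 y yr.
have -> : phi y - w = (phi y - phi (z0 - s%:C * e)) +
   (phi (z0 - s%:C * e) - phi z0 - - (s%:C * e) * dphi z0) + (1 - s)%:C * r.
  have -> : - (s%:C * e) * dphi z0 = - (s%:C * r) by rewrite mulNr -mulrA -re.
  by rewrite rmorphB rmorph1 /r; ring.
move=> h3; have := le_trans h3 (le_trans (le_normcD _ _) (lerD (le_normcD _ _) (lexx _))).
rewrite [normc ((1 - s)%:C * r)]normcM normcR ger0_norm; last by lra.
move: h1; rewrite normcN normcM normcR gtr0_norm // -/B => h1.
have : s * (s * (D + 1)) <= s * (normc r / 2) by rewrite ler_wpM2l // ltW.
have := mulr_gt0 spos rpos; have := mulr_gt0 spos spos.
rewrite /D; move: h1 h2 yd; rewrite exprMn !expr2; lra.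
Qed.

End Convex.

(** * Close-to-convexity and univalence *)

Section Univalence.
Variable R : realType.
Implicit Types (z w : R[i]).

(** Noshiro-Warschawski argument in the coordinate phi: F has derivative H with
    respect to phi, and Re H > 0.  If phi z1 differed from phi z2, the segment between
    them would be cut into N pieces, whose endpoints are values of phi by
    [phi_convex].  On each piece the increment of F divided by phi z2 - phi z1 has real
    part at least dl / N - O(1 / N^2), so that the total is positive. *)
Lemma close_to_convex_inj (n : nat) (mu : R[i]) (F H : R[i] -> R[i]) (rho dl B M : R) :
  (0 < n)%N -> normc mu <= (n%:R + 1)^-1 ->
  0 < rho -> rho < 1 -> 0 < dl -> 0 <= M ->
  (forall z, normc z <= rho -> dl <= complex.Re (H z)) ->
  (forall z, normc z <= rho -> normc (H z) <= B) ->
  (forall z w, normc z <= rho -> normc w <= rho ->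
     normc (F w - F z - H z * dphi n mu z * (w - z)) <= M * normc (w - z) ^+ 2) ->
  forall z1 z2, normc z1 <= rho -> normc z2 <= rho -> F z1 = F z2 -> z1 = z2.
Proof.
move=> n0 mule r0 r1 dl0 M0 Hdl HB HF z1 z2 z1r z2r F12.
pose ph := phi n mu.
have B0 : 0 <= B by apply: le_trans (normc_ge0 (H z1)) (HB _ z1r).
apply: (phi_inj n0 mule); [lra|lra|]; apply/eqP; rewrite eq_sym -subr_eq0.
apply/negPn/negP; set D := _ - _ => Dn0.
have D0 : 0 < normc D by rewrite normc_gt0.
pose K := 4 * (M + B * 'C(n.+1, 2)%:R).
have K0 : 0 <= K by rewrite mulr_ge0 // addr_ge0 // mulr_ge0.
have KD : 0 <= K * normc D / dl.
  by rewrite divr_ge0 ?(ltW dl0) // mulr_ge0 // normc_ge0.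
have [N HN] : exists N : nat, K * normc D / dl < N%:R.
  by exists (Num.truncn (K * normc D / dl)).+1; exact: truncnS_gt.
have N0 : 0 < N%:R :> R by exact: le_lt_trans HN.
have [zf Hzf] : exists zf : nat -> R[i], forall j, (j <= N)%N ->
    normc (zf j) <= rho /\ ph (zf j) = ph z1 + (j%:R / N%:R)%:C * D.
  suff /choice[zf Hzf] : forall j, exists z, (j <= N)%N ->
     normc z <= rho /\ ph z = ph z1 + (j%:R / N%:R)%:C * D by exists zf.
  move=> j; have [jN|_] := boolP (j <= N)%N; last by exists 0.
  have [||z zr Hz] := @phi_convex R n mu n0 mule rho (j%:R / N%:R) z1 z2 r0 r1 z1r z2r.
  - by rewrite divr_ge0.
  - by rewrite ler_pdivrMr // mul1r ler_nat.
  by exists z.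
have step j : (j < N)%N ->
   dl / N%:R - K * normc D / N%:R ^+ 2 <= complex.Re ((F (zf j.+1) - F (zf j)) / D).
  move=> jN; have [zr Hz] := Hzf j (ltnW jN); have [wr Hw] := Hzf j.+1 jN.
  set z := zf j in zr Hz *; set w := zf j.+1 in wr Hw *.
  have E : ph w - ph z = (N%:R^-1)%:C * D.
    rewrite Hw Hz -[j.+1]addn1 natrD mulrDl mul1r rmorphD; ring.
  have nwz : normc (w - z) <= 2 * (normc D / N%:R).
    have := @phi_lower R n mu n0 mule w z.
    rewrite -/ph E normcM normcR ger0_norm ?invr_ge0 ?(ltW N0) //.
    by rewrite [_^-1 * _]mulrC; apply; lra.
  have h1 := HF z w zr wr.
  have h2 : normc (ph w - ph z - (w - z) * dphi n mu z) <= 'C(n.+1, 2)%:R * normc (w - z) ^+ 2.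
    have := @phi_taylor R n mu n0 mule z (w - z).
    by rewrite [z + _]addrC subrK; apply; lra.
  have E2 : (F w - F z) / D = H z * (N%:R^-1)%:C +
     ((F w - F z - H z * dphi n mu z * (w - z)) -
       H z * (ph w - ph z - (w - z) * dphi n mu z)) / D.
    rewrite E; move: (_%:C) (D) Dn0 => k D' Dn0'; field; exact: Dn0'.
  rewrite E2; move: h1 h2.
  set X := F w - F z - _; set Y := ph w - ph z - _ => h1 h2.
  have h3 : normc ((X - H z * Y) / D) <= K * normc D / N%:R ^+ 2.
    rewrite normcM normcV ler_pdivrMr //.
    have h4 : normc (X - H z * Y) <= (M + B * 'C(n.+1, 2)%:R) * normc (w - z) ^+ 2.
      apply: le_trans (le_normcB _ _) _; rewrite mulrDl; apply: lerD => //.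
      rewrite normcM -mulrA; apply: ler_pM => //; rewrite ?normc_ge0 //; exact: HB.
    apply: le_trans h4 _.
    have h5 : normc (w - z) ^+ 2 <= (2 * (normc D / N%:R)) ^+ 2.
      by rewrite lerXn2r ?nnegrE ?normc_ge0 // mulr_ge0 // divr_ge0 // ltW.
    apply: (@le_trans _ _ ((M + B * 'C(n.+1, 2)%:R) * (2 * (normc D / N%:R)) ^+ 2)).
      by rewrite ler_wpM2l // addr_ge0 // mulr_ge0.
    by rewrite le_eqVlt /K; apply/orP; left; apply/eqP; field; rewrite gt_eqF.
  rewrite ReD ReM [complex.Im _%:C]/= mulr0 subr0 [complex.Re (N%:R^-1)%:C]/=.
  have h4 : - normc ((X - H z * Y) / D) <= complex.Re ((X - H z * Y) / D).
    by have := normc_Re ((X - H z * Y) / D); rewrite ler_norml => /andP[].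
  have : dl / N%:R <= complex.Re (H z) / N%:R.
    by rewrite ler_wpM2r ?invr_ge0 ?(ltW N0) // Hdl.
  by lra.
have tot m : (m <= N)%N ->
   m%:R * (dl / N%:R - K * normc D / N%:R ^+ 2) <= complex.Re ((F (zf m) - F (zf 0)) / D).
  elim: m => [|m IH] mN; first by rewrite subrr !mul0r.
  have -> : (F (zf m.+1) - F (zf 0)) / D =
    (F (zf m) - F (zf 0)) / D + (F (zf m.+1) - F (zf m)) / D by ring.
  rewrite ReD -[m.+1]addn1 natrD mulrDl mul1r addn1; apply: lerD.
    by apply: IH; exact: ltnW.
  exact: step.
have zf0 : zf 0%N = z1.
  have [zr Hz] := Hzf 0%N (leq0n _); apply: (phi_inj n0 mule); [lra|lra|].
  by rewrite [LHS]Hz mul0r mul0r addr0.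
have zfN : zf N = z2.
  have [zr Hz] := Hzf N (leqnn _); apply: (phi_inj n0 mule); [lra|lra|].
  by rewrite [LHS]Hz mulfV ?gt_eqF // mul1r /D addrC subrK.
have := tot N (leqnn _); rewrite zf0 zfN F12 subrr mul0r leNgt => /negP; apply.
have -> : N%:R * (dl / N%:R - K * normc D / N%:R ^+ 2) =
   (dl * N%:R - K * normc D) / N%:R by field; rewrite gt_eqF.
by rewrite divr_gt0 // subr_gt0 [dl * _]mulrC -ltr_pdivrMr.
Qed.

Lemma unimodular_conj (a : R[i]) : exists2 e : R[i], normc e = 1 & a^* = e * a.
Proof.
have [->|an0] := eqVneq a 0; first by exists 1; rewrite ?normc1 // rmorph0 mulr0.
exists (a^* / a); last by rewrite divfK.
by rewrite normcM normcV normc_conj mulfV // normc_eq0.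
Qed.

(** If h z1 + conj (g z1) = h z2 + conj (g z2), let e be the unimodular number which
    turns g z1 - g z2 into its conjugate; then h + e g takes the same value at z1
    and z2. *)
Lemma harmonic_inj (h g : R[i] -> R[i]) (K : set R[i]) :
  (forall e, normc e = 1 -> forall z1 z2, K z1 -> K z2 ->
     h z1 + e * g z1 = h z2 + e * g z2 -> z1 = z2) ->
  forall z1 z2, K z1 -> K z2 -> h z1 + (g z1)^* = h z2 + (g z2)^* -> z1 = z2.
Proof.
move=> H z1 z2 K1 K2 E.
have [e e1 He] := unimodular_conj (g z1 - g z2).
apply: (H e e1) => //; move: He; rewrite rmorphB /= => He.
have : h z1 - h z2 + ((g z1)^* - (g z2)^*) = 0.
  by rewrite addrACA E -opprD subrr.
rewrite He => E'; apply/eqP; rewrite -subr_eq0; apply/eqP; rewrite -E'; ring.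
Qed.

End Univalence.

(** * From the class F to power series *)

Section FromClassF.
Variable R : realType.
Implicit Types (z w : R[i]) (c : nat -> R[i]).

Lemma derive1_quadratic (h : Cplx R -> Cplx R) (z a : R[i]) (d C : R) :
  0 < d -> (forall w, normc w < d -> normc (h (z + w) - h z - w * a) <= C * normc w ^+ 2) ->
  derive1 h z = a.
Proof.
move=> d0 H; have C0 : 0 <= C.
  have := H (d / 2)%:C; rewrite normcR ger0_norm; last by lra.
  have hd : d / 2 < d by lra.
  move=> /(_ hd) /(le_trans (normc_ge0 _)); rewrite pmulr_lge0 // exprn_gt0 //; lra.
apply: cvg_lim; first exact: norm_hausdorff.
apply/cvgrPdist_lt => e e0.
have [e' e'0 eE] : exists2 e' : R, 0 < e' & e = e'%:C.
  move: e0; rewrite ltcE => /= /andP[/eqP im0 re0]; exists (complex.Re e) => //.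
  by rewrite [LHS]complexE im0 rmorph0 mulr0 addr0.
near=> y.
have yn0 : y != 0 by near: y; exact: nbhs_dnbhs_neq.
have yd : `|y| < (Num.min d (e' / (C + 1)))%:C.
  near: y; apply: dnbhs0_lt; rewrite ltcR lt_min d0 divr_gt0 //; lra.
move: yd; rewrite normc_norm ltcR lt_min => /andP[yd ye].
rewrite eE normc_norm ltcR.
have ny : 0 < normc y by rewrite normc_gt0.
have -> : a - y^-1 *: (h (y + z) - h z) = - ((h (z + y) - h z - y * a) / y) :> R[i].
  rewrite [y + z]addrC /GRing.scale /=.
  by move: (h (z + y)) (h z) => u v; field.
rewrite normcN normcM normcV ltr_pdivrMr //.
apply: le_lt_trans (H _ yd) _; rewrite expr2 mulrA ltr_pM2r //.
move: ye; rewrite ltr_pdivlMr; last by lra.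
by lra.
Unshelve. all: by end_near.
Qed.

Lemma cvg_ctends (u : nat -> Cplx R) (l : Cplx R) : u @ \oo --> l -> ctends u l.
Proof.
move=> /cvgrPdist_lt H e e0.
have [|N _ HN] := H e%:C; first by rewrite ltcR.
exists N => M NM; have := HN M NM; rewrite /= normc_norm ltcR normcC //.
Qed.

(** The general term of a convergent series is bounded, here at the real point s. *)
Lemma radius_ge1_of_cvg c (l : R[i] -> R[i]) :
  (forall z, normc z < 1 -> ctends (fun N => \sum_(k < N) c k * z ^+ k) (l z)) ->
  radius_ge1 (fun k => normc (c k)).
Proof.
move=> H s s0 s1; have ns : normc s%:C = s by rewrite normcR gtr0_norm.
have [|N HN] := H s%:C _ 1 ltr01; first by rewrite ns.
exists (2 + \sum_(k < N) normc (c k) * s ^+ k) => k.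
have E : normc (c k * s%:C ^+ k) = normc (c k) * s ^+ k by rewrite normcM normcX ns.
have [kN|Nk] := ltnP k N.
  rewrite (bigD1 (Ordinal kN)) //= addrCA lerDl addr_ge0 // sumr_ge0 // => i _.
  by rewrite mulr_ge0 ?normc_ge0 ?exprn_ge0 // ltW.
have h1 := HN k Nk; have h2 := HN k.+1 (leqW Nk).
rewrite -E; have -> : c k * s%:C ^+ k = (\sum_(i < k.+1) c i * s%:C ^+ i - l s%:C)
   - (\sum_(i < k) c i * s%:C ^+ i - l s%:C).
  by rewrite big_ord_recr /=; ring.
have : 0 <= \sum_(k0 < N) normc (c k0) * s ^+ k0.
  by rewrite sumr_ge0 // => i _; rewrite mulr_ge0 ?normc_ge0 ?exprn_ge0 // ltW.
have := le_normcB (\sum_(i < k.+1) c i * s%:C ^+ i - l s%:C) (\sum_(i < k) c i * s%:C ^+ i - l s%:C).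
by lra.
Qed.

Lemma psum_recl c z : radius_ge1 (fun k => normc (c k)) -> normc z < 1 ->
  psum c z = c 0%N + z * psum (fun k => c k.+1) z.
Proof.
move=> tc z1.
have ts : radius_ge1 (fun k => normc (c k.+1)).
  apply: radius_ge1_le (radius_ge1_shift 1 _ tc) => k; first by rewrite addn1.
  exact: normc_ge0.
apply: ctends_uniq (ctends_shift 1 (psum_ctends tc z1)) _.
have HC : ctends (fun=> c 0%N) (c 0%N).
  by move=> e e0; exists 0%N => N _; rewrite subrr normc0.
apply: ctends_ext (ctendsD HC (ctendsZ z (psum_ctends ts z1))) => N.
rewrite addn1 big_ord_recl /= expr0 mulr1 mulr_sumr; congr (_ + _).
by apply: eq_bigr => i _; rewrite exprS; ring.
Qed.

Lemma radius_room z : normc z < 1 -> exists s, [/\ 0 < s, s < 1, normc z <= s &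
   forall w, normc w < (1 - normc z) / 2 -> normc (z + w) <= s].
Proof.
move=> z1; have z0 := normc_ge0 z; exists ((1 + normc z) / 2); split; try lra.
by move=> w wd; apply: le_trans (le_normcD _ _) _; lra.
Qed.

Lemma derive1_psum c (h : Cplx R -> Cplx R) : radius_ge1 (fun k => normc (c k)) ->
  (forall z, normc z < 1 -> h z = psum c z) ->
  forall z, normc z < 1 -> derive1 h z = psum (dcoef 1 c) z.
Proof.
move=> tc hE z z1; have [s [s0 s1 zs zw]] := radius_room z1.
have [M M0 HM] := psum_taylor1 tc s0 s1.
apply: (@derive1_quadratic h z _ ((1 - normc z) / 2) M); first by lra.
move=> w wd; have zws := zw _ wd.
by rewrite !hE ?HM //; lra.
Qed.

(** Used for h', which has this form, so that the left-hand side is h''. *)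
Lemma derive1_one_sub_mul e (h : Cplx R -> Cplx R) : radius_ge1 (fun k => normc (e k)) ->
  (forall z, normc z < 1 -> h z = 1 - z * psum e z) ->
  forall z, normc z < 1 -> derive1 h z = - (psum e z + z * psum (dcoef 1 e) z).
Proof.
move=> te hE z z1; have [s [s0 s1 zs zw]] := radius_room z1.
have [M M0 HM] := psum_taylor1 te s0 s1.
have [L L0 HL] := psum_lipschitz te s0 s1.
apply: (@derive1_quadratic h z _ ((1 - normc z) / 2) (M + L)); first by lra.
move=> w wd; have zws := zw _ wd.
rewrite !hE; try lra.
have h1 := HM z w zs zws; have h2 := HL _ _ zws zs.
have -> : 1 - (z + w) * psum e (z + w) - (1 - z * psum e z) -
    w * - (psum e z + z * psum (dcoef 1 e) z) =
  - (z * (psum e (z + w) - psum e z - w * psum (dcoef 1 e) z) +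
     w * (psum e (z + w) - psum e z)) by ring.
rewrite normcN; apply: le_trans (le_normcD _ _) _; rewrite mulrDl; apply: lerD.
  rewrite normcM; apply: le_trans h1; rewrite ler_piMl ?normc_ge0 //; lra.
move: h2; rewrite addrAC subrr add0r normcM expr2 => /(ler_wpM2l (normc_ge0 w)); lra.
Qed.

(** First-order expansion with a remainder uniform in both points.  Together with
    [lip_on] it is all that the univalence and the area formula need to know about
    differentiability. *)
Definition quad_approx (F dF : R[i] -> R[i]) (rho : R) := exists2 M, 0 <= M &
  forall z w, normc z <= rho -> normc w <= rho ->
    normc (F w - F z - dF z * (w - z)) <= M * normc (w - z) ^+ 2.

Definition lip_on (F : R[i] -> R[i]) (rho : R) := exists2 L, 0 <= L &
  forall z w, normc z <= rho -> normc w <= rho ->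
    normc (F w - F z) <= L * normc (w - z).

(** The passage from the class to the estimates used below: hp and gp are h' and g'.
    The coefficients e are those of psi. *)
Lemma classF_data (alpha : R) (lambda : Cplx R) (n : nat) (f : Cplx R -> Cplx R) :
  alpha <= 3 / 2 -> classF alpha lambda n f ->
  exists h g hp gp : R[i] -> R[i],
   [/\ forall z, normc z < 1 -> f z = h z + (g z)^*,
       forall rho, 0 < rho -> rho < 1 -> quad_approx h hp rho /\ quad_approx g gp rho,
       forall rho, 0 < rho -> rho < 1 -> lip_on hp rho /\ lip_on gp rho,
       forall z, normc z < 1 -> gp z = lambda * z ^+ n * hp z &
       forall z, normc z < 1 -> normc (1 - hp z) <= normc z].
Proof.
move=> a32 [h [g [[_ fE _ [a [b ab]]] hcond gcond]]].
pose c k : R[i] := if k is k'.+1 then if k' is k''.+1 then a k else 1 else 0.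
pose b' k : R[i] := if k is k'.+1 then b k else 0.
have Hc z : normc z < 1 -> ctends (fun N => \sum_(k < N) c k * z ^+ k) (h z).
  move=> z1; have [/cvg_ctends H _] := ab z z1.
  move=> e /H [N0 HN]; exists (maxn N0 2) => N; rewrite geq_max => /andP[/HN + N2].
  rewrite -(big_mkord xpredT (fun k => c k * z ^+ k)) big_ltn ?(ltnW N2) //.
  rewrite big_ltn // mul0r add0r mul1r expr1.
  suff -> : \sum_(2 <= i < N) c i * z ^+ i = \sum_(2 <= k < N) a k * z ^+ k by [].
  by apply: eq_big_nat => -[|[|k]] //.
have Hb z : normc z < 1 -> ctends (fun N => \sum_(k < N) b' k * z ^+ k) (g z).
  move=> z1; have [_ /cvg_ctends H] := ab z z1.
  move=> e /H [N0 HN]; exists (maxn N0 1) => N; rewrite geq_max => /andP[/HN + N1].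
  rewrite -(big_mkord xpredT (fun k => b' k * z ^+ k)) big_ltn // mul0r add0r.
  suff -> : \sum_(1 <= i < N) b' i * z ^+ i = \sum_(1 <= k < N) b k * z ^+ k by [].
  by apply: eq_big_nat => -[|k] //.
have tc := radius_ge1_of_cvg Hc; have tb := radius_ge1_of_cvg Hb.
have hE z : normc z < 1 -> h z = psum c z.
  by move=> z1; apply: ctends_uniq (Hc _ z1) (psum_ctends tc z1).
have gE z : normc z < 1 -> g z = psum b' z.
  by move=> z1; apply: ctends_uniq (Hb _ z1) (psum_ctends tb z1).
have dh := derive1_psum tc hE; have dg := derive1_psum tb gE.
pose e k := - dcoef 1 c k.+1.
have tdc := radius_ge1_dcoef 1 tc.
have te : radius_ge1 (fun k => normc (e k)).
  apply: radius_ge1_le (radius_ge1_shift 1 _ tdc) => k; first by rewrite normcN addn1.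
  exact: normc_ge0.
have hpE z : normc z < 1 -> psum (dcoef 1 c) z = 1 - z * psum e z.
  move=> z1; rewrite psum_recl // /dcoef /= mulr1; congr (_ + _).
  rewrite -mulrN; congr (_ * _); apply: ctends_uniq (ctendsN (psum_ctends te z1)).
  have ts : radius_ge1 (fun k => normc (dcoef 1 c k.+1)).
    by apply: radius_ge1_le te => k; rewrite normcN.
  apply: ctends_ext (psum_ctends ts z1) => N.
  by rewrite -sumrN; apply: eq_bigr => k _; rewrite /e mulNr opprK.
have dh1 z : normc z < 1 -> derive1 h z = 1 - z * psum e z.
  by move=> z1; rewrite dh // hpE.
have d2h := derive1_one_sub_mul te dh1.
exists h, g, (psum (dcoef 1 c)), (psum (dcoef 1 b')); split.
- exact: fE.
- have Q d F : radius_ge1 (fun k => normc (d k)) -> (forall z, normc z < 1 -> F z = psum d z) ->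
     forall rho, 0 < rho -> rho < 1 -> quad_approx F (psum (dcoef 1 d)) rho.
    move=> td FE rho r0 r1; have [M M0 HM] := psum_taylor1 td r0 r1.
    exists M => // z w zr wr; have := HM z (w - z) zr.
    rewrite [z + _]addrC subrK => /(_ wr); rewrite !FE; try lra.
    by rewrite [_ * psum _ _]mulrC.
  by move=> rho r0 r1; split; apply: Q.
- move=> rho r0 r1; split.
    have [L L0 HL] := psum_lipschitz tdc r0 r1; exists L => // z w zr wr; exact: HL.
  have [L L0 HL] := psum_lipschitz (radius_ge1_dcoef 1 tb) r0 r1.
  by exists L => // z w zr wr; exact: HL.
- by move=> z z1; rewrite -dg // -dh // gcond.
move=> z z1; rewrite hpE // opprB addrC subrK normcM ler_piMr ?normc_ge0 //.
apply: (jack_psi_le1 te) z1 => x x1.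
  have [+ _] := hcond x x1; rewrite dh // hpE // => h0.
  by rewrite -subr_eq0 -oppr_eq0 opprB.
have [h0] := hcond x x1; rewrite d2h // dh // hpE // ReD /=.
by move: (complex.Re _) => t; lra.
Qed.

End FromClassF.

(** * Lebesgue measure under affine maps *)

Section Affine1.
Variable R : realType.
Local Notation mu := (@lebesgue_measure R).
Local Notation T := (measurableTypeR R).

Lemma measurable_affine (a c : R) : measurable_fun [set: T] (fun y : T => a * y + c : T).
Proof.
apply: measurable_funD; last exact: measurable_cst.
by apply: measurable_funM; [exact: measurable_cst|exact: measurable_id].
Qed.

Lemma affine_preimage_itvoc_measure (a c x1 x2 : R) : a != 0 ->
  mu ((fun y : R => a * y + c) @^-1` `]x1, x2]) = (`|a|^-1%:E * mu `]x1, x2])%E.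
Proof.
move=> a0; have [apos|aneg] : 0 < a \/ a < 0.
  by move: a0; rewrite neq_lt => /orP[]; [right|left].
- have -> : (fun y : R => a * y + c) @^-1` `]x1, x2] = `](x1 - c) / a, (x2 - c) / a].
    apply/seteqP; split => y /=; rewrite !in_itv /= ltr_pdivrMr // ler_pdivlMr //;
      by move=> /andP[h1 h2]; apply/andP; split; lra.
  rewrite !lebesgue_measure_itv /= !lte_fin ltr_pM2r ?invr_gt0 // ltrD2r.
  case: ifP => _; last by rewrite mule0.
  by rewrite -!EFinB -EFinM gtr0_norm //; congr EFin; field.
have -> : (fun y : R => a * y + c) @^-1` `]x1, x2] = `[(x2 - c) / a, (x1 - c) / a[.
  apply/seteqP; split => y /=; rewrite !in_itv /= ltr_ndivlMr // ler_ndivrMr //;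
    by move=> /andP[h1 h2]; apply/andP; split; lra.
rewrite !lebesgue_measure_itv /= !lte_fin ltr_nM2r ?invr_lt0 // ltrD2r.
case: ifP => _; last by rewrite mule0.
by rewrite -!EFinB -EFinM ltr0_norm //; congr EFin; field.
Qed.

Lemma lebesgue_measure_affine (a c : R) (S : set T) : a != 0 -> measurable S ->
  mu ((fun y : T => a * y + c : T) @^-1` S) = (`|a|^-1%:E * mu S)%E.
Proof.
move=> a0 mS; have na : 0 < `|a| by rewrite normr_gt0.
have nn : (0 <= `|a|) by [].
pose nu : {measure set T -> \bar R} := mscale (NngNum nn) mu.
suff -> : mu S = pushforward nu (fun y : T => a * y + c : T) S.
  rewrite /pushforward /nu /= /mscale /=.
  by rewrite muleA -EFinM mulVf ?gt_eqF // mul1e.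
apply: lebesgue_measure_unique => //.
  exact: measurable_affine.
move=> mf X [[x1 x2] _ <-].
transitivity (`|a|%:E * (`|a|^-1%:E * mu `]x1, x2]))%E.
  by rewrite muleA -EFinM mulfV ?gt_eqF // mul1e.
by rewrite -(affine_preimage_itvoc_measure c x1 x2 a0).
Qed.

End Affine1.

Section Affine2.
Variable R : realType.
Local Notation mu := (@lebesgue_measure R).
Local Notation T := (measurableTypeR R).
Local Notation mu2 := (mu \x mu)%E.

(** Affine maps of the plane are composed of swaps and maps that preserve vertical
    lines; the factors multiply. *)
Definition scales (F : T * T -> T * T) (k : R) := measurable_fun setT F /\
  forall B, measurable B -> mu2 (F @^-1` B) = (k%:E * mu2 B)%E.

Lemma scales_comp F G k l : scales F k -> scales G l -> scales (G \o F) (k * l).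
Proof.
move=> [mF HF] [mG HG]; split; first exact: measurableT_comp.
move=> B mB; rewrite comp_preimage HF; last first.
  by rewrite -[X in measurable X]setTI; exact: mG.
by rewrite HG // muleA EFinM.
Qed.

Lemma scales_swap : scales (fun p => (p.2, p.1)) 1.
Proof.
have ms : measurable_fun [set: T * T] (fun p : T * T => (p.2, p.1) : T * T).
  exact: measurable_swap.
split=> // B mB; rewrite mul1e.
transitivity ((mu \x^ mu)%E B); last first.
  apply/esym; apply: product_measure_unique => // A1 A2 mA1 mA2.
  exact: product_measure2E.
rewrite /product_measure1 /product_measure2 /=.
by apply: eq_integral => y _ /=; congr (mu _).
Qed.

(** Fubini: on the vertical line over x the map is affine with slope a. *)
Lemma scales_vertical (a b c : R) : a != 0 ->
  scales (fun p => (p.1, a * p.2 + (b * p.1 + c))) `|a|^-1.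
Proof.
move=> a0.
have mV : measurable_fun [set: T * T]
   (fun p : T * T => (p.1, a * p.2 + (b * p.1 + c)) : T * T).
  apply: measurable_fun_pair; first exact: measurable_fst.
  apply: measurable_funD; first by
    apply: measurable_funM; [exact: measurable_cst|exact: measurable_snd].
  apply: measurable_funD; last exact: measurable_cst.
  by apply: measurable_funM; [exact: measurable_cst|exact: measurable_fst].
split => // B mB.
rewrite /product_measure1 /= -ge0_integralZl //=; last first.
- exact: measurable_fun_xsection.
apply: eq_integral => x _ /=.
rewrite -(lebesgue_measure_affine (b * x + c) a0); last exact: measurable_xsection.
by congr (mu _); apply/seteqP; split => y; rewrite /xsection /= !inE.
Qed.

(** If a is nonzero, Gaussian elimination writes the map as a vertical map, a swap,
    another vertical map and a swap.  If a = 0 then b is nonzero, and the coordinates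
    are swapped first. *)
Lemma scales_affine (a b c a' b' c' : R) : a * b' - b * a' != 0 ->
  scales (fun p => (a * p.1 + b * p.2 + c, a' * p.1 + b' * p.2 + c'))
    `|a * b' - b * a'|^-1.
Proof.
wlog a0 : a b a' b' / a != 0.
  move=> H D; have [a0|an0] := eqVneq a 0; last exact: H.
  have b0 : b != 0.
    by apply: contraNneq D => b0; rewrite a0 b0 !mul0r subrr.
  have D' : b * a' - a * b' != 0 by rewrite -opprB oppr_eq0.
  have := scales_comp scales_swap (H b a b' a' b0 D').
  rewrite mul1r distrC; congr scales; apply/funext => p /=.
  by congr pair; ring.
move=> D.
have V1 := scales_vertical b c a0.
have e0 : (a * b' - b * a') / a != 0 by rewrite mulf_neq0 ?invr_eq0.
have V2 := scales_vertical (a' / a) (c' - a' * c / a) e0.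
have := scales_comp (scales_comp (scales_comp scales_swap V1) scales_swap) V2.
have -> : 1 * `|a|^-1 * 1 * `|(a * b' - b * a') / a|^-1 = `|a * b' - b * a'|^-1.
  rewrite mul1r mulr1 -invfM -normrM; congr (`| _ |^-1); field; exact: a0.
congr scales; apply/funext => p /=.
by congr pair; field.
Qed.

(** The parallelogram is the preimage of a rectangle under the inverse affine map,
    which Cramer's rule gives. *)
Lemma area_parallelogram (w0 u v : R[i]) (x1 x2 y1 y2 : R) :
  let D := complex.Im (u^* * v) in D != 0 -> x1 <= x2 -> y1 <= y2 ->
  let P := [set w : Cplx R | exists x y, [/\ x1 <= x <= x2, y1 <= y <= y2 &
     w = w0 + x%:C * u + y%:C * v]] in
  measurable [set p : T * T | P (p.1 +i* p.2)] /\
  area P = (`|D| * (x2 - x1) * (y2 - y1))%:E.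
Proof.
move=> D D0 x12 y12 P.
case: u v w0 @D D0 @P => u1 u2 [v1 v2] [w1 w2] D D0 P.
have DE : D = u1 * v2 - u2 * v1 by rewrite /D /= mulNr.
rewrite DE in D0 *; move: DE => _; clear D.
have D0' : v2 / (u1 * v2 - u2 * v1) * (u1 / (u1 * v2 - u2 * v1)) -
   - v1 / (u1 * v2 - u2 * v1) * (- u2 / (u1 * v2 - u2 * v1)) != 0.
  rewrite (_ : _ - _ = (u1 * v2 - u2 * v1)^-1) ?invr_eq0 //; field; exact: D0.
set Dt := u1 * v2 - u2 * v1 in D0 D0' *.
have [mF HF] := scales_affine (- (v2 * w1 - v1 * w2) / Dt) (- (u1 * w2 - u2 * w1) / Dt) D0'.
set F := fun p => _ in mF HF.
have PE : [set p : T * T | P (p.1 +i* p.2)] = F @^-1` (`[x1, x2] `*` `[y1, y2]).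
  apply/seteqP; split => [[s t]|[s t]]; rewrite /P /F /= !in_itv /=.
    move=> [x [y [hx hy]]] [-> ->].
    have -> : v2 / Dt * (w1 + (x * u1 - 0 * u2) + (y * v1 - 0 * v2)) +
     - v1 / Dt * (w2 + (x * u2 + 0 * u1) + (y * v2 + 0 * v1)) +
     - (v2 * w1 - v1 * w2) / Dt = x by rewrite /Dt; field.
    have -> : - u2 / Dt * (w1 + (x * u1 - 0 * u2) + (y * v1 - 0 * v2)) +
     u1 / Dt * (w2 + (x * u2 + 0 * u1) + (y * v2 + 0 * v1)) +
     - (u1 * w2 - u2 * w1) / Dt = y by rewrite /Dt; field.
    by [].
  move=> [hx hy]; eexists; eexists; split; [exact: hx|exact: hy|].
  by apply/eqP; rewrite eq_complex /=; apply/andP; split; apply/eqP; rewrite /Dt; field.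
have mB : measurable ((`[x1, x2] : set T) `*` (`[y1, y2] : set T)).
  by apply: measurableX; exact: measurable_itv.
rewrite PE; split; first by rewrite -[X in measurable X]setTI; exact: mF.
rewrite /area PE HF // product_measure1E; [|exact: measurable_itv|exact: measurable_itv].
rewrite /= !lebesgue_measure_itv /= !lte_fin.
have E : `|v2 / Dt * (u1 / Dt) - - v1 / Dt * (- u2 / Dt)|^-1 = `|Dt|.
  rewrite -normfV; congr (`| _ |); rewrite /Dt; field.
  exact: D0.
rewrite E.
case: ltrP => hx; case: ltrP => hy; rewrite ?mule0 ?mul0e ?mule0.
- by rewrite -!EFinB -!EFinM mulrA.
- have -> : y2 - y1 = 0 by lra.
  by rewrite mulr0.
- have -> : x2 - x1 = 0 by lra.
  by rewrite mulr0 mul0r.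
have -> : x2 - x1 = 0 by lra.
by rewrite mulr0 mul0r.
Qed.

End Affine2.

(** * The image of one cell *)

Section Cells.
Variable R : realType.
Implicit Types (z w p : R[i]).

(** The real-linear map of the plane with columns u and v; its determinant is the
    imaginary part of conj u v. *)
Definition lin2 (u v w : R[i]) : R[i] := (complex.Re w)%:C * u + (complex.Im w)%:C * v.

Lemma lin2D u v w w' : lin2 u v (w + w') = lin2 u v w + lin2 u v w'.
Proof. by rewrite /lin2 ReD ImD !rmorphD; ring. Qed.

Lemma lin2N u v w : lin2 u v (- w) = - lin2 u v w.
Proof. by rewrite /lin2 ReN ImN !rmorphN; ring. Qed.

Lemma normc_lin2 u v w : normc (lin2 u v w) <= (normc u + normc v) * normc w.
Proof.
apply: le_trans (le_normcD _ _) _; rewrite !normcM !normcR [leRHS]mulrDl.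
by apply: lerD; rewrite [leRHS]mulrC ler_wpM2r ?normc_ge0 ?normc_Re ?normc_Im.
Qed.

Lemma lin2_det_neq0 u v (m : R) : 0 < m ->
  (forall w, m * normc w <= normc (lin2 u v w)) -> complex.Im (u^* * v) != 0.
Proof.
move=> m0 H; apply/eqP => D0.
have : lin2 u v ((- complex.Re (u^* * v)) +i* (normc u ^+ 2)) = 0.
  rewrite /lin2 sqr_normcE /=; move: D0; case: u H => u1 u2 H; case: v H => v1 v2 _ /= D0.
  have {}D0 : u1 * v2 = u2 * v1 by lra.
  by apply/eqP; rewrite eq_complex /=; apply/andP; split; apply/eqP; ring: D0.
move=> E; have := H ((- complex.Re (u^* * v)) +i* (normc u ^+ 2)).
rewrite E normc0 pmulr_rle0 // => h.
have u0 : normc u ^+ 2 = 0.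
  apply/eqP; rewrite eq_le exprn_ge0 ?normc_ge0 // andbT.
  apply: le_trans h; apply: le_trans (ler_norm _) _.
  exact: (normc_Im ((- complex.Re (u^* * v)) +i* (normc u ^+ 2))).
have {}u0 : u = 0 by apply/eqP; rewrite -normc_eq0; move/eqP: u0; rewrite expf_eq0.
have := H 1; rewrite normc1 mulr1 /lin2 /= u0 mulr0 mul0r addr0 normc0; lra.
Qed.

Lemma lin2_surj u v r : complex.Im (u^* * v) != 0 -> exists w, lin2 u v w = r.
Proof.
set D := complex.Im _ => D0.
exists ((- complex.Im (v^* * r) / D) +i* (complex.Im (u^* * r) / D)).
rewrite /lin2 /=; move: D0; rewrite /D.
case: u {D} => u1 u2; case: v => v1 v2; case: r => r1 r2 /=; rewrite mulNr => D0.
by apply/eqP; rewrite eq_complex /=; apply/andP; split; apply/eqP; field.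
Qed.

Definition box p (a b : R) z :=
  (complex.Re p <= complex.Re z <= complex.Re p + a) /\
  (complex.Im p <= complex.Im z <= complex.Im p + b).

Lemma box_normc p a b z w : box p a b z -> box p a b w -> normc (z - w) <= a + b.
Proof.
move=> [/andP[h1 h2] /andP[h3 h4]] [/andP[k1 k2] /andP[k3 k4]].
apply: le_trans (normc_le_ReIm _) _; rewrite ReB ImD ImN.
by apply: lerD; rewrite ler_norml; apply/andP; split; lra.
Qed.

Lemma box_sep p a b q : ~ box p a b q ->
  exists2 d : R, 0 < d & forall q', normc (q - q') < d -> ~ box p a b q'.
Proof.
move=> nb.
have [c [k [ck ce]]] : exists c k : R, 0 < k /\ forall q', normc (q - q') < k -> ~ box p a b q'.
  exists 0.
  have [h|h1] := boolP (complex.Re p <= complex.Re q); last first.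
    exists (complex.Re p - complex.Re q); rewrite -ltNge in h1; split; first by lra.
    move=> q'; rewrite normcC => qq [/andP[k1 _] _].
    by have := Re_le_normc (q' - q); rewrite ReB; lra.
  have [h2|h2] := boolP (complex.Re q <= complex.Re p + a); last first.
    exists (complex.Re q - (complex.Re p + a)); rewrite -ltNge in h2; split; first by lra.
    move=> q' qq [/andP[_ k1] _].
    by have := Re_le_normc (q - q'); rewrite ReB; lra.
  have [h3|h3] := boolP (complex.Im p <= complex.Im q); last first.
    exists (complex.Im p - complex.Im q); rewrite -ltNge in h3; split; first by lra.
    move=> q'; rewrite normcC => qq [_ /andP[k1 _]].
    by have := le_trans (ler_norm _) (normc_Im (q' - q)); rewrite ImD ImN; lra.
  have [h4|h4] := boolP (complex.Im q <= complex.Im p + b); last first.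
    exists (complex.Im q - (complex.Im p + b)); rewrite -ltNge in h4; split; first by lra.
    move=> q' qq [_ /andP[_ k1]].
    by have := le_trans (ler_norm _) (normc_Im (q - q')); rewrite ImD ImN; lra.
  by exfalso; apply: nb; split; apply/andP.
by exists k.
Qed.

Section OneCell.
Variables (T : R[i] -> R[i]) (p u v : R[i]) (a b e m : R).
Hypotheses (a0 : 0 < a) (b0 : 0 < b) (e0 : 0 < e) (m0 : 0 < m).
Hypothesis HT : forall z w, box p a b z -> box p a b w ->
  normc (T w - T z - lin2 u v (w - z)) <= e * normc (w - z).
Hypothesis Hm : forall w, m * normc w <= normc (lin2 u v w).
Let k := e * (a + b) / m.

Let pbox : box p a b p.
Proof. by split; rewrite lexx lerDl ltW. Qed.

Lemma small_lin2 w : normc (lin2 u v w) <= e * (a + b) ->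
  `|complex.Re w| <= k /\ `|complex.Im w| <= k.
Proof.
move=> H; have kw : normc w <= k.
  by rewrite /k ler_pdivlMr // mulrC; exact: le_trans (Hm _) H.
by split; [exact: le_trans (normc_Re _) kw|exact: le_trans (normc_Im _) kw].
Qed.

Lemma cell_image_sub z : box p a b z -> exists x y,
  [/\ - k <= x <= a + k, - k <= y <= b + k & T z = T p + x%:C * u + y%:C * v].
Proof.
move=> bz; have [w Hw] := lin2_surj (T z - T p) (lin2_det_neq0 m0 Hm).
have : normc (lin2 u v (w - (z - p))) <= e * (a + b).
  rewrite lin2D lin2N Hw; apply: le_trans (HT pbox bz) _.
  by rewrite ler_wpM2l ?(ltW e0) //; exact: (box_normc bz pbox).
move=> /small_lin2[]; rewrite !(ReB, ImD, ImN) !ler_norml => h1 h2.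
case: bz h1 h2 => /andP[z1 z2] /andP[z3 z4] /andP[h1 h2] /andP[h3 h4].
exists (complex.Re w), (complex.Im w); split; [lra|lra|].
by rewrite -addrA -[_ * u + _]/(lin2 u v w) Hw addrC subrK.
Qed.

(** For t in the inner parallelogram, minimise |T - t| over the cell.  At the
    minimum z, subtracting the solution w of lin2 u v w = T z - t stays in the cell and
    multiplies the distance to t by at most e / m < 1, so this distance is 0.  The
    upper margin is 2 k instead of k in order that z avoids the upper and the right
    side: the half-open cells are disjoint. *)
Lemma cell_image_sup x y : e < m -> k <= x <= a - k - k -> k <= y <= b - k - k ->
  exists z, [/\ box p a b z, complex.Re z < complex.Re p + a,
     complex.Im z < complex.Im p + b & T z = T p + x%:C * u + y%:C * v].
Proof.
move=> em hx hy; set t := T p + _ + _.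
have tE : t = T p + lin2 u v (x +i* y) by rewrite /t /lin2 /= addrA.
have k0 : 0 < k by rewrite divr_gt0 // mulr_gt0 // addr_gt0.
pose C := e + (normc u + normc v).
have C0 : 0 <= C by rewrite !addr_ge0 ?normc_ge0 // ltW.
have lipu z w : box p a b z -> box p a b w ->
    normc (T z - t) - normc (T w - t) <= C * normc (z - w).
  move=> bz bw; apply: le_trans (le_normc_sub _ _) _.
  have -> : T z - t - (T w - t) = (T z - T w - lin2 u v (z - w)) + lin2 u v (z - w) by ring.
  apply: le_trans (le_normcD _ _) _; rewrite mulrDl; apply: lerD; first exact: HT.
  exact: normc_lin2.
have [|||||z bz Hz] := @EVT_min_lip R (box p a b) (normc p + (a + b)) C (fun z => normc (T z - t)).
- by exists p.
- move=> z bz; have := le_normcD (z - p) p; rewrite subrK.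
  by have := box_normc bz pbox; lra.
- exact: box_sep.
- exact: C0.
- exact: lipu.
have [w Hw] := lin2_surj (T z - t) (lin2_det_neq0 m0 Hm).
(* The Newton step z - w is within k of the point of coordinates x, y. *)
have dl : normc (lin2 u v ((z - p) - w - (x +i* y))) <= e * (a + b).
  rewrite !lin2D !lin2N Hw tE.
  have -> : lin2 u v z - lin2 u v p - (T z - (T p + lin2 u v (x +i* y))) - lin2 u v (x +i* y)
    = - (T z - T p - lin2 u v (z - p)) by rewrite lin2D lin2N; ring.
  rewrite normcN; apply: le_trans (HT pbox bz) _.
  by rewrite ler_wpM2l ?(ltW e0) //; exact: (box_normc bz pbox).
have [] := small_lin2 dl.
rewrite !(ReB, ImD, ImN) /= !ler_norml => /andP[h1 h2] /andP[h3 h4].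
move: hx hy => /andP[hx1 hx2] /andP[hy1 hy2].
have bzw : box p a b (z - w).
  by split; rewrite !(ReB, ImD, ImN); apply/andP; split; lra.
have r0 : T z - t = 0.
  apply/eqP/negPn/negP => rn0; have r0 : 0 < normc (T z - t) by rewrite normc_gt0.
  have := Hz _ bzw; rewrite leNgt => /negP; apply.
  have -> : T (z - w) - t = T (z - w) - T z - lin2 u v ((z - w) - z).
    by rewrite (_ : z - w - z = - w); [rewrite lin2N Hw; ring|ring].
  apply: le_lt_trans (HT bz bzw) _.
  rewrite (_ : z - w - z = - w); last by ring.
  rewrite normcN.
  have := Hm w; rewrite Hw; have nw := normc_ge0 w.
  have : 0 < normc w.
    rewrite normc_gt0; apply/eqP => w0; move: rn0; rewrite -Hw w0 /lin2 /= !mul0r addr0 eqxx //.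
  by move=> wp; rewrite -(ltr_pM2r wp) in em; lra.
have w0 : w = 0.
  apply/eqP; rewrite -normc_eq0 eq_le normc_ge0 andbT -(pmulr_rle0 _ m0).
  by apply: le_trans (Hm w) _; rewrite Hw r0 normc0.
move: h1 h2 h3 h4; rewrite w0 /= => h1 h2 h3 h4.
exists z; split; [exact: bz|lra|lra|].
by apply/eqP; rewrite -subr_eq0 r0.
Qed.

End OneCell.
End Cells.

(** * Finite families of measurable sets *)

Section FiniteFamilies.
Context d (X : measurableType d) (R : realType).
Variables (m : {measure set X -> \bar R}) (I : eqType) (A : I -> set X).

Lemma sum_measure_le (s : seq I) (B : set X) : uniq s ->
  (forall i, i \in s -> measurable (A i)) ->
  (forall i, i \in s -> A i `<=` B) ->
  (forall i j x, i \in s -> j \in s -> A i x -> A j x -> i = j) ->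
  measurable B -> (\sum_(i <- s) m (A i) <= m B)%E.
Proof.
elim: s B => [|i s IH] B /=; first by move=> *; rewrite big_nil measure_ge0.
move=> /andP[is_ us] mA AB dA mB; rewrite big_cons.
have mi : measurable (A i) by apply: mA; rewrite mem_head.
have -> : m B = (m (A i) + m (B `\` A i))%E.
  rewrite -measureU //; [|exact: measurableD|]; last first.
    exact: setDIK.
  by rewrite setDUK //; apply: AB; rewrite mem_head.
apply: leeD => //; apply: IH => //.
- by move=> j js; apply: mA; rewrite in_cons js orbT.
- move=> j js x Ajx; split; first by apply: (AB j) => //; rewrite in_cons js orbT.
  move=> Aix; have E := dA i j x (mem_head _ _) _ Aix Ajx.
  by move: is_; rewrite E ?js // in_cons js orbT.
- by move=> j k x js ks; apply: dA; rewrite in_cons ?js ?ks orbT.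
- exact: measurableD.
Qed.

Lemma measure_le_sum (s : seq I) (B : set X) :
  (forall i, i \in s -> measurable (A i)) ->
  (forall x, B x -> exists2 i, i \in s & A i x) ->
  measurable B -> (m B <= \sum_(i <- s) m (A i))%E.
Proof.
elim: s B => [|i s IH] B /= mA AB mB.
  rewrite big_nil; have -> : B = set0.
    by apply/seteqP; split => x // /AB[].
  by rewrite measure0.
have mi : measurable (A i) by apply: mA; rewrite mem_head.
rewrite big_cons; apply: (@le_trans _ _ (m (A i `|` (B `\` A i)))).
  apply: le_measure; rewrite ?inE //; first by apply: measurableU => //; exact: measurableD.
  by move=> x Bx; have [|] := pselect (A i x); [left|right].
apply: (@le_trans _ _ (m (A i) + m (B `\` A i))%E).
  by apply: measureU2 => //; exact: measurableD.
apply: leeD => //; apply: IH.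
- by move=> j js; apply: mA; rewrite in_cons js orbT.
- move=> x [/AB[j]]; rewrite in_cons => /orP[/eqP -> //|js Ajx _].
  by exists j.
- exact: measurableD.
Qed.

End FiniteFamilies.

(** * Area of the image of a rectangle *)

Section Grid.
Variable R : realType.
Implicit Types (z w p : R[i]).
Local Notation Tm := (measurableTypeR R).
Local Notation mu2 := (@lebesgue_measure R \x @lebesgue_measure R)%E.

(** Half-open, so that the cells of a grid are disjoint and cover the whole box. *)
Definition hbox p (a b : R) z :=
  (complex.Re p <= complex.Re z < complex.Re p + a) /\
  (complex.Im p <= complex.Im z < complex.Im p + b).

Lemma hbox_box p a b z : hbox p a b z -> box p a b z.
Proof. by move=> [/andP[h1 h2] /andP[h3 h4]]; split; apply/andP; split; rewrite // ltW. Qed.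

Definition corner p (a b : R) (N i j : nat) : R[i] :=
  (complex.Re p + i%:R * (a / N%:R)) +i* (complex.Im p + j%:R * (b / N%:R)).

Lemma grid_index (a x x0 : R) N : (0 < N)%N -> 0 < a -> x0 <= x < x0 + a ->
  exists i : 'I_N, x0 + i%:R * (a / N%:R) <= x < x0 + i%:R * (a / N%:R) + a / N%:R.
Proof.
move=> N0 a0 /andP[h1 h2]; have NR : 0 < N%:R :> R by rewrite ltr0n.
have d0 : 0 < a / N%:R by rewrite divr_gt0.
have t0 : 0 <= (x - x0) / (a / N%:R) by rewrite divr_ge0 ?subr_ge0 // ltW.
have /andP[k1 k2] := truncn_itv t0.
set k := Num.truncn _ in k1 k2.
have kN : (k < N)%N.
  rewrite -(ltr_nat R); apply: le_lt_trans k1 _; rewrite ltr_pdivrMr //.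
  by rewrite mulrC divfK ?gt_eqF //; lra.
exists (Ordinal kN) => /=; move: k1 k2; rewrite ler_pdivlMr // ltr_pdivrMr // -natr1.
by move=> k1 k2; apply/andP; split; lra.
Qed.

Lemma grid_unique (a x x0 : R) (i j : nat) : 0 < a ->
  x0 + i%:R * a <= x < x0 + i%:R * a + a -> x0 + j%:R * a <= x < x0 + j%:R * a + a ->
  i = j.
Proof.
move=> a0 /andP[h1 h2] /andP[k1 k2].
have ij : i%:R < j.+1%:R :> R by rewrite -(ltr_pM2r a0) -natr1; lra.
have ji : j%:R < i.+1%:R :> R by rewrite -(ltr_pM2r a0) -natr1; lra.
by move: ij ji; rewrite !ltr_nat !ltnS => ij ji; apply/eqP; rewrite eqn_leq ij ji.
Qed.

Lemma subcell_box (p : R[i]) (a b : R) N (i j : 'I_N) : 0 < a -> 0 < b ->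
  box (corner p a b N i j) (a / N%:R) (b / N%:R) `<=` box p a b.
Proof.
move=> a0 b0 z [/andP[h1 h2] /andP[h3 h4]]; move: h1 h2 h3 h4 => /=.
have N0 : (0 < N)%N by exact: leq_ltn_trans (leq0n i) (ltn_ord i).
have NR : 0 < N%:R :> R by rewrite ltr0n.
have aE : a = N%:R * (a / N%:R) by field; rewrite gt_eqF.
have bE : b = N%:R * (b / N%:R) by field; rewrite gt_eqF.
have da : 0 < a / N%:R by rewrite divr_gt0.
have db : 0 < b / N%:R by rewrite divr_gt0.
have ub (k : 'I_N) (t : R) : 0 < t -> 0 <= k%:R * t /\ k%:R * t + t <= N%:R * t.
  move=> t0; split; first by rewrite mulr_ge0 // ltW.
  have -> : k%:R * t + t = (k.+1)%:R * t by rewrite -natr1; ring.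
  by rewrite ler_pM2r // ler_nat ltn_ord.
have [i0 iN] := ub i _ da; have [j0 jN] := ub j _ db.
by move=> *; split; apply/andP; split; lra.
Qed.

Variables (T Tx Ty : R[i] -> R[i]) (p0 : R[i]) (a b M L m : R).
Hypotheses (a0 : 0 < a) (b0 : 0 < b) (M0 : 0 <= M) (L0 : 0 <= L) (m0 : 0 < m).
Hypothesis quad : forall z w, box p0 a b z -> box p0 a b w ->
  normc (T w - T z - lin2 (Tx z) (Ty z) (w - z)) <= M * normc (w - z) ^+ 2.
Hypothesis lipx : forall z w, box p0 a b z -> box p0 a b w ->
  normc (Tx w - Tx z) <= L * normc (w - z).
Hypothesis lipy : forall z w, box p0 a b z -> box p0 a b w ->
  normc (Ty w - Ty z) <= L * normc (w - z).
Hypothesis coer : forall z, box p0 a b z -> forall w,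
  m * normc w <= normc (lin2 (Tx z) (Ty z) w).

Definition jac z := `|complex.Im ((Tx z)^* * Ty z)|.
Let S := [set T z | z in hbox p0 a b].
Hypothesis mS : measurable [set p : Tm * Tm | S (p.1 +i* p.2)].

Let e N := (M + 2 * L + 1) * (a / N%:R + b / N%:R).
Let k N := e N * (a / N%:R + b / N%:R) / m.

Let e_gt0 N : (0 < N)%N -> 0 < e N.
Proof.
move=> N0; have NR : 0 < N%:R :> R by rewrite ltr0n.
apply: mulr_gt0; last by rewrite addr_gt0 ?divr_gt0.
by rewrite ltr_wpDl // addr_ge0 // mulr_ge0.
Qed.

Let corner_in N (i j : 'I_N) : box p0 a b (corner p0 a b N i j).
Proof.
have N0 : (0 < N)%N by exact: leq_ltn_trans (leq0n i) (ltn_ord i).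
have NR : 0 < N%:R :> R by rewrite ltr0n.
apply: (@subcell_box _ _ _ N i j a0 b0).
by split; rewrite lexx lerDl divr_ge0 // ltW.
Qed.

Let cell_lin N (i j : 'I_N) z w : let p := corner p0 a b N i j in
  box p (a / N%:R) (b / N%:R) z -> box p (a / N%:R) (b / N%:R) w ->
  normc (T w - T z - lin2 (Tx p) (Ty p) (w - z)) <= e N * normc (w - z).
Proof.
move=> p bz bw; have := corner_in i j; rewrite -/p => bp.
have N0 : (0 < N)%N by exact: leq_ltn_trans (leq0n i) (ltn_ord i).
have NR : 0 < N%:R :> R by rewrite ltr0n.
have bpp : box p (a / N%:R) (b / N%:R) p.
  by split; rewrite lexx lerDl divr_ge0 // ltW.
have bz' := subcell_box a0 b0 bz; have bw' := subcell_box a0 b0 bw.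
have dwz := box_normc bw bz; have dzp := box_normc bz bpp.
set h := a / N%:R + b / N%:R in dwz dzp.
have h0 : 0 <= h := le_trans (normc_ge0 _) dzp.
have -> : T w - T z - lin2 (Tx p) (Ty p) (w - z) =
  (T w - T z - lin2 (Tx z) (Ty z) (w - z)) + lin2 (Tx z - Tx p) (Ty z - Ty p) (w - z).
  by rewrite /lin2; ring.
apply: le_trans (le_normcD _ _) _.
have q1 := quad bz' bw'.
have q2 := normc_lin2 (Tx z - Tx p) (Ty z - Ty p) (w - z).
have q3 := lipx bp bz'; have q4 := lipy bp bz'.
have nw := normc_ge0 (w - z).
have q5 : (normc (Tx z - Tx p) + normc (Ty z - Ty p)) * normc (w - z) <=
   2 * L * h * normc (w - z).
  rewrite ler_wpM2r //; have : L * normc (z - p) <= L * h by rewrite ler_wpM2l.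
  by lra.
have q6 : M * normc (w - z) ^+ 2 <= M * (h * normc (w - z)).
  by rewrite ler_wpM2l // expr2 ler_wpM2r.
have : 0 <= h * normc (w - z) by rewrite mulr_ge0.
rewrite /e -/h; lra.
Qed.

Let k_ge0 N : (0 < N)%N -> 0 <= k N.
Proof.
move=> N0; have NR : 0 < N%:R :> R by rewrite ltr0n.
by rewrite /k divr_ge0 ?(ltW m0) // mulr_ge0 ?(ltW (e_gt0 N0)) // addr_ge0 // divr_ge0 // ltW.
Qed.

(** The margin k N is of order 1 / N^2 and the sides of the cells of order 1 / N, so
    that the enlargement of the cells is negligible in the limit. *)
Lemma area_grid_le N : (0 < N)%N ->
  (area S <= (\sum_(ij : 'I_N * 'I_N) jac (corner p0 a b N ij.1 ij.2) *
      (a / N%:R + 2 * k N) * (b / N%:R + 2 * k N))%:E)%E.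
Proof.
move=> N0; have NR : 0 < N%:R :> R by rewrite ltr0n.
have aN : 0 < a / N%:R by rewrite divr_gt0.
have bN : 0 < b / N%:R by rewrite divr_gt0.
have kN := k_ge0 N0.
pose P (ij : 'I_N * 'I_N) := let p := corner p0 a b N ij.1 ij.2 in
  [set w : Cplx R | exists x y, [/\ - k N <= x <= a / N%:R + k N,
     - k N <= y <= b / N%:R + k N & w = T p + x%:C * Tx p + y%:C * Ty p]].
have HP ij : measurable [set p : Tm * Tm | P ij (p.1 +i* p.2)] /\
   area (P ij) = (jac (corner p0 a b N ij.1 ij.2) *
      (a / N%:R + 2 * k N) * (b / N%:R + 2 * k N))%:E.
  have D0 := lin2_det_neq0 m0 (coer (corner_in ij.1 ij.2)).
  have [||mP aP] := @area_parallelogram R (T (corner p0 a b N ij.1 ij.2)) _ _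
    (- k N) (a / N%:R + k N) (- k N) (b / N%:R + k N) D0; [lra|lra|].
  split => //; rewrite [LHS]aP; congr ((_ * _ * _)%:E); lra.
rewrite -sumEFin (eq_bigr (fun ij => area (P ij))); last by move=> ij _; case: (HP ij).
apply: measure_le_sum => //.
  by move=> ij _; case: (HP ij).
move=> [s t] /= [z bz Tz].
have [bz1 bz2] := bz.
have [i Hi] := grid_index N0 a0 bz1; have [j Hj] := grid_index N0 b0 bz2.
exists (i, j); first by rewrite mem_index_enum.
rewrite /P /= -Tz.
have bij : box (corner p0 a b N i j) (a / N%:R) (b / N%:R) z.
  by apply: hbox_box; split.
exact: (cell_image_sub aN bN (e_gt0 N0) m0 (@cell_lin N i j) (coer (corner_in i j)) bij).
Qed.

Lemma area_grid_ge N : (0 < N)%N ->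
  (forall z w, hbox p0 a b z -> hbox p0 a b w -> T z = T w -> z = w) ->
  e N < m -> 3 * k N <= a / N%:R -> 3 * k N <= b / N%:R ->
  ((\sum_(ij : 'I_N * 'I_N) jac (corner p0 a b N ij.1 ij.2) *
      (a / N%:R - 3 * k N) * (b / N%:R - 3 * k N))%:E <= area S)%E.
Proof.
move=> N0 injT em ka kb; have NR : 0 < N%:R :> R by rewrite ltr0n.
have aN : 0 < a / N%:R by rewrite divr_gt0.
have bN : 0 < b / N%:R by rewrite divr_gt0.
have kN := k_ge0 N0.
pose P (ij : 'I_N * 'I_N) := let p := corner p0 a b N ij.1 ij.2 in
  [set w : Cplx R | exists x y, [/\ k N <= x <= a / N%:R - k N - k N,
     k N <= y <= b / N%:R - k N - k N & w = T p + x%:C * Tx p + y%:C * Ty p]].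
have HP ij : measurable [set p : Tm * Tm | P ij (p.1 +i* p.2)] /\
   area (P ij) = (jac (corner p0 a b N ij.1 ij.2) *
      (a / N%:R - 3 * k N) * (b / N%:R - 3 * k N))%:E.
  have D0 := lin2_det_neq0 m0 (coer (corner_in ij.1 ij.2)).
  have [||mP aP] := @area_parallelogram R (T (corner p0 a b N ij.1 ij.2)) _ _
    (k N) (a / N%:R - k N - k N) (k N) (b / N%:R - k N - k N) D0; [lra|lra|].
  split => //; rewrite [LHS]aP; congr ((_ * _ * _)%:E); lra.
have PT ij w : P ij w -> exists2 z, T z = w & hbox p0 a b z /\
   hbox (corner p0 a b N ij.1 ij.2) (a / N%:R) (b / N%:R) z.
  case: ij => i j /= [x [y [hx hy ->]]].
  have [z [bz z1 z2 Tz]] := @cell_image_sup R T _ _ _ _ _ _ _ aN bN (e_gt0 N0) m0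
    (@cell_lin N i j) (coer (corner_in i j)) x y em hx hy.
  exists z; first by [].
  have := subcell_box a0 b0 bz => -[/andP[w1 w2] /andP[w3 w4]].
  case: bz => /andP[v1 v2] /andP[v3 v4]; split; last by split; apply/andP.
  have la : complex.Re (corner p0 a b N i j) + a / N%:R <= complex.Re p0 + a.
    have := @subcell_box p0 a b N i j a0 b0 (corner p0 a b N i j + (a / N%:R)%:C).
    case; last by move=> /andP[_]; rewrite ReD.
    by split; rewrite ?ReD ?ImD /=; apply/andP; split; lra.
  have lb : complex.Im (corner p0 a b N i j) + b / N%:R <= complex.Im p0 + b.
    have := @subcell_box p0 a b N i j a0 b0 (corner p0 a b N i j + (0 +i* (b / N%:R))).
    case; last by move=> _ /andP[_]; rewrite ImD.
    by split; rewrite ?ReD ?ImD /=; apply/andP; split; lra.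
  by split; apply/andP; split => //; lra.
rewrite -sumEFin (eq_bigr (fun ij => area (P ij))); last by move=> ij _; case: (HP ij).
apply: sum_measure_le => //.
- exact: index_enum_uniq.
- by move=> ij _; case: (HP ij).
- by move=> ij _ [s t] /= /PT [z <- [bz _]]; exists z.
move=> [i j] [i' j'] [s t] _ _ /= /PT[z Tz [bz [c1 c2]]] /PT[z' Tz' [bz' [c1' c2']]].
have E : z = z' by apply: injT => //; rewrite Tz Tz'.
rewrite -E in c1' c2'; move: c1 c2 c1' c2' => /= c1 c2 c1' c2'.
by congr pair; apply: val_inj; [exact: grid_unique aN c1 c1'|exact: grid_unique bN c2 c2'].
Qed.


Variables (q Q : R -> R) (C : R).
Hypothesis C0 : 0 <= C.
Let x0 := complex.Re p0.
Hypothesis dQ : forall s t, x0 <= s -> s <= t -> t <= x0 + a ->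
  `|Q t - Q s - q s * (t - s)| <= C * (t - s) ^+ 2.
Let I := Q (x0 + a) - Q x0.
Hypothesis I0 : 0 <= I.

(** Telescoping sum of the increments of Q; each differs from the corresponding term
    by at most C (a / N)^2. *)
Lemma riemann_sum N : (0 < N)%N ->
  `|\sum_(i < N) q (x0 + i%:R * (a / N%:R)) * (a / N%:R) - I| <= C * a ^+ 2 / N%:R.
Proof.
move=> N0; have NR : 0 < N%:R :> R by rewrite ltr0n.
pose x i := x0 + i%:R * (a / N%:R).
have h0 : 0 < a / N%:R by rewrite divr_gt0.
have -> : I = \sum_(i < N) (Q (x i.+1) - Q (x i)).
  rewrite -(big_mkord xpredT (fun i => Q (x i.+1) - Q (x i))) telescope_sumr //.
  rewrite /I /x mul0r addr0; congr (Q (_ + _) - _); field; by rewrite gt_eqF.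
rewrite -sumrB; apply: le_trans (ler_norm_sum _ _ _) _.
apply: (@le_trans _ _ (\sum_(i < N) C * (a / N%:R) ^+ 2)); last first.
  rewrite sumr_const card_ord -mulr_natr le_eqVlt; apply/orP; left; apply/eqP.
  by field; rewrite gt_eqF.
apply: ler_sum => i _.
have xx : x i.+1 - x i = a / N%:R by rewrite /x -natr1; ring.
have := @dQ (x i) (x i.+1); rewrite xx distrC; apply.
- by rewrite /x lerDl mulr_ge0 // ltW.
- by rewrite -subr_ge0 xx ltW.
have aE : a = N%:R * (a / N%:R) by field; rewrite gt_eqF.
by rewrite /x lerD2l {2}aE ler_pM2r // ler_nat.
Qed.

Lemma sum_grid N (c d : R) : (0 < N)%N ->
  \sum_(ij : 'I_N * 'I_N) q (complex.Re (corner p0 a b N ij.1 ij.2)) * c * d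
  = (\sum_(i < N) q (x0 + i%:R * (a / N%:R)) * (a / N%:R)) * (N%:R / a * c) * (N%:R * d).
Proof.
move=> N0; have NR : N%:R != 0 :> R by rewrite gt_eqF // ltr0n.
rewrite -(pair_bigA _ (fun i j : 'I_N => q (complex.Re (corner p0 a b N i j)) * c * d)) /=.
rewrite !mulr_suml; apply: eq_bigr => i _.
rewrite sumr_const card_ord -mulr_natr; field.
by rewrite NR gt_eqF.
Qed.

Let c1 := (M + 2 * L + 1) * (a + b) ^+ 2 / m.

Let c1_ge0 : 0 <= c1.
Proof.
by rewrite divr_ge0 ?(ltW m0) // mulr_ge0 ?exprn_ge0 ?addr_ge0 ?mulr_ge0 // ltW.
Qed.

Let kE N : (0 < N)%N -> k N = c1 * N%:R^-1 ^+ 2.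
Proof.
move=> N0; have NR : N%:R != 0 :> R by rewrite gt_eqF // ltr0n.
by rewrite /k /e /c1; field; rewrite NR gt_eqF.
Qed.

(** With t = 1 / N the bound of [area_grid_le] is at most
    (I + A t) (1 + B t) (b + D t), where A t bounds the error of the Riemann sum and
    B t, D t come from the margins of the cells; this is b I + O(t). *)
Lemma area_le_integral : (forall z, box p0 a b z -> jac z <= q (complex.Re z)) ->
  (area S <= (b * I)%:E)%E.
Proof.
move=> Hq; apply/lee_addgt0Pr => d d0.
pose A := C * a ^+ 2; pose B := 2 * c1 / a; pose D := 2 * c1.
have A0 : 0 <= A by rewrite mulr_ge0 // exprn_ge0 // ltW.
have B0 : 0 <= B by rewrite divr_ge0 ?(ltW a0) // mulr_ge0.
have D0 : 0 <= D by rewrite mulr_ge0.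
pose G := A * (1 + B) * (b + D) + I * B * (b + D) + I * D.
have b0' := ltW b0.
have bD := addr_ge0 b0' D0; have B1 := addr_ge0 (@ler01 R) B0.
have G0 : 0 <= G := addr_ge0 (addr_ge0 (mulr_ge0 (mulr_ge0 A0 B1) bD)
  (mulr_ge0 (mulr_ge0 I0 B0) bD)) (mulr_ge0 I0 D0).
pose N := (Num.truncn (G / d)).+1.
have N0 : (0 < N)%N by [].
have NR : 0 < N%:R :> R by rewrite ltr0n.
have GN : G / N%:R <= d.
  rewrite ler_pdivrMr // mulrC -ler_pdivrMr //; apply: ltW; exact: truncnS_gt.
apply: le_trans (area_grid_le N0) _; rewrite -EFinD lee_fin.
apply: le_trans (_ : b * I + G / N%:R <= _); last by rewrite lerD2l.
have kN := k_ge0 N0.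
have aN : 0 < a / N%:R by rewrite divr_gt0.
have bN : 0 < b / N%:R by rewrite divr_gt0.
apply: (@le_trans _ _ (\sum_(ij : 'I_N * 'I_N) q (complex.Re (corner p0 a b N ij.1 ij.2))
   * (a / N%:R + 2 * k N) * (b / N%:R + 2 * k N))).
  apply: ler_sum => ij _; rewrite -!mulrA ler_wpM2r //; last exact: Hq.
  by rewrite mulr_ge0 //; lra.
rewrite sum_grid // kE //.
set t := N%:R^-1; have t0 : 0 <= t by rewrite invr_ge0 ltW.
have t1 : t <= 1 by rewrite invf_le1 // ler1n.
have -> : N%:R / a * (a * t + 2 * (c1 * t ^+ 2)) = 1 + B * t.
  by rewrite /B /t; field; rewrite !gt_eqF.
have -> : N%:R * (b * t + 2 * (c1 * t ^+ 2)) = b + D * t.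
  by rewrite /D /t; field; rewrite !gt_eqF.
have := riemann_sum N0; rewrite -/t -/A ler_norml => /andP[_].
set s := \sum_(i < N) _ => hs.
have hs' : s <= I + A * t by lra.
have Bt : 0 <= B * t by rewrite mulr_ge0.
have Dt : 0 <= D * t by rewrite mulr_ge0.
apply: (@le_trans _ _ ((I + A * t) * (1 + B * t) * (b + D * t))).
  by rewrite ler_wpM2r ?addr_ge0 // ler_wpM2r ?addr_ge0.
have -> : b * I + G * t = (I + A * t) * (1 + B * t) * (b + D * t) +
   (A * t * ((1 + B) * (b + D) - (1 + B * t) * (b + D * t)) + I * B * t * (D - D * t)).
  by rewrite /G; ring.
rewrite lerDl; apply: addr_ge0.
  apply: (mulr_ge0 (mulr_ge0 A0 t0)); rewrite subr_ge0.
  have h1 : 1 + B * t <= 1 + B by rewrite lerD2l ler_piMr.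
  have h2 : b + D * t <= b + D by rewrite lerD2l ler_piMr.
  exact: ler_pM (addr_ge0 ler01 Bt) (addr_ge0 b0' Dt) h1 h2.
apply: (mulr_ge0 (mulr_ge0 (mulr_ge0 I0 B0) t0)).
by rewrite subr_ge0 ler_piMr.
Qed.

Lemma integral_le_area : (forall z, box p0 a b z -> q (complex.Re z) <= jac z) ->
  (forall s, x0 <= s -> s <= x0 + a -> 0 <= q s) ->
  (forall z w, hbox p0 a b z -> hbox p0 a b w -> T z = T w -> z = w) ->
  ((b * I)%:E <= area S)%E.
Proof.
move=> Hq q0 injT; apply/lee_addgt0Pr => d d0.
pose A := C * a ^+ 2; pose B := 3 * c1 / a; pose D := 3 * c1.
have A0 : 0 <= A by rewrite mulr_ge0 // exprn_ge0 // ltW.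
have B0 : 0 <= B by rewrite divr_ge0 ?(ltW a0) // mulr_ge0.
have D0 : 0 <= D by rewrite mulr_ge0.
pose G := A * b + I * (B * b + D).
have b0' := ltW b0.
have G0 : 0 <= G :=
  addr_ge0 (mulr_ge0 A0 b0') (mulr_ge0 I0 (addr_ge0 (mulr_ge0 B0 b0') D0)).
pose E := (M + 2 * L + 1) * (a + b).
have E0 : 0 <= E by rewrite mulr_ge0 ?addr_ge0 ?mulr_ge0 // ltW.
pose W := G / d + (E / m + 1 + B + D / b).
have E2 : 0 <= E / m by rewrite divr_ge0 // ltW.
have E3 : 0 <= D / b by rewrite divr_ge0.
have E4 : 0 <= G / d by rewrite divr_ge0 // ltW.
pose N := (Num.truncn W).+1.
have N0 : (0 < N)%N by [].
have NR : 0 < N%:R :> R by rewrite ltr0n.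
have WN : W < N%:R by exact: truncnS_gt.
pose t : R := N%:R^-1; have t0 : 0 < t by rewrite invr_gt0.
have Nt : N%:R * t = 1 by rewrite mulfV // gt_eqF.
have small x : x <= N%:R -> x * t <= 1.
  by move=> xN; rewrite -Nt ler_wpM2r // ltW.
have GN : G * t <= d.
  have : G / d * t <= 1 by apply: small; rewrite /W in WN; lra.
  by rewrite mulrAC ler_pdivrMr // mul1r.
have Bt1 : B * t <= 1 by apply: small; rewrite /W in WN; lra.
have Dt1 : D * t <= b.
  have : D / b * t <= 1 by apply: small; rewrite /W in WN; lra.
  by rewrite mulrAC ler_pdivrMr // mul1r.
have em : e N < m.
  have -> : e N = E * t by rewrite /e /E /t; ring.
  have : E / m < N%:R by rewrite /W in WN; lra.
  by rewrite ltr_pdivrMr // -ltr_pdivrMl // mulrC.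
have Bt : 0 <= B * t by rewrite mulr_ge0 // ltW.
have Dt : 0 <= D * t by rewrite mulr_ge0 // ltW.
have aN : 0 < a * t by rewrite mulr_gt0.
have bN : 0 < b * t by rewrite mulr_gt0.
have ka : 3 * k N <= a / N%:R.
  rewrite kE // -/t; have -> : 3 * (c1 * t ^+ 2) = a * t * (B * t).
    by rewrite /B; field; rewrite gt_eqF.
  by rewrite ler_piMr // ltW.
have kb : 3 * k N <= b / N%:R.
  rewrite kE // -/t; have -> : 3 * (c1 * t ^+ 2) = t * (D * t) by rewrite /D; ring.
  by rewrite [b * t]mulrC ler_wpM2l // ltW.
have := area_grid_ge N0 injT em ka kb.
move=> H; apply: (@le_trans _ _ (area S + (G * t)%:E)%E); last first.
  by rewrite leeD2l // lee_fin.
rewrite -leeBlDr // -EFinB; apply: le_trans H; rewrite lee_fin.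
apply: (@le_trans _ _ (\sum_(ij : 'I_N * 'I_N) q (complex.Re (corner p0 a b N ij.1 ij.2))
   * (a / N%:R - 3 * k N) * (b / N%:R - 3 * k N))); last first.
  apply: ler_sum => ij _; rewrite -!mulrA ler_wpM2r //; last exact: Hq.
  by rewrite mulr_ge0 //; lra.
rewrite sum_grid // kE // -/t.
have -> : N%:R / a * (a * t - 3 * (c1 * t ^+ 2)) = 1 - B * t.
  by rewrite /B /t; field; rewrite !gt_eqF.
have -> : N%:R * (b * t - 3 * (c1 * t ^+ 2)) = b - D * t.
  by rewrite /D /t; field; rewrite !gt_eqF.
have := riemann_sum N0; rewrite -/t -/A ler_norml => /andP[+ _].
set s := \sum_(i < N) _ => hs.
have hs' : I - A * t <= s by lra.
set F := (1 - B * t) * (b - D * t).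
have F0 : 0 <= F by rewrite mulr_ge0 // subr_ge0.
have F1 : F <= b.
  rewrite /F -[leRHS]mul1r; apply: ler_pM; rewrite ?subr_ge0 // gerBl //.
have F2 : b - (B * b + D) * t <= F.
  have -> : F = b - (B * b + D) * t + B * t * (D * t) by rewrite /F; ring.
  by rewrite lerDl mulr_ge0.
rewrite -mulrA -/F.
apply: (@le_trans _ _ ((I - A * t) * F)); last by rewrite ler_wpM2r.
have h1 : I * (b - (B * b + D) * t) <= I * F by rewrite ler_wpM2l.
have h2 : A * t * F <= A * t * b by rewrite ler_wpM2l // mulr_ge0 // ltW.
by rewrite /G; lra.
Qed.

End Grid.

(** * The unit circle *)

Section Cis.
Variable R : realType.
Implicit Types (t : R).

Lemma mvt_bound (f df : R -> R) (B t : R) : (forall x : R, is_derive x 1 f (df x)) ->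
  (forall c : R, `|c| <= `|t| -> `|df c| <= B) -> `|f t - f 0| <= B * `|t|.
Proof.
move=> Hd HB; have cf : continuous f.
  move=> x; apply: differentiable_continuous; apply/derivable1_diffP.
  exact: ex_derive.
have [t0|t0] := leP 0 t.
  have [|c] := @MVT_segment R f df 0 t t0 (fun x _ => Hd x).
    exact: continuous_subspaceT.
  rewrite in_itv /= => /andP[c0 ct] ->; rewrite subr0 normrM ler_wpM2r //.
  by apply: HB; rewrite !ger0_norm.
have [|c] := @MVT_segment R f df t 0 (ltW t0) (fun x _ => Hd x).
  exact: continuous_subspaceT.
rewrite in_itv /= => /andP[ct c0] E; rewrite distrC E sub0r normrM normrN ler_wpM2r //.
by apply: HB; rewrite !ler0_norm ?lerN2 // ltW.
Qed.

Lemma norm_sin_le t : `|sin t| <= `|t|.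
Proof.
have := @mvt_bound sin cos 1 t (fun x => is_derive_sin x).
by rewrite sin0 subr0 mul1r; apply => c _; exact: cos_max.
Qed.

Lemma norm_cosB1_le t : `|cos t - 1| <= `|t| ^+ 2.
Proof.
have := @mvt_bound cos (fun x => - sin x) `|t| t (fun x => is_derive_cos x).
rewrite cos0 expr2; apply => c ct.
by rewrite normrN; exact: le_trans (norm_sin_le c) ct.
Qed.

Lemma norm_cosB1_le1 t : `|cos t - 1| <= `|t|.
Proof.
have := @mvt_bound cos (fun x => - sin x) 1 t (fun x => is_derive_cos x).
rewrite cos0 mul1r; apply => c ct.
by rewrite normrN; exact: sin_max.
Qed.

Lemma norm_sinBid_le t : `|sin t - t| <= `|t| ^+ 2.
Proof.
have D (x : R) : is_derive x 1 (fun y : R => sin y - y) (cos x - 1).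
  by apply: is_deriveB.
have := mvt_bound (t := t) D; rewrite sin0 subr0 subr0 expr2 => /(_ `|t|); apply => c ct.
exact: le_trans (norm_cosB1_le1 c) ct.
Qed.

Definition cis t : R[i] := cos t +i* sin t.

Lemma normc_cis t : normc (cis t) = 1.
Proof. by rewrite /= cos2Dsin2 sqrtr1. Qed.

Lemma cisD t t' : cis (t + t') = cis t * cis t'.
Proof. by rewrite /cis cosD sinD; congr Complex; ring. Qed.

Lemma cis_lip t t' : normc (cis t' - cis t) <= 2 * `|t' - t|.
Proof.
have -> : cis t' - cis t = cis t * (cis (t' - t) - 1).
  by rewrite mulrBr -cisD mulr1 [t + _]addrC subrK.
rewrite normcM normc_cis mul1r; apply: le_trans (normc_le_ReIm _) _.
rewrite ReB ImD ImN /= oppr0 addr0.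
by have := norm_sin_le (t' - t); have := norm_cosB1_le1 (t' - t); lra.
Qed.

Lemma cis_quad t t' :
  normc (cis t' - cis t - (t' - t)%:C * ('i * cis t)) <= 2 * `|t' - t| ^+ 2.
Proof.
have -> : cis t' - cis t - (t' - t)%:C * ('i * cis t) =
   cis t * (cis (t' - t) - 1 - (0 +i* (t' - t))).
  have -> : cis t' = cis t * cis (t' - t) by rewrite -cisD addrC subrK.
  have -> : 0 +i* (t' - t) = (t' - t)%:C * 'i :> R[i].
    by apply/eqP; rewrite eq_complex /=; apply/andP; split; apply/eqP; ring.
  by ring.
rewrite normcM normc_cis mul1r; apply: le_trans (normc_le_ReIm _) _.
rewrite !(ReB, ImD, ImN) /= subr0 oppr0 addr0.
by have := norm_sinBid_le (t' - t); have := norm_cosB1_le (t' - t); lra.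
Qed.

Lemma cis_inj t t' : `|t - t'| < pi *+ 2 -> cis t = cis t' -> t = t'.
Proof.
move=> tt E; have [c s] : cos (t - t') = 1 /\ sin (t - t') = 0.
  have : cis (t - t') = 1.
    have : cis (t - t') * cis t' = 1 * cis t' by rewrite -cisD subrK E mul1r.
    by apply: mulIf; rewrite -normc_gt0 normc_cis ltr01.
  by case.
set d := t - t' in tt c s.
suff : d = 0 by move/eqP; rewrite subr_eq0 => /eqP.
(* Half angles: cos d = 1 forces sin (d / 2) = 0, and sin does not vanish on ]0,
   pi[. *)
have hd : d = (d / 2) *+ 2 by rewrite -mulr_natr divfK.
have sh : sin (d / 2) = 0.
  have : cos d = 1 - sin (d / 2) ^+ 2 *+ 2.
    by rewrite {1}hd cos_mulr2n cos2sin2 mulrnBl; rewrite mulr2n; ring.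
  rewrite c => /eqP; rewrite -subr_eq0 opprD opprK addrA subrr add0r mulrn_eq0 /=.
  by rewrite sqrf_eq0 => /eqP.
have [//|dn0] := eqVneq d 0.
have [dp|dn] : 0 < d \/ d < 0 by move: dn0; rewrite neq_lt => /orP[]; [right|left].
  have : 0 < sin (d / 2).
    apply: sin_gt0_pi; apply/andP; split; first by lra.
    by rewrite gtr0_norm // mulr2n in tt; lra.
  by rewrite sh ltxx.
have : 0 < sin (- (d / 2)).
  apply: sin_gt0_pi; apply/andP; split; first by lra.
  by rewrite ltr0_norm // mulr2n in tt; lra.
by rewrite sinN sh oppr0 ltxx.
Qed.

Lemma cis_surj (z : R[i]) : normc z = 1 -> exists2 t, 0 <= t < pi *+ 2 & z = cis t.
Proof.
move=> z1; have := sqr_normcE z; rewrite z1 expr1n.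
case: z z1 => x y _ /= xy.
have x1 : -1 <= x <= 1.
  rewrite -ler_norml -(@ler_pXn2r _ 2) ?nnegrE // real_normK ?num_real // expr1n.
  by have := sqr_ge0 y; lra.
have [a0 ap] : 0 <= acos x /\ acos x <= pi by split; [exact: acos_ge0|exact: acos_lepi].
have cx : cos (acos x) = x by apply: acosK; rewrite in_itv.
have sx : sin (acos x) = `|y|.
  rewrite sin_acos // (_ : 1 - x ^+ 2 = y ^+ 2) ?sqrtr_sqr //; lra.
have p0 := pi_gt0 R.
have [y0|y0] := leP 0 y.
  exists (acos x); last by rewrite /cis cx sx ger0_norm.
  by rewrite a0 mulr2n /=; lra.
exists (pi *+ 2 - acos x); last first.
  rewrite /cis addrC cosD2pi sinD2pi cosN sinN cx sx ltr0_norm // opprK //.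
have : acos x != 0.
  by apply/eqP => E; move: sx; rewrite E sin0 ltr0_norm // => /eqP; rewrite eq_sym oppr_eq0 lt_eqF.
move=> an0; have ap0 : 0 < acos x by rewrite lt_def an0.
by rewrite mulr2n; apply/andP; split; lra.
Qed.

End Cis.

(** * Images of discs are Borel sets *)

Section Measurability.
Variable R : realType.
Local Notation Tm := (measurableTypeR R).

Lemma rat_ball (x e : R) : 0 < e -> exists q : rat, ball (ratr q : R) e x.
Proof.
move=> e0; have [|q] := @rat_in_itvoo R (x - e) (x + e); first by lra.
rewrite in_itv /= => /andP[h1 h2]; exists q.
by rewrite /ball /= ltr_norml; apply/andP; split; lra.
Qed.

(** The balls with rational centre and radius 1 / (k + 1) form a countable base. *)
Lemma open_measurable2 (U : set (R * R)) : open U -> measurable (U : set (Tm * Tm)).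
Proof.
move=> oU.
pose F (i : rat * rat * nat) : set (Tm * Tm) :=
  if pselect ((ball (ratr i.1.1 : R) (i.2.+1%:R^-1) `*` ball (ratr i.1.2 : R) (i.2.+1%:R^-1))
      `<=` U) then
   ball (ratr i.1.1 : R) (i.2.+1%:R^-1) `*` ball (ratr i.1.2 : R) (i.2.+1%:R^-1) else set0.
have -> : (U : set (Tm * Tm)) = \bigcup_i F i.
  apply/seteqP; split => [[x y] Uxy|p [i _]]; last by rewrite /F; case: pselect => // H /H.
  move: oU; rewrite openE => /(_ _ Uxy) /nbhs_ballP [d /= d0 Hd].
  have [k kd] : exists k : nat, k.+1%:R^-1 < d / 2.
    exists (Num.truncn (d / 2)^-1); rewrite invf_plt ?posrE ?divr_gt0 //.
    exact: truncnS_gt.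
  have k0 : 0 < k.+1%:R^-1 :> R by rewrite invr_gt0.
  have [q1 q1x] := rat_ball x k0; have [q2 q2y] := rat_ball y k0.
  have kd2 : k.+1%:R^-1 + k.+1%:R^-1 <= d.
    by move: kd; set u := _^-1 => kd; lra.
  exists ((q1, q2), k) => //; rewrite /F /=; case: pselect => // H; exfalso; apply: H.
  move=> [x' y'] [/= h1 h2]; apply: Hd; split => /=.
    apply: (le_ball kd2).
    exact: ball_triangle (ball_sym q1x) h1.
  apply: (le_ball kd2).
  exact: ball_triangle (ball_sym q2y) h2.
apply: countable_bigcupT_measurable => // i.
rewrite /F; case: pselect => H; last exact: measurable0.
by apply: measurableX; exact: measurable_ball.
Qed.

Lemma closed_measurable2 (U : set (R * R)) : closed U -> measurable (U : set (Tm * Tm)).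
Proof.
by move=> cU; rewrite -[U]setCK; apply: measurableC; apply: open_measurable2; exact: closed_openC.
Qed.

Lemma hausdorff_RR : hausdorff_space (R * R)%type.
Proof. exact: (@norm_hausdorff R (R * R)%type). Qed.

(** The image is compact. *)
Lemma measurable_lip_image (f : R[i] -> R[i]) (rho L : R) : 0 <= L ->
  (forall z w, normc z <= rho -> normc w <= rho ->
     normc (f z - f w) <= L * normc (z - w)) ->
  measurable ([set p : R * R | (f @` [set z | normc z <= rho]) (p.1 +i* p.2)] : set (Tm * Tm)).
Proof.
move=> L0 HL; pose K := [set p : R * R | normc (toC p) <= rho].
have cK : compact K.
  by apply: (@compact_toC R [set z | normc z <= rho] rho) => //; exact: closed_disc_sep.
pose F (p : R * R) : R * R := (complex.Re (f (toC p)), complex.Im (f (toC p))).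
have -> : [set p : R * R | (f @` [set z | normc z <= rho]) (p.1 +i* p.2)] = F @` K.
  apply/seteqP; split => [[x y] /= [z zr fz]|_ [p Kp <-]].
    exists (complex.Re z, complex.Im z); first by rewrite /K /toC /=; case: (z) zr.
    by rewrite /F /toC /=; case: (z) fz => a b /= ->.
  by exists (toC p) => //; rewrite /F; case: (f (toC p)).
apply: closed_measurable2; apply: compact_closed; first exact: hausdorff_RR.
apply: continuous_compact cK.
rewrite continuous_subspace_in => p; rewrite inE => pK.
apply/cvg_ballP => e e0; rewrite -nbhs_subspace_in //.
apply/nbhs_ballP; exists (e / (2 * (L + 1))) => /=.
  by rewrite divr_gt0 // mulr_gt0 // ltr_wpDl.
move=> q pq qK /=.
have L1 : 0 < L + 1 by lra.
have H : normc (f (toC p) - f (toC q)) < e.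
  apply: le_lt_trans (HL _ _ pK qK) _.
  apply: (@le_lt_trans _ _ ((L + 1) * normc (toC p - toC q))).
    by rewrite ler_wpM2r ?normc_ge0 //; lra.
  rewrite mulrC -ltr_pdivlMr //; apply: lt_le_trans (normc_toC_le pq) _.
  by rewrite le_eqVlt; apply/orP; left; apply/eqP; field; rewrite gt_eqF.
split; rewrite /ball /=; apply: le_lt_trans H.
  by rewrite -ReB normc_Re.
by rewrite -ImN -ImD normc_Im.
Qed.

(** The open disc is a countable union of closed discs. *)
Lemma measurable_image_disc (f : R[i] -> R[i]) (r : R) : 0 < r ->
  (forall rho, 0 < rho -> rho < r -> exists2 L, 0 <= L &
     forall z w, normc z <= rho -> normc w <= rho ->
     normc (f z - f w) <= L * normc (z - w)) ->
  measurable ([set p : R * R | (f @` [set z | normc z < r]) (p.1 +i* p.2)] : set (Tm * Tm)).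
Proof.
move=> r0 Hf; pose rk k := r - r / k.+2%:R.
have rk1 k : 0 < rk k /\ rk k < r.
  have k0 : 0 < k.+2%:R :> R by rewrite ltr0n.
  rewrite /rk; split; last by rewrite gtrBl divr_gt0.
  by rewrite subr_gt0 ltr_pdivrMr // ltr_pMr // ltr1n.
have -> : [set p : R * R | (f @` [set z | normc z < r]) (p.1 +i* p.2)] =
  \bigcup_k [set p : R * R | (f @` [set z | normc z <= rk k]) (p.1 +i* p.2)].
  apply/seteqP; split => [p /= [z zr fz]|p [k _] /= [z zr fz]]; last first.
    by exists z => //=; apply: le_lt_trans zr _; case: (rk1 k).
  have d0 : 0 < r - normc z by rewrite subr_gt0.
  exists (Num.truncn (r / (r - normc z))) => //; exists z => //=.
  rewrite /rk; set k := Num.truncn _.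
  have kk : r / (r - normc z) < k.+2%:R.
    by apply: lt_trans (truncnS_gt _) _; rewrite ltr_nat.
  have k0 : 0 < k.+2%:R :> R by rewrite ltr0n.
  have : r / k.+2%:R <= r - normc z.
    by rewrite ler_pdivrMr // mulrC -ler_pdivrMr // ltW.
  by rewrite lerBrDr -lerBrDl.
apply: bigcupT_measurable => k; have [k0 kr] := rk1 k.
by have [L L0 HL] := Hf _ k0 kr; exact: measurable_lip_image HL.
Qed.

Lemma area_lip_image_le (f : R[i] -> R[i]) (rho L : R) : 0 < rho -> 0 <= L ->
  (forall z, normc z < rho -> normc (f z - f 0) <= L * normc z) ->
  measurable ([set p : R * R | (f @` [set z | normc z < rho]) (p.1 +i* p.2)] : set (Tm * Tm)) ->
  (area (f @` [set z | (normc z < rho)%R]) <= ((2 * L * rho) ^+ 2)%:E)%E.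
Proof.
move=> r0 L0 HL mf.
have Lr : 0 <= L * rho by rewrite mulr_ge0 // ltW.
have D0 : complex.Im ((1 : R[i])^* * 'i) != 0.
  by rewrite rmorph1 mul1r /= oner_eq0.
have [||mP aP] := @area_parallelogram R (f 0) 1 'i (- (L * rho)) (L * rho) (- (L * rho)) (L * rho) D0;
  [lra|lra|].
have -> : ((2 * L * rho) ^+ 2)%:E = area
   [set w | exists x y, [/\ - (L * rho) <= x <= L * rho, - (L * rho) <= y <= L * rho &
      w = f 0 + x%:C * 1 + y%:C * 'i]].
  by rewrite [RHS]aP rmorph1 mul1r /= normr1 mul1r; congr EFin; ring.
apply: le_measure; rewrite ?inE //.
move=> [s t] /= [z zr fz].
have fL : normc (f z - f 0) <= L * rho.
  by apply: le_trans (HL _ zr) _; rewrite ler_wpM2l // ltW.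
exists (complex.Re (f z - f 0)), (complex.Im (f z - f 0)); split.
- by rewrite -ler_norml; exact: le_trans (normc_Re _) fL.
- by rewrite -ler_norml; exact: le_trans (normc_Im _) fL.
rewrite -fz mulr1 [_ * 'i]mulrC -addrA -complexE addrC subrK //.
Qed.

End Measurability.

(** * Primitives of Lipschitz functions *)

Section Primitive.
Variable R : realType.
Local Notation mu := (@lebesgue_measure R).

Definition lip01 (q : R -> R) := exists K, [/\ 0 <= K,
  forall x, 0 <= x <= 1 -> `|q x| <= K &
  forall x y, 0 <= x <= 1 -> 0 <= y <= 1 -> `|q x - q y| <= K * `|x - y|].

Lemma lip01_cst c : lip01 (fun=> c).
Proof.
by exists `|c|; split => // x y _ _; rewrite subrr normr0 mulr_ge0.
Qed.

Lemma lip01_id : lip01 id.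
Proof.
exists 1; split => // [x /andP[x0 x1]|x y _ _]; last by rewrite mul1r.
by rewrite ger0_norm.
Qed.

Lemma lip01D p q : lip01 p -> lip01 q -> lip01 (fun x => p x + q x).
Proof.
move=> [K [K0 bK lK]] [L [L0 bL lL]]; exists (K + L); split; first exact: addr_ge0.
  by move=> x hx; apply: le_trans (ler_normD _ _) _; rewrite lerD ?bK ?bL.
move=> x y hx hy; have -> : p x + q x - (p y + q y) = (p x - p y) + (q x - q y) by ring.
by apply: le_trans (ler_normD _ _) _; rewrite mulrDl lerD ?lK ?lL.
Qed.

Lemma lip01M p q : lip01 p -> lip01 q -> lip01 (fun x => p x * q x).
Proof.
move=> [K [K0 bK lK]] [L [L0 bL lL]]; exists (K * L + K * L); split.
- by rewrite addr_ge0 // mulr_ge0.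
- move=> x hx; rewrite normrM; apply: le_trans (ler_pM _ _ (bK x hx) (bL x hx)) _ => //.
  by rewrite lerDl mulr_ge0.
move=> x y hx hy; have -> : p x * q x - p y * q y = p x * (q x - q y) + (p x - p y) * q y by ring.
apply: le_trans (ler_normD _ _) _; rewrite !normrM mulrDl; apply: lerD.
  by rewrite -mulrA; apply: ler_pM => //; [exact: bK|exact: lL].
by rewrite mulrAC; apply: ler_pM => //; [exact: lK|exact: bL].
Qed.

Lemma lip01X p n : lip01 p -> lip01 (fun x => p x ^+ n).
Proof.
move=> hp; elim: n => [|n IH]; first exact: lip01_cst.
have -> : (fun x => p x ^+ n.+1) = (fun x => p x * p x ^+ n).
  by apply/funext => x; rewrite exprS.
exact: lip01M.
Qed.

Lemma lip01_integrable q t : lip01 q -> t <= 1 -> mu.-integrable `[0, t] (EFin \o q).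
Proof.
move=> [K [K0 bK lK]] t1; apply: continuous_compact_integrable; first exact: segment_compact.
rewrite continuous_subspace_in => x; rewrite inE /= in_itv /= => /andP[x0 xt].
apply/cvgrPdist_lt => e e0; rewrite -nbhs_subspace_in; last by rewrite /= in_itv /= x0.
have K1 : 0 < K + 1 by lra.
apply/nbhs_ballP; exists (e / (K + 1)) => /=; first by rewrite divr_gt0.
move=> y; rewrite /ball /= => xy; rewrite in_itv /= => /andP[y0 yt].
rewrite /from_subspace; apply: le_lt_trans (lK x y _ _) _.
- by rewrite x0 (le_trans xt).
- by rewrite y0 (le_trans yt).
rewrite ltr_pdivlMr // mulrC in xy; apply: le_lt_trans xy.
by rewrite ler_wpM2r //; lra.
Qed.

Lemma primitive_quad q : lip01 q -> exists2 C, 0 <= C & forall s t : R,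
  0 <= s -> s <= t -> t <= 1 ->
  `|\int[mu]_(x in `[0, t]) q x - \int[mu]_(x in `[0, s]) q x - q s * (t - s)|
    <= C * (t - s) ^+ 2.
Proof.
move=> hq; have [K [K0 bK lK]] := hq; exists K => // s t s0 st t1.
have iq := lip01_integrable hq t1.
rewrite Rintegral_itvB // ?bnd_simp //.
have sub : `]s, t]%classic `<=` `[0, t]%classic.
  move=> x /=; rewrite !in_itv /= => /andP[sx ->]; rewrite andbT.
  by rewrite ltW // (le_lt_trans s0).
have mst : measurable (`]s, t]%classic : set (measurableTypeR R)) by exact: measurable_itv.
have iqst : mu.-integrable `]s, t] (EFin \o q).
  by apply: integrableS iq => //; exact: measurable_itv.
have icst c : mu.-integrable `]s, t] (EFin \o (fun=> c : R)).
  have := lip01_integrable (lip01_cst c) t1.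
  by apply: integrableS => //; exact: measurable_itv.
have len : fine (mu `]s, t]) = t - s.
  rewrite lebesgue_measure_itv /= lte_fin; case: ltrP => // ts /=.
  by apply/esym; lra.
have ts : 0 <= t - s by rewrite subr_ge0.
have bnd x : `]s, t]%classic x -> `|q x - q s| <= K * (t - s).
  rewrite /= in_itv /= => /andP[sx xt]; apply: le_trans (lK _ _ _ _) _.
  - by rewrite ltW ?(le_lt_trans s0) //= (le_trans xt).
  - by rewrite s0 (le_trans st).
  by rewrite ler_wpM2l // ger0_norm; lra.
have up := @le_Rintegral _ _ _ mu _ q (fun=> q s + K * (t - s)) mst iqst (icst _).
have lo := @le_Rintegral _ _ _ mu _ (fun=> q s - K * (t - s)) q mst (icst _) iqst.
rewrite Rintegral_cst // len in up; rewrite Rintegral_cst // len in lo.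
have {}up : \int[mu]_(x in `]s, t]) q x <= (q s + K * (t - s)) * (t - s).
  by apply: up => x /bnd; rewrite ler_norml => /andP[_]; rewrite lerBlDl.
have {}lo : (q s - K * (t - s)) * (t - s) <= \int[mu]_(x in `]s, t]) q x.
  by apply: lo => x /bnd; rewrite ler_norml => /andP[+ _]; rewrite lerBrDl.
move: up lo; set J := Rintegral _ _ _ => up lo.
by rewrite ler_norml; apply/andP; split; lra.
Qed.

End Primitive.

(** * Polar coordinates *)

Section Polar.
Variable R : realType.
Implicit Types (z w : R[i]).

Definition polar z : R[i] := (complex.Re z)%:C * cis (complex.Im z).

Lemma normc_polar z : normc (polar z) = `|complex.Re z|.
Proof. by rewrite normcM normcR normc_cis mulr1. Qed.

Lemma polar_lip z w : 0 <= complex.Re z <= 1 ->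
  normc (polar w - polar z) <= 3 * normc (w - z).
Proof.
move=> /andP[z0 z1].
have -> : polar w - polar z = (complex.Re w - complex.Re z)%:C * cis (complex.Im w)
   + (complex.Re z)%:C * (cis (complex.Im w) - cis (complex.Im z)).
  by rewrite /polar rmorphB; ring.
apply: le_trans (le_normcD _ _) _.
rewrite !normcM !normcR normc_cis mulr1 (ger0_norm z0).
have h1 := normc_Re (w - z); rewrite ReB in h1.
have h2 := normc_Im (w - z); rewrite ImD ImN in h2.
have h3 := cis_lip (complex.Im z) (complex.Im w).
have : complex.Re z * normc (cis (complex.Im w) - cis (complex.Im z)) <=
  1 * normc (cis (complex.Im w) - cis (complex.Im z)).
  by rewrite ler_wpM2r // normc_ge0.
by lra.
Qed.

(** The differential of (s, t) |-> s e^(it) has the columns e^(it) and i s e^(it). *)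
Lemma polar_quad z w : 0 <= complex.Re z <= 1 ->
  normc (polar w - polar z - lin2 (cis (complex.Im z)) ('i * polar z) (w - z))
    <= 4 * normc (w - z) ^+ 2.
Proof.
move=> /andP[z0 z1].
have h1 := normc_Re (w - z); rewrite ReB in h1.
have h2 := normc_Im (w - z); rewrite ImD ImN in h2.
have h3 := cis_lip (complex.Im z) (complex.Im w).
have h4 := cis_quad (complex.Im z) (complex.Im w).
have nw := normc_ge0 (w - z).
rewrite /lin2 ReB ImD ImN /polar.
move: h1 h2 h3 h4; set s := complex.Re z in z0 z1 *; set s' := complex.Re w.
set t := complex.Im z; set t' := complex.Im w; set d := normc (w - z) in nw *.
move=> h1 h2 h3 h4.
have -> : s'%:C * cis t' - s%:C * cis t -
   ((s' - s)%:C * cis t + (t' - t)%:C * ('i * (s%:C * cis t))) =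
  (s' - s)%:C * (cis t' - cis t) + s%:C * (cis t' - cis t - (t' - t)%:C * ('i * cis t)).
  by rewrite rmorphB; ring.
apply: le_trans (le_normcD _ _) _; rewrite !normcM !normcR (ger0_norm z0).
have k1 : `|s' - s| * normc (cis t' - cis t) <= d * (2 * d).
  by apply: ler_pM => //; [exact: normc_ge0|lra].
have k2 : `|t' - t| ^+ 2 <= d ^+ 2 by rewrite lerXn2r ?nnegrE.
have k3 : s * normc (cis t' - cis t - (t' - t)%:C * ('i * cis t)) <= 1 * (2 * d ^+ 2).
  by apply: ler_pM => //; [exact: normc_ge0|lra].
by move: k2 k3; rewrite !expr2; lra.
Qed.

Lemma polar_inj z w : 0 < complex.Re z -> 0 < complex.Re w ->
  0 <= complex.Im z < pi *+ 2 -> 0 <= complex.Im w < pi *+ 2 ->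
  polar z = polar w -> z = w.
Proof.
move=> z0 w0 /andP[z1 z2] /andP[w1 w2] E.
have Re_eq : complex.Re z = complex.Re w.
  by have := congr1 (@normc R) E; rewrite !normc_polar !gtr0_norm.
have Im_eq : complex.Im z = complex.Im w.
  apply: cis_inj; first by rewrite ltr_norml; apply/andP; split; lra.
  apply: (mulfI (x := (complex.Re z)%:C)); first by rewrite -normc_eq0 normcR normr_eq0 gt_eqF.
  by rewrite [LHS]E /polar Re_eq.
by case: z w Re_eq Im_eq {z0 w0 z1 z2 w1 w2 E} => a b [c d] /= -> ->.
Qed.

Lemma polar_surj (x : R[i]) : 0 < normc x -> exists z,
  [/\ complex.Re z = normc x, 0 <= complex.Im z < pi *+ 2 & polar z = x].
Proof.
move=> x0; have xn : (normc x)%:C != 0 :> R[i] by rewrite -normc_eq0 normcR normr_eq0 gt_eqF.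
have [|t ht E] := @cis_surj R (x / (normc x)%:C).
  by rewrite normcM normcV normcR gtr0_norm // mulfV // gt_eqF.
exists (normc x +i* t); split => //.
by rewrite /polar /= -[cis t]E mulrC divfK.
Qed.

End Polar.

(** * Area of the image of a disc under the harmonic map *)

Section HarmonicArea.
Variable R : realType.
Implicit Types (z w : R[i]).
Local Notation Tm := (measurableTypeR R).
Variables (n : nat) (lam : R[i]) (h g hp gp : R[i] -> R[i]).
Hypothesis n0 : (0 < n)%N.
Hypothesis lam_le : normc lam <= (n%:R + 1)^-1.
Hypothesis Q : forall rho, 0 < rho -> rho < 1 -> quad_approx h hp rho /\ quad_approx g gp rho.
Hypothesis Lp : forall rho, 0 < rho -> rho < 1 -> lip_on hp rho /\ lip_on gp rho.
Hypothesis gpE : forall z, normc z < 1 -> gp z = lam * z ^+ n * hp z.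
Hypothesis hp_near : forall z, normc z < 1 -> normc (1 - hp z) <= normc z.

Let f z := h z + (g z)^*.

Let hp_lower z : normc z < 1 -> 1 - normc z <= normc (hp z).
Proof.
move=> z1; have := hp_near z1; have := le_normc_sub 1 (1 - hp z).
by rewrite subKr normc1; lra.
Qed.

Let hp_upper z : normc z < 1 -> normc (hp z) <= 1 + normc z.
Proof.
move=> z1; have := hp_near z1; have := le_normcB 1 (1 - hp z).
by rewrite subKr normc1; lra.
Qed.

Let hp_Re z : normc z < 1 -> 1 - normc z <= complex.Re (hp z).
Proof.
move=> z1; have := hp_near z1; have := Re_le_normc (1 - hp z).
by rewrite ReB /=; lra.
Qed.

Let lam_half : normc lam <= 1 / 2.
Proof. exact: normc_mu_half n0 lam_le. Qed.

Let gp_norm z : normc z < 1 -> normc (gp z) = normc lam * normc z ^+ n * normc (hp z).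
Proof. by move=> z1; rewrite gpE // !normcM normcX. Qed.

Let gp_half z : normc z < 1 -> normc (gp z) <= 1 / 2 * normc (hp z).
Proof.
move=> z1; rewrite gp_norm // ler_wpM2r ?normc_ge0 //.
apply: le_trans lam_half; rewrite ler_piMr ?normc_ge0 //.
by rewrite exprn_ile1 ?normc_ge0 // ltW.
Qed.

Lemma harmonic_univalent z w : normc z < 1 -> normc w < 1 -> f z = f w -> z = w.
Proof.
move=> z1 w1; pose rho := Num.max (1 / 2) (Num.max (normc z) (normc w)).
have r0 : 0 < rho by rewrite lt_max; apply/orP; left; lra.
have r1 : rho < 1 by rewrite !gt_max z1 w1 !andbT; lra.
have zr : normc z <= rho by rewrite !le_max lexx !orbT.
have wr : normc w <= rho by rewrite !le_max lexx !orbT.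
apply: (@harmonic_inj R h g [set x | normc x <= rho]) => //.
move: rho r0 r1 {zr wr z1 w1} => rho r0 r1 e e1 {}z {}w /= zr wr.
have [[Mh Mh0 HMh] [Mg Mg0 HMg]] := Q r0 r1.
have mule : normc (e * lam) <= (n%:R + 1)^-1 by rewrite normcM e1 mul1r.
apply: (@close_to_convex_inj R n (e * lam) (fun x => h x + e * g x) hp rho
  (1 - rho) 2 (Mh + Mg)) => //.
- lra.
- exact: addr_ge0.
- by move=> x xr; have := hp_Re (le_lt_trans xr r1); lra.
- by move=> x xr; have := hp_upper (le_lt_trans xr r1); lra.
move=> x y xr yr; have h1 := HMh x y xr yr; have h2 := HMg x y xr yr.
have -> : h y + e * g y - (h x + e * g x) - hp x * dphi n (e * lam) x * (y - x) =
  (h y - h x - hp x * (y - x)) + e * (g y - g x - gp x * (y - x)).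
  by rewrite gpE; [rewrite /dphi; ring|lra].
apply: le_trans (le_normcD _ _) _; rewrite normcM e1 mul1r mulrDl; exact: lerD.
Qed.

Let T z := f (polar z).
Let Tx z := hp (polar z) * cis (complex.Im z) + (gp (polar z) * cis (complex.Im z))^*.
Let Ty z := hp (polar z) * ('i * polar z) + (gp (polar z) * ('i * polar z))^*.

(** The differential of f is w |-> h' w + conj (g' w), composed with the one of the polar
    map. *)
Lemma lin2_chart z w : lin2 (Tx z) (Ty z) w =
  hp (polar z) * lin2 (cis (complex.Im z)) ('i * polar z) w +
  (gp (polar z) * lin2 (cis (complex.Im z)) ('i * polar z) w)^*.
Proof.
rewrite /lin2 /Tx /Ty; move: (cis _) ('i * polar z) (hp _) (gp _) => u v a b.
case: u v a b => u1 u2 [v1 v2] [a1 a2] [b1 b2].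
by apply/eqP; rewrite eq_complex /=; apply/andP; split; apply/eqP; ring.
Qed.

(** The differential w |-> A w + conj (B w) has determinant |A|^2 - |B|^2, and the polar
    map contributes the factor s. *)
Lemma jac_chart z : 0 <= complex.Re z -> complex.Re z < 1 ->
  jac Tx Ty z = complex.Re z * normc (hp (polar z)) ^+ 2 *
    (1 - normc lam ^+ 2 * complex.Re z ^+ (2 * n)).
Proof.
move=> z0 z1; have pz : normc (polar z) = complex.Re z by rewrite normc_polar ger0_norm.
have pz1 : normc (polar z) < 1 by rewrite pz.
have E : complex.Im ((Tx z)^* * Ty z) =
   complex.Re z * (normc (hp (polar z)) ^+ 2 - normc (gp (polar z)) ^+ 2).
  have uu : cos (complex.Im z) ^+ 2 + sin (complex.Im z) ^+ 2 = 1 := cos2Dsin2 _.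
  rewrite /Tx /Ty; move: (hp (polar z)) (gp (polar z)) => A B.
  rewrite /polar /cis !sqr_normcE.
  move: uu; move: (cos _) (sin _) (complex.Re z) => x y s uu.
  case: A B => a1 a2 [b1 b2].
  transitivity (s * (a1 ^+ 2 + a2 ^+ 2 - (b1 ^+ 2 + b2 ^+ 2)) * (x ^+ 2 + y ^+ 2)).
    by rewrite /=; ring.
  by rewrite uu mulr1.
rewrite /jac E gp_norm // pz.
have -> : complex.Re z * (normc (hp (polar z)) ^+ 2 -
    (normc lam * complex.Re z ^+ n * normc (hp (polar z))) ^+ 2) =
  complex.Re z * normc (hp (polar z)) ^+ 2 * (1 - normc lam ^+ 2 * complex.Re z ^+ (2 * n)).
  by rewrite mulnC exprM; ring.
have l1 : normc lam ^+ 2 <= 1 by rewrite exprn_ile1 ?normc_ge0 //; have := lam_half; lra.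
have s1 : complex.Re z ^+ (2 * n) <= 1 by rewrite exprn_ile1 // ltW.
rewrite ger0_norm //; apply: mulr_ge0; first by rewrite mulr_ge0 // exprn_ge0 ?normc_ge0.
by rewrite subr_ge0 mulr_ile1 ?exprn_ge0 ?normc_ge0.
Qed.

Lemma f_lip s : 0 < s -> s < 1 -> exists2 L, 0 <= L &
  forall z w, normc z <= s -> normc w <= s -> normc (f z - f w) <= L * normc (z - w).
Proof.
move=> s0 s1; have [[Mh Mh0 HMh] [Mg Mg0 HMg]] := Q s0 s1.
exists (Mh * 2 + 2 + (Mg * 2 + 1)); first by rewrite !addr_ge0 // mulr_ge0.
move=> z w zs ws; have d2 : normc (z - w) <= 2.
  by apply: le_trans (le_normcB _ _) _; lra.
have w1 : normc w < 1 by lra.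
have h1 := hp_upper w1; have h2 := gp_half w1.
have one (F dF : R[i] -> R[i]) (M B : R) : 0 <= M -> normc (dF w) <= B ->
   normc (F z - F w - dF w * (z - w)) <= M * normc (z - w) ^+ 2 ->
   normc (F z - F w) <= (M * 2 + B) * normc (z - w).
  move=> M0 HB HM; have -> : F z - F w = (F z - F w - dF w * (z - w)) + dF w * (z - w) by ring.
  apply: le_trans (le_normcD _ _) _; rewrite [leRHS]mulrDl; apply: lerD.
    apply: le_trans HM _; rewrite -mulrA ler_wpM2l // expr2 ler_wpM2r ?normc_ge0 //.
  by rewrite normcM ler_wpM2r ?normc_ge0.
have -> : f z - f w = (h z - h w) + (g z - g w)^* by rewrite /f rmorphB /=; ring.
apply: le_trans (le_normcD _ _) _; rewrite normc_conj [leRHS]mulrDl; apply: lerD.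
  by apply: (one h hp Mh 2) (HMh _ _ ws zs) => //; lra.
by apply: (one g gp Mg 1) (HMg _ _ ws zs) => //; lra.
Qed.

Let D s := [set z : R[i] | normc z < s].

Lemma measurable_f_disc s : 0 < s -> s < 1 ->
  measurable ([set p : R * R | (f @` D s) (p.1 +i* p.2)] : set (Tm * Tm)).
Proof.
move=> s0 s1; apply: measurable_image_disc => // t t0 ts; apply: f_lip => //; lra.
Qed.

Section Annulus.
Variables (rho r : R).
Hypotheses (rho0 : 0 < rho) (rhor : rho < r) (r1 : r < 1).
Let r0 : 0 < r := lt_trans rho0 rhor.
Let radii : [/\ 0 < rho, rho < r & r < 1]. Proof. by split. Qed.
Let p0 : R[i] := rho +i* 0.
Let a := r - rho.
Let b : R := pi *+ 2.
Let a0 : 0 < a. Proof. by rewrite subr_gt0. Qed.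
Let b0 : 0 < b. Proof. by rewrite /b pmulrn_lgt0 // pi_gt0. Qed.

Let boxE z : box p0 a b z -> rho <= complex.Re z <= r.
Proof. by move=> [/andP[/= z1 z2] _]; rewrite z1 /=; move: z2; rewrite /a addrC subrK. Qed.

Let box_polar z : box p0 a b z -> normc (polar z) = complex.Re z.
Proof.
by move=> /boxE /andP[z1 _]; rewrite normc_polar ger0_norm //; exact: le_trans (ltW rho0) z1.
Qed.

Let box01 z : box p0 a b z -> 0 <= complex.Re z <= 1.
Proof.
have [rho_gt0 rho_lt r_lt1] := radii. by move=> /boxE /andP[z1 z2]; apply/andP; split; lra. Qed.

Let box_in z : box p0 a b z -> normc (polar z) <= r.
Proof. by move=> bz; rewrite box_polar //; case/andP: (boxE bz). Qed.

Let hp2 z : box p0 a b z -> normc (hp (polar z)) <= 2.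
Proof.
have [rho_gt0 rho_lt r_lt1] := radii.
move=> bz; have zr := box_in bz; have := hp_upper (le_lt_trans zr r1).
by lra.
Qed.

Let gp1 z : box p0 a b z -> normc (gp (polar z)) <= 1.
Proof.
have [rho_gt0 rho_lt r_lt1] := radii.
move=> bz; have zr := box_in bz; have := gp_half (le_lt_trans zr r1).
by have := hp2 bz; lra.
Qed.

Lemma chart_quad : exists2 M, 0 <= M & forall z w, box p0 a b z -> box p0 a b w ->
  normc (T w - T z - lin2 (Tx z) (Ty z) (w - z)) <= M * normc (w - z) ^+ 2.
Proof.
have [rho_gt0 rho_lt r_lt1] := radii.
have [[Mh Mh0 HMh] [Mg Mg0 HMg]] := Q r0 r1.
exists ((Mh + Mg) * 9 + 12); first by rewrite addr_ge0 // mulr_ge0 // addr_ge0.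
move=> z w bz bw; rewrite lin2_chart /T /f.
have h1 := HMh _ _ (box_in bz) (box_in bw); have h2 := HMg _ _ (box_in bz) (box_in bw).
have h3 := polar_quad w (box01 bz); have h4 := polar_lip w (box01 bz).
have h5 := hp2 bz; have h6 := gp1 bz.
move: h1 h2 h3 h4 h5 h6; set x := polar z; set y := polar w.
set l := lin2 _ _ _ => h1 h2 h3 h4 h5 h6.
have -> : h y + (g y)^* - (h x + (g x)^*) - (hp x * l + (gp x * l)^*) =
  (h y - h x - hp x * (y - x)) + (g y - g x - gp x * (y - x))^* +
  (hp x * (y - x - l) + (gp x * (y - x - l))^*).
  by rewrite !(rmorphB, rmorphM) /=; ring.
set d := normc (w - z) in h3 h4 *; have d0 : 0 <= d := normc_ge0 _.
have k1 : normc (y - x) ^+ 2 <= 9 * d ^+ 2.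
  have : normc (y - x) ^+ 2 <= (3 * d) ^+ 2.
    by rewrite lerXn2r ?nnegrE ?normc_ge0 // mulr_ge0.
  by rewrite exprMn; lra.
have k2 : Mh * normc (y - x) ^+ 2 <= Mh * (9 * d ^+ 2) by rewrite ler_wpM2l.
have k3 : Mg * normc (y - x) ^+ 2 <= Mg * (9 * d ^+ 2) by rewrite ler_wpM2l.
have k4 : normc (hp x) * normc (y - x - l) <= 2 * (4 * d ^+ 2).
  by apply: ler_pM => //; exact: normc_ge0.
have k5 : normc (gp x) * normc (y - x - l) <= 1 * (4 * d ^+ 2).
  by apply: ler_pM => //; exact: normc_ge0.
have -> : ((Mh + Mg) * 9 + 12) * d ^+ 2 =
  (Mh * (9 * d ^+ 2) + Mg * (9 * d ^+ 2)) + (2 * (4 * d ^+ 2) + 1 * (4 * d ^+ 2)) by ring.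
apply: le_trans (le_normcD _ _) (lerD _ _).
  apply: le_trans (le_normcD _ _) (lerD _ _); first exact: le_trans h1 k2.
  by rewrite normc_conj; exact: le_trans h2 k3.
apply: le_trans (le_normcD _ _) (lerD _ _); first by rewrite normcM.
by rewrite normc_conj normcM.
Qed.

Let mul_lip (F G : R[i] -> R[i]) (BF BG LF LG : R) z w :
  normc (F w) <= BF -> normc (G z) <= BG ->
  normc (F w - F z) <= LF * normc (w - z) -> normc (G w - G z) <= LG * normc (w - z) ->
  normc (F w * G w - F z * G z) <= (BF * LG + LF * BG) * normc (w - z).
Proof.
move=> h1 h2 h3 h4.
have -> : F w * G w - F z * G z = F w * (G w - G z) + (F w - F z) * G z by ring.
apply: le_trans (le_normcD _ _) _; rewrite !normcM [leRHS]mulrDl; apply: lerD.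
  by rewrite -mulrA; apply: ler_pM; rewrite ?normc_ge0.
by rewrite mulrAC; apply: ler_pM; rewrite ?normc_ge0.
Qed.

Lemma chart_lip : exists L, [/\ 0 <= L,
  forall z w, box p0 a b z -> box p0 a b w -> normc (Tx w - Tx z) <= L * normc (w - z) &
  forall z w, box p0 a b z -> box p0 a b w -> normc (Ty w - Ty z) <= L * normc (w - z)].
Proof.
have [rho_gt0 rho_lt r_lt1] := radii.
have [[Lh Lh0 HLh] [Lg Lg0 HLg]] := Lp r0 r1.
have hl z w : box p0 a b z -> box p0 a b w ->
    normc (hp (polar w) - hp (polar z)) <= (Lh * 3) * normc (w - z).
  move=> bz bw; apply: le_trans (HLh _ _ (box_in bz) (box_in bw)) _.
  by rewrite -mulrA ler_wpM2l //; exact: polar_lip (box01 bz).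
have gl z w : box p0 a b z -> box p0 a b w ->
    normc (gp (polar w) - gp (polar z)) <= (Lg * 3) * normc (w - z).
  move=> bz bw; apply: le_trans (HLg _ _ (box_in bz) (box_in bw)) _.
  by rewrite -mulrA ler_wpM2l //; exact: polar_lip (box01 bz).
have ni : normc ('i : R[i]) = 1 by rewrite /= expr0n add0r expr1n sqrtr1.
have cl z w : normc (cis (complex.Im w) - cis (complex.Im z)) <= 3 * normc (w - z).
  apply: le_trans (cis_lip _ _) _; have := normc_Im (w - z); rewrite ImD ImN.
  by have := normc_ge0 (w - z); lra.
have il z w : box p0 a b z -> normc ('i * polar w - 'i * polar z) <= 3 * normc (w - z).
  by move=> bz; rewrite -mulrBr normcM ni mul1r; exact: polar_lip (box01 bz).
have i1 z : box p0 a b z -> normc ('i * polar z) <= 1.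
  by move=> bz; rewrite normcM ni mul1r; have := box_in bz; lra.
have prod_lip z w (A : R[i] -> R[i]) : box p0 a b z -> box p0 a b w ->
   normc (A z) <= 1 -> normc (A w - A z) <= 3 * normc (w - z) ->
   normc (hp (polar w) * A w + (gp (polar w) * A w)^* -
     (hp (polar z) * A z + (gp (polar z) * A z)^*))
   <= (2 * 3 + Lh * 3 * 1 + (1 * 3 + Lg * 3 * 1)) * normc (w - z).
  move=> bz bw A1 Al.
  have -> : hp (polar w) * A w + (gp (polar w) * A w)^* -
     (hp (polar z) * A z + (gp (polar z) * A z)^*) =
    (hp (polar w) * A w - hp (polar z) * A z) +
    (gp (polar w) * A w - gp (polar z) * A z)^* by rewrite rmorphB /=; ring.
  apply: le_trans (le_normcD _ _) _; rewrite normc_conj [leRHS]mulrDl; apply: lerD.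
    exact: (@mul_lip (fun x => hp (polar x)) A 2 1 (Lh * 3) 3 z w (hp2 bw) A1 (hl _ _ bz bw) Al).
  exact: (@mul_lip (fun x => gp (polar x)) A 1 1 (Lg * 3) 3 z w (gp1 bw) A1 (gl _ _ bz bw) Al).
exists (2 * 3 + Lh * 3 * 1 + (1 * 3 + Lg * 3 * 1)); split.
- by rewrite !addr_ge0 // !mulr_ge0.
- move=> z w bz bw; apply: (prod_lip z w (fun z => cis (complex.Im z)) bz bw); last exact: cl.
  by rewrite normc_cis.
move=> z w bz bw; apply: (prod_lip z w (fun z => 'i * polar z) bz bw); first exact: i1.
exact: il.
Qed.

(** |A w + conj (B w)| >= (|A| - |B|) |w| with |B| <= |A| / 2 and |A| >= 1 - r.  The
    polar map shrinks lengths at most by the factor rho, which forces the small disc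
    to be left out. *)
Lemma chart_coercive z : box p0 a b z -> forall w,
  ((1 - r) / 2 * rho) * normc w <= normc (lin2 (Tx z) (Ty z) w).
Proof.
have [rho_gt0 rho_lt r_lt1] := radii.
move=> bz w; rewrite lin2_chart; set l := lin2 _ _ _.
have zr := box_in bz; have z1 : normc (polar z) < 1 by lra.
have /andP[rz rz'] := boxE bz.
have nl : rho * normc w <= normc l.
  have -> : l = cis (complex.Im z) * (complex.Re w +i* (complex.Re z * complex.Im w)).
    rewrite /l /lin2 /polar.
    have -> : complex.Re w +i* (complex.Re z * complex.Im w) =
      (complex.Re w)%:C + 'i * (complex.Re z)%:C * (complex.Im w)%:C.
      by apply/eqP; rewrite eq_complex /=; apply/andP; split; apply/eqP; ring.
    by ring.
  rewrite normcM normc_cis mul1r.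
  rewrite -(@ler_pXn2r _ 2) ?nnegrE ?normc_ge0 ?mulr_ge0 ?normc_ge0 ?(ltW rho0) //.
  rewrite exprMn !sqr_normcE /= exprMn.
  have q1 : rho ^+ 2 <= 1 by rewrite exprn_ile1 ?(ltW rho0) //; lra.
  have q2 : rho ^+ 2 <= complex.Re z ^+ 2.
    by rewrite lerXn2r ?nnegrE ?(ltW rho0) //; lra.
  have := ler_wpM2r (sqr_ge0 (complex.Re w)) q1.
  by have := ler_wpM2r (sqr_ge0 (complex.Im w)) q2; lra.
have h1 := le_normc_sub (hp (polar z) * l) (- (gp (polar z) * l)^*).
rewrite opprK normcN normc_conj !normcM in h1.
have h2 := gp_half z1; have h3 := hp_lower z1.
have l0 := normc_ge0 l.
have h4 : normc (gp (polar z)) * normc l <= 1 / 2 * normc (hp (polar z)) * normc l.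
  by rewrite ler_wpM2r.
have h5 : (1 - r) * normc l <= normc (hp (polar z)) * normc l.
  by rewrite ler_wpM2r //; lra.
have h6 : (1 - r) * (rho * normc w) <= (1 - r) * normc l.
  by rewrite ler_wpM2l //; lra.
by lra.
Qed.

Let S := [set T z | z in hbox p0 a b].

Lemma annulus_image : S = (f @` D r) `\` (f @` D rho).
Proof.
have [rho_gt0 rho_lt r_lt1] := radii.
apply/seteqP; split => [_ [z [/andP[z1 z2] _] <-]|_ [[x xr <-] nx]].
  have zp : 0 <= complex.Re z by move: z1 => /=; lra.
  have pz : normc (polar z) = complex.Re z by rewrite normc_polar ger0_norm.
  have zr : complex.Re z < r by move: z2; rewrite /= /a addrC subrK.
  split; first by exists (polar z) => //; rewrite /D /mkset pz.
  move=> [y yr fy]; have : y = polar z.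
    by apply: harmonic_univalent => //; [exact: lt_trans yr (lt_trans rhor r1)|rewrite pz; lra].
  by move=> E; move: yr; rewrite /D /mkset E pz; move: z1 => /=; lra.
have xrho : rho <= normc x.
  by rewrite leNgt; apply/negP => xl; apply: nx; exists x.
have [|z [z1 z2 z3]] := @polar_surj R x; first exact: lt_le_trans rho0 xrho.
exists z; last by rewrite /T z3.
split; last by rewrite /= add0r.
by rewrite /= z1 xrho /= /a addrC subrK.
Qed.

Lemma measurable_annulus :
  measurable ([set p : R * R | S (p.1 +i* p.2)] : set (Tm * Tm)).
Proof.
rewrite annulus_image.
apply: (measurableD (measurable_f_disc r0 r1) (measurable_f_disc rho0 (lt_trans rhor r1))).
Qed.

Let T_inj z w : hbox p0 a b z -> hbox p0 a b w -> T z = T w -> z = w.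
Proof.
move=> hz hw; have bz := hbox_box hz; have bw := hbox_box hw.
have zr := box_in bz; have wr := box_in bw.
move=> /(harmonic_univalent (le_lt_trans zr r1) (le_lt_trans wr r1)).
case: hz hw => [/andP[z1 z2] z3] [/andP[w1 w2] w3].
apply: polar_inj; [exact: lt_le_trans z1|exact: lt_le_trans w1| |].
  by move: z3; rewrite /= add0r.
by move: w3; rewrite /= add0r.
Qed.

Variables (q : R -> R).
Hypothesis ql : lip01 q.
Let P s := \int[@lebesgue_measure R]_(x in `[0, s]) q x.

Let m0 : 0 < (1 - r) / 2 * rho.
Proof. by rewrite mulr_gt0 // divr_gt0 // subr_gt0. Qed.

Hypothesis P_incr : P rho <= P r.
Let E : complex.Re p0 + a = r. Proof. by rewrite /= /a addrC subrK. Qed.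

Let quadP C : (forall s t : R, 0 <= s -> s <= t -> t <= 1 ->
     `|P t - P s - q s * (t - s)| <= C * (t - s) ^+ 2) ->
  forall s t, complex.Re p0 <= s -> s <= t -> t <= complex.Re p0 + a ->
     `|P t - P s - q s * (t - s)| <= C * (t - s) ^+ 2.
Proof.
have [rho_gt0 rho_lt r_lt1] := radii. by rewrite E => H s t /= s0 st tr; apply: H => //; lra. Qed.

Lemma annulus_area_le :
  (forall z, normc z < 1 -> normc (hp z) ^+ 2 * (1 - normc lam ^+ 2 * normc z ^+ (2 * n))
     * normc z <= q (normc z)) ->
  (area S <= (b * (P r - P rho))%:E)%E.
Proof.
have [rho_gt0 rho_lt r_lt1] := radii.
move=> Hq; have [M M0 HM] := chart_quad; have [L [L0 HLx HLy]] := chart_lip.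
have [C C0 HC] := primitive_quad ql.
have := @area_le_integral R T Tx Ty p0 a b M L ((1 - r) / 2 * rho) a0 b0 M0 L0 m0 HM HLx HLy
  chart_coercive measurable_annulus q P C C0 (quadP HC).
rewrite E subr_ge0; apply => // z bz.
have /andP[z1 z2] := boxE bz.
rewrite jac_chart; [|lra|lra].
have := Hq (polar z); rewrite (box_polar bz).
have -> : complex.Re z < 1 by lra.
by move=> /(_ isT); apply: le_trans; rewrite le_eqVlt; apply/orP; left; apply/eqP; ring.
Qed.

Lemma annulus_area_ge : (forall s, 0 <= s -> s <= 1 -> 0 <= q s) ->
  (forall z, normc z < 1 -> q (normc z) <=
     normc (hp z) ^+ 2 * (1 - normc lam ^+ 2 * normc z ^+ (2 * n)) * normc z) ->
  ((b * (P r - P rho))%:E <= area S)%E.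
Proof.
have [rho_gt0 rho_lt r_lt1] := radii.
move=> q0 Hq; have [M M0 HM] := chart_quad; have [L [L0 HLx HLy]] := chart_lip.
have [C C0 HC] := primitive_quad ql.
have := @integral_le_area R T Tx Ty p0 a b M L ((1 - r) / 2 * rho) a0 b0 M0 L0 m0 HM HLx HLy
  chart_coercive measurable_annulus q P C C0 (quadP HC).
rewrite E subr_ge0; apply; [exact: P_incr| | |exact: T_inj]; last first.
  by move=> s /= s1 s2; apply: q0; lra.
move=> z bz; have /andP[z1 z2] := boxE bz.
rewrite jac_chart; [|lra|lra].
have := Hq (polar z); rewrite (box_polar bz).
have -> : complex.Re z < 1 by lra.
move=> /(_ isT) h1; apply: le_trans h1 _; rewrite le_eqVlt; apply/orP; left; apply/eqP; ring.
Qed.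

End Annulus.

Section Disc.
Variables (r : R) (q : R -> R).
Hypotheses (r0 : 0 < r) (r1 : r < 1) (ql : lip01 q).
Hypothesis q0 : forall s, 0 <= s -> s <= 1 -> 0 <= q s.
Let P s := \int[@lebesgue_measure R]_(x in `[0, s]) q x.

Lemma primitive_ge0 s : s <= 1 -> 0 <= P s.
Proof.
move=> s1; apply: Rintegral_ge0 => x; rewrite /= in_itv /= => /andP[x0 xs].
by apply: q0 => //; exact: le_trans s1.
Qed.

Lemma primitive_le s t : 0 <= s -> s <= t -> t <= 1 -> P s <= P t.
Proof.
move=> s0 st t1; rewrite -subr_ge0 /P Rintegral_itvB ?bnd_simp //; last exact: lip01_integrable.
apply: Rintegral_ge0 => x; rewrite /= in_itv /= => /andP[sx xt].
by apply: q0; [exact: le_trans s0 (ltW sx)|exact: le_trans t1].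
Qed.

Lemma primitive_small : exists2 K, 0 <= K & forall s, 0 <= s -> s <= 1 -> P s <= K * s.
Proof.
have [C C0 HC] := primitive_quad ql.
exists (`|q 0| + C); first exact: addr_ge0.
move=> s s0 s1; have := HC 0 s (lexx _) s0 s1.
rewrite -/(P s) set_itv1 Rintegral_set1 !subr0 ler_norml => /andP[_ h1].
have h2 : q 0 * s <= `|q 0| * s by rewrite ler_wpM2r // ler_norm.
have h3 : C * s ^+ 2 <= C * s by rewrite ler_wpM2l // expr2 ler_piMr.
by lra.
Qed.

Let twopi_gt0 : 0 < pi *+ 2 :> R. Proof. by rewrite pmulrn_lgt0 // pi_gt0. Qed.

(** The small disc of radius rho left out by the polar chart has an image of area
    O(rho^2). *)
Lemma disc_area_le :
  (forall z, normc z < 1 -> normc (hp z) ^+ 2 * (1 - normc lam ^+ 2 * normc z ^+ (2 * n))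
     * normc z <= q (normc z)) ->
  (area (f @` D r) <= (2 * pi * P r)%:E)%E.
Proof.
move=> Hq; apply/lee_addgt0Pr => d d0.
have [L L0 HL] := f_lip r0 r1.
pose rho := Num.min (r / 2) (d / ((2 * L) ^+ 2 + 1)).
have LL : 0 < (2 * L) ^+ 2 + 1 by rewrite ltr_wpDl // sqr_ge0.
have rho0 : 0 < rho by rewrite lt_min !divr_gt0.
have rr := r0; have rr1 := r1.
have rhor2 : rho <= r / 2 by rewrite ge_min lexx.
have rhor : rho < r by lra.
have rho1 : rho < 1 by lra.
have rhod : rho * ((2 * L) ^+ 2 + 1) <= d by rewrite -ler_pdivlMr // ge_min lexx orbT.
have Pinc : P rho <= P r by apply: primitive_le; lra.
have := annulus_area_le rho0 rhor r1 ql Pinc Hq.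
have := annulus_image rho0 rhor r1; set S := [set T z | z in _] => SE Sle.
have mS : measurable [set p : Tm * Tm | S (p.1 +i* p.2)].
  exact: measurable_annulus rho0 rhor r1.
have mD := measurable_f_disc rho0 rho1.
have small : (area (f @` D rho) <= ((2 * L * rho) ^+ 2)%:E)%E.
  apply: area_lip_image_le => // z zr.
  have := HL z 0; rewrite subr0 normc0; apply; last exact: ltW.
  exact: ltW (lt_trans zr rhor).
apply: (@le_trans _ _ (area S + area (f @` D rho))%E).
  apply: le_trans (measureU2 _ mS mD); apply: le_measure; rewrite ?inE.
  - exact: measurable_f_disc.
  - exact: measurableU.
  move=> p fp; have [|np] := pselect ((f @` D rho) (p.1 +i* p.2)); first by right.
  by left; rewrite /mkset SE; split.
apply: le_trans (leeD Sle small) _; rewrite -!EFinD lee_fin.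
have Prho : 0 <= P rho by apply: primitive_ge0; lra.
have k1 : pi *+ 2 * (P r - P rho) <= 2 * pi * P r.
  have := mulr_ge0 (pi_ge0 R) Prho; rewrite mulr2n; lra.
have k2 : (2 * L * rho) ^+ 2 <= rho * ((2 * L) ^+ 2 + 1).
  have : (2 * L) ^+ 2 * (rho * rho) <= (2 * L) ^+ 2 * (rho * 1).
    by rewrite ler_wpM2l ?sqr_ge0 // ler_wpM2l ?ltW.
  by rewrite [(2 * L * rho) ^+ 2]exprMn [rho ^+ 2]expr2; lra.
exact: lerD k1 (le_trans k2 rhod).
Qed.

(** Leaving out the small disc costs at most 2 pi times the integral up to rho, which
    is O(rho). *)
Lemma disc_area_ge :
  (forall z, normc z < 1 -> q (normc z) <=
     normc (hp z) ^+ 2 * (1 - normc lam ^+ 2 * normc z ^+ (2 * n)) * normc z) ->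
  ((2 * pi * P r)%:E <= area (f @` D r))%E.
Proof.
move=> Hq; apply/lee_addgt0Pr => d d0.
have [K K0 HK] := primitive_small.
have piK : 0 < 2 * pi * K + 1 by rewrite ltr_wpDl // !mulr_ge0 // pi_ge0.
pose rho := Num.min (r / 2) (d / (2 * pi * K + 1)).
have rho0 : 0 < rho by rewrite lt_min !divr_gt0.
have rr := r0; have rr1 := r1.
have rhor2 : rho <= r / 2 by rewrite ge_min lexx.
have rhor : rho < r by lra.
have rhod : rho * (2 * pi * K + 1) <= d by rewrite -ler_pdivlMr // ge_min lexx orbT.
have Pinc : P rho <= P r by apply: primitive_le; lra.
have := annulus_area_ge rho0 rhor r1 ql Pinc q0 Hq.
have := annulus_image rho0 rhor r1; set S := [set T z | z in _] => SE Sge.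
have SD : (area S <= area (f @` D r))%E.
  apply: le_measure; rewrite ?inE.
  - exact: measurable_annulus rho0 rhor r1.
  - exact: measurable_f_disc.
  by move=> p; rewrite /mkset SE => -[].
apply: (@le_trans _ _ (area S + d%:E)%E); last exact: leeD2r.
apply: le_trans (leeD2r d%:E Sge).
rewrite -EFinD lee_fin.
have Prho : P rho <= K * rho by apply: HK; lra.
have k1 := ler_wpM2l (ltW twopi_gt0) Prho.
have -> : 2 * pi * P r = pi *+ 2 * (P r - P rho) + pi *+ 2 * P rho.
  by rewrite -mulrDr subrK mulr_natl.
rewrite lerD2l; apply: le_trans k1 (le_trans _ rhod).
rewrite -[pi *+ 2]mulr_natl mulrA mulrC ler_wpM2l ?(ltW rho0) // lerDl.
exact: ler01.
Qed.

End Disc.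

Lemma area_growth (r : R) : 0 < r -> r < 1 ->
  ((2 * pi * \int[@lebesgue_measure R]_(x in `[0, r])
      ((1 - normc lam ^+ 2 * x ^+ (2 * n)) * (1 - x) ^+ 2 * x))%R%:E <= area (f @` D r))%E /\
  (area (f @` D r) <= (2 * pi * \int[@lebesgue_measure R]_(x in `[0%R, r])
      ((1 - normc lam ^+ 2 * x ^+ (2 * n)) * (1 + x) ^+ 2 * x))%R%:E)%E.
Proof.
move=> r0 r1.
have w0 s : 0 <= s -> s <= 1 -> 0 <= 1 - normc lam ^+ 2 * s ^+ (2 * n).
  move=> s0 s1; rewrite subr_ge0.
  have l1 : normc lam ^+ 2 <= 1 by rewrite exprn_ile1 ?normc_ge0 //; have := lam_half; lra.
  have s2 : s ^+ (2 * n) <= 1 by rewrite exprn_ile1.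
  by rewrite mulr_ile1 ?exprn_ge0 ?normc_ge0.
have lipw : lip01 (fun x : R => 1 - normc lam ^+ 2 * x ^+ (2 * n)).
  have -> : (fun x : R => 1 - normc lam ^+ 2 * x ^+ (2 * n)) =
     (fun x => 1 + - (normc lam ^+ 2) * x ^+ (2 * n)) by apply/funext => x; ring.
  apply: lip01D; first exact: lip01_cst.
  by apply: lip01M; [exact: lip01_cst|apply: lip01X; exact: lip01_id].
split.
- apply: disc_area_ge => //.
  + apply: lip01M (lip01_id R); apply: lip01M lipw _; apply: lip01X.
    have -> : (fun x : R => 1 - x) = (fun x => 1 + (-1) * x) by apply/funext => x; ring.
    apply: lip01D; first exact: lip01_cst.
    by apply: lip01M; [exact: lip01_cst|exact: lip01_id].
  + by move=> s s0 s1; exact: mulr_ge0 (mulr_ge0 (w0 s s0 s1) (sqr_ge0 _)) s0.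
  move=> z z1; have z0 := normc_ge0 z; rewrite ler_wpM2r // mulrC ler_wpM2r ?w0 ?(ltW z1) //.
  by rewrite lerXn2r ?nnegrE ?normc_ge0 ?hp_lower // subr_ge0 ltW.
apply: disc_area_le => //.
- apply: lip01M (lip01_id R); apply: lip01M lipw _; apply: lip01X.
  by apply: lip01D; [exact: lip01_cst|exact: lip01_id].
- by move=> s s0 s1; exact: mulr_ge0 (mulr_ge0 (w0 s s0 s1) (sqr_ge0 _)) s0.
move=> z z1; have z0 := normc_ge0 z; rewrite ler_wpM2r // mulrC ler_wpM2l ?w0 ?(ltW z1) //.
by rewrite lerXn2r ?nnegrE ?normc_ge0 ?hp_upper // addr_ge0.
Qed.

End HarmonicArea.

Theorem theorem6 (R : realType) (n : nat) (alpha : R) (lambda : Cplx R)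
    (f : Cplx R -> Cplx R) (r : R)
    (n_gt0 : (0 < n)%N)
    (alpha_bounds : 1 < alpha <= 3 / 2)
    (lambda_le : normc lambda <= 1 / (n%:R + 1))
    (fF : classF alpha lambda n f)
    (r_bounds : 0 < r < 1) :
  ((2 * pi * \int[lebesgue_measure]_(xi in `[0%R, r])
      ((1 - normc lambda ^+ 2 * xi ^+ (2 * n)) * (1 - xi) ^+ 2 * xi))%R%:E
     <= area (f @` disc r))%E
  /\
  (area (f @` disc r)
     <= (2 * pi * \int[lebesgue_measure]_(xi in `[0%R, r])
      ((1 - normc lambda ^+ 2 * xi ^+ (2 * n)) * (1 + xi) ^+ 2 * xi))%R%:E)%E.
Proof.
have /andP[r0 r1] := r_bounds; have /andP[_ a32] := alpha_bounds.
have [h [g [hp [gp [fE Q Lp gpE near1]]]]] := classF_data a32 fF.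
rewrite div1r in lambda_le.
have -> : f @` disc r = (fun z => h z + (g z)^*) @` [set z : R[i] | normc z < r].
  apply/seteqP; split => _ [z zr <-]; exists z => //; rewrite fE //; exact: lt_trans zr r1.
exact: (area_growth n_gt0 lambda_le Q Lp gpE near1 r0 r1).
Qed.
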